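(* Let $A$ be a fixed set of positive integers that is a finite union of arithmetic progressions, with natural density $\delta(A)$, and let $a,b$ be fixed real numbers with $0\le a<b\le1$. Then, as $n\to\infty$ through all positive integers, $$\sum_{\substack{p\ \mathrm{prime},\ n^a<p\le n^b\\ v_p(n!)\in A}} v_p(n!)\,\log p=\bigl((b-a)\,\delta(A)+o(1)\bigr)\log(n!).$$
   Context: For a prime $p$, $v_p(n!)=\sum_{j\ge1}\lfloor n/p^j\rfloor$ is the exponent of $p$ in the factorization of $n!$. Arithmetic progressions are infinite progressions $\{u+kq:k\ge0\}$ with common difference $q\ge1$, restricted to positive integers; such a progression may differ from the set of positive integers in its residue class modulo $q$ in finitely many elements. The natural density is $\delta(A)=\lim_{N\to\infty}|A\cap\{1,\dots,N\}|/N$. The set $A$ and the numbers $a,b$ are fixed independently of $n$; the $o(1)$ term is not asserted to be uniform in them. *)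

(* Defs.v *)
From mathcomp Require Import all_boot all_order all_algebra.
From mathcomp Require Import all_classical all_reals all_analysis.
Import Order.TTheory GRing.Theory Num.Theory.
Import numFieldNormedType.Exports.

Set Implicit Arguments.
Unset Strict Implicit.
Unset Printing Implicit Defensive.

Local Open Scope classical_set_scope.
Local Open Scope ring_scope.

(* The starting point u may be nonpositive; only positive terms are kept. *)
Definition arith_prog (u : int) (q : nat) : set nat :=
  [set m | (0 < m)%N /\ exists k : nat, m%:Z = u + k%:Z * q%:Z].

(* Each pair in s is (starting point, common difference). *)
Definition finite_union_of_arith_progs (A : set nat) : Prop :=
  exists s : seq (int * nat),
    (forall uq, uq \in s -> (0 < uq.2)%N) /\
    A = \big[setU/set0]_(uq <- s) arith_prog uq.1 uq.2.

Definition natural_density (R : realType) (A : set nat) : R :=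
  limn (fun N : nat => (count (fun m => m \in A) (iota 1 N))%:R / N%:R : R).

(* Main.v *)
Require Import Defs.
From mathcomp Require Import all_boot all_order all_algebra.
From mathcomp Require Import all_classical all_reals all_analysis.
From mathcomp Require Import complex ring lra zify.

(** Since v_p(n!) is the sum of the floors of n/p^j, it differs from n/p by
    O(1 + n/p^2), and a finite union of progressions is periodic from some point
    on, say with period Q.  On large values the indicator of A is therefore its
    density delta plus a Q-periodic function f of mean zero.  The density
    contributes delta * n * (the sum of log p / p over n^a < p <= n^b) up to O(n),
    which is (b - a) delta n log n + O(n) by Mertens' theorem ([mertens]), and
    log n! = n log n + O(n).  What remains is to show that the sum of
    (log p / p) f(v_p(n!)) over p <= n is o(log n) ([weighted_sum_small]), that is,
    that v_p(n!) is equidistributed modulo Q for the weight log p / p.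

    Cut the range into dyadic blocks 2^i < p <= 2^(i+1).  By Chebyshev's bound a
    block contributes O(1), and there are about log n of them, so an arbitrarily
    small proportion of the blocks may be discarded.  The discarded ones are those
    with 2^i < n^c, and those for which some power 2^(iJ) lies between n^(1-c') and
    n.  On every other block exactly the floors of n/p, ..., n/p^J matter for some
    bounded J, and the last quotient n/p^J is still larger than a power of n.

    On such a block expand f in the nontrivial characters of Z/Q
    ([fourier_inversion]); mean zero means that the trivial one is absent.  A
    character of v_p(n!) is a product over j of om^floor(n/p^j), with om a root of
    unity other than 1.  As a function of u, om^floor(u) is Q-periodic, has mean
    zero and jumps only at integers, so smoothing it with a Fejer kernel
    approximates it by trigonometric polynomials without constant term, with an
    error majorized by a small constant plus a further such polynomial
    ([floor_character_approx]).  Replacing the floors one after the other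
    ([small_floor_product]) reduces everything to the sums of
    log p * e(n (c_0 p^-j0 + c_1 p^-(j0+1) + ... )) with c_0 <> 0, where
    e(x) = exp(2 i pi x).

    These exponential sums over primes save a power of n ([prime_wave_small]).
    Vaughan's identity ([vaughan_identity]) rewrites them through sums over all
    integers, either of the same phase (type I) or, after the Cauchy-Schwarz
    inequality, of differences of such phases (type II); both are again sums of
    inverse powers with a dominant leading term ([inner_sums]).  Such a smooth
    phase is treated by K applications of van der Corput's inequality
    ([vdc_inequality]), which replace it by a phase with derivative between 0 and
    1/2, to which the Kusmin-Landau inequality ([kusmin_landau]) applies.  The
    number K of steps is bounded because p is at least a fixed power of n. *)

Import Order.TTheory GRing.Theory Num.Theory.
Import numFieldNormedType.Exports.

Set Implicit Arguments.
Unset Strict Implicit.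
Unset Printing Implicit Defensive.

Local Open Scope ring_scope.
Local Open Scope complex_scope.

(** * The additive character and summation by parts *)
Section ComplexExponential.
Variable R : realType.
Implicit Types (x y : R) (z w : R[i]).

Definition toC x : R[i] := Complex x 0.
Definition cj z : R[i] := conjc z.

(** The norm of [R[i]] takes its values in [R[i]]; [cmod] is the modulus as a
    real number, so that the order and the decision procedures of [R] apply. *)
Definition cmod z : R := Normc.normc z.

Lemma cmodM z w : cmod (z * w) = cmod z * cmod w.
Proof. exact: Normc.normcM. Qed.

Lemma cmodD z w : cmod (z + w) <= cmod z + cmod w.
Proof. exact: le_normcD. Qed.

Lemma cmodN z : cmod (- z) = cmod z.
Proof. exact: normcN. Qed.

Lemma cmodB z w : cmod (z - w) <= cmod z + cmod w.
Proof. by rewrite -(cmodN w); exact: cmodD. Qed.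

Lemma cmod0 : cmod 0 = 0. Proof. exact: Normc.normc0. Qed.
Lemma cmod1 : cmod 1 = 1. Proof. exact: Normc.normc1. Qed.

Lemma cmod_ge0 z : 0 <= cmod z.
Proof. by case: z => a b; exact: sqrtr_ge0. Qed.

Lemma cmod_toC x : cmod (toC x) = `|x|.
Proof. by rewrite /cmod /= expr0n /= addr0 sqrtr_sqr. Qed.

Lemma cmod_cj z : cmod (cj z) = cmod z.
Proof. by case: z => a b; rewrite /cmod /= sqrrN. Qed.

Lemma cmod_sum (I : Type) (r : seq I) (P : pred I) (F : I -> R[i]) :
  cmod (\sum_(i <- r | P i) F i) <= \sum_(i <- r | P i) cmod (F i).
Proof.
elim/big_rec2: _ => [|i y1 y2 _ h]; first by rewrite cmod0.
by apply: le_trans (cmodD _ _) _; rewrite lerD2l.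
Qed.

Lemma cmod_Re z : complex.Re z <= cmod z.
Proof.
case: z => a b; rewrite /cmod /=; apply: le_trans (ler_norm _) _.
by rewrite -sqrtr_sqr ler_sqrt ?addr_ge0 ?sqr_ge0 // lerDl sqr_ge0.
Qed.

Lemma toC1 : toC 1 = 1. Proof. by []. Qed.
Lemma toCD x y : toC (x + y) = toC x + toC y.
Proof. by rewrite /toC; congr Complex; rewrite /= ?addr0. Qed.
Lemma toCM x y : toC (x * y) = toC x * toC y.
Proof. by rewrite /toC; congr Complex; rewrite /= ?mulr0 ?mul0r ?subr0 ?addr0. Qed.
Lemma toC_sum (I : Type) (r : seq I) (P : pred I) (F : I -> R) :
  toC (\sum_(i <- r | P i) F i) = \sum_(i <- r | P i) toC (F i).
Proof. by elim/big_rec2: _ => // i y1 y2 _ <-; rewrite toCD. Qed.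
Lemma toC_nat n : toC n%:R = n%:R.
Proof. by elim: n => [|n IH] //; rewrite -!natr1 toCD IH. Qed.

Lemma cjM z w : cj (z * w) = cj z * cj w. Proof. exact: rmorphM. Qed.
Lemma cj_toC x : cj (toC x) = toC x.
Proof. by rewrite /cj /toC /= oppr0. Qed.
Lemma cj_sum (I : Type) (r : seq I) (P : pred I) (F : I -> R[i]) :
  cj (\sum_(i <- r | P i) F i) = \sum_(i <- r | P i) cj (F i).
Proof. exact: raddf_sum. Qed.

Lemma mul_cj z : z * cj z = toC (cmod z ^+ 2).
Proof.
case: z => a b; rewrite /cmod /= sqr_sqrtr ?addr_ge0 ?sqr_ge0 //.
by rewrite /toC; congr Complex; rewrite /=; ring.
Qed.

(** This is exp(2 i pi x), a character of the additive group with kernel the integers. *)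
Definition e x : R[i] := Complex (cos (2 * pi * x)) (sin (2 * pi * x)).

Lemma eD x y : e (x + y) = e x * e y.
Proof.
rewrite /e mulrDr; congr Complex; rewrite /=.
  by rewrite cosD.
by rewrite sinD; ring.
Qed.

Lemma e0 : e 0 = 1. Proof. by rewrite /e mulr0 cos0 sin0. Qed.

Lemma norm_e x : cmod (e x) = 1.
Proof. by rewrite /cmod /= cos2Dsin2 sqrtr1. Qed.

Lemma cj_e x : cj (e x) = e (- x).
Proof. by rewrite /cj /e /= mulrN cosN sinN. Qed.

Lemma eB x y : e (x - y) = e x * cj (e y).
Proof. by rewrite eD cj_e. Qed.

Lemma e_nat n : e n%:R = 1.
Proof.
elim: n => [|n IH]; first exact: e0.
rewrite -natr1 eD IH mul1r /e mulr1 mulr_natl.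
by rewrite -[RHS]/(Complex 1 0) cos2pi sin2pi.
Qed.

Lemma eX x n : e x ^+ n = e (n%:R * x).
Proof.
elim: n => [|n IH]; first by rewrite expr0 mul0r e0.
by rewrite exprS IH -eD -natr1; congr e; ring.
Qed.

Lemma e_int (m : int) : e m%:~R = 1.
Proof.
case: m => n; first exact: e_nat.
by rewrite NegzE mulrNz -cj_e -pmulrn e_nat -toC1 cj_toC.
Qed.

Lemma eDint x (m : int) : e (x + m%:~R) = e x.
Proof. by rewrite eD e_int mulr1. Qed.

Lemma norm_sin_le x : `|sin x| <= `|x|.
Proof.
have pos y : 0 <= y -> `|sin y| <= y.
  move=> y0; have [c _] := @MVT_segment R sin cos 0 y y0 (fun _ _ => is_derive_sin _)
    (continuous_subspaceT (@continuous_sin R)).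
  rewrite sin0 !subr0 => ->; rewrite normrM (ger0_norm y0) ler_piMl //.
  by rewrite ler_norml cos_geN1 cos_le1.
have [x0|x0] := leP 0 x; first by rewrite (ger0_norm x0); exact: pos.
rewrite (ltr0_norm x0) -{1}[x]opprK sinN normrN.
by apply: pos; rewrite oppr_ge0 ltW.
Qed.

(** The duplication formulas turn 1 - e(x) into a multiple of sin(pi x), which
    gives both bounds on the chord |1 - e(x)| in terms of |x|. *)
Lemma norm_1_e_sqr x : cmod (1 - e x) ^+ 2 = 4 * sin (pi * x) ^+ 2.
Proof.
have -> : 1 - e x = Complex (1 - cos (2 * pi * x)) (- sin (2 * pi * x)).
  by rewrite -[1]/(Complex (1:R) 0) /e; congr Complex; rewrite /= ?sub0r.
rewrite /cmod /= sqr_sqrtr ?addr_ge0 ?sqr_ge0 //.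
have -> : 2 * pi * x = (pi * x) *+ 2 :> R by rewrite mulr2n; ring.
rewrite cos_mulr2n sin_mulr2n.
have := cos2sin2 (pi * x); set c := cos _; set s := sin _ => c2.
rewrite sqrrN !mulr2n -[(c * s + c * s) ^+ 2]/((c * s + c * s) * (c * s + c * s)).
have -> : (c * s + c * s) * (c * s + c * s) = 4 * (c ^+ 2) * s ^+ 2 by ring.
by rewrite c2; ring.
Qed.

Lemma norm_1_e x : cmod (1 - e x) = 2 * `|sin (pi * x)|.
Proof.
apply/eqP; rewrite -(@eqrXn2 _ 2) ?mulr_ge0 ?cmod_ge0 //.
by rewrite norm_1_e_sqr exprMn real_normK ?num_real // -natrX.
Qed.

Lemma norm_1_e_le x : cmod (1 - e x) <= 8 * `|x|.
Proof.
rewrite norm_1_e; have := norm_sin_le (pi * x); rewrite normrM.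
have pi4 : pi <= 4 :> R by have := @pihalf_lt2 R; lra.
have pi0 := @pi_ge0 R.
rewrite (ger0_norm pi0) => h.
have : pi * `|x| <= 4 * `|x| by apply: ler_wpM2r.
lra.
Qed.

Lemma e_lip x y : cmod (e x - e y) <= 8 * `|x - y|.
Proof.
have -> : e x - e y = e x * (1 - e (y - x)).
  by rewrite mulrBr mulr1 -eD (addrC x) subrK.
by rewrite cmodM norm_e mul1r distrC; exact: norm_1_e_le.
Qed.

(** With sin y = 2 cos(y/2) sin(y/2) and the mean value theorem for sin(y/2),
    the bound reduces to cos^2(pi/4) = 1/2, as both cosines are taken at points
    of the interval from 0 to pi/4. *)
Lemma sin_ge_half y : 0 <= y <= pi / 2 -> y / 2 <= sin y.
Proof.
move=> /andP[y0 yp]; have pi0 := @pi_gt0 R.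
have pi4 : pi <= 4 :> R by have := @pihalf_lt2 R; lra.
have c4 : cos (pi / 4 : R) ^+ 2 = 2^-1.
  have := cos_mulr2n (pi / 4 : R).
  rewrite (_ : pi / 4 *+ 2 = pi / 2); last by rewrite mulr2n; lra.
  by rewrite cos_pihalf; set c := cos _ ^+ 2; rewrite mulr2n; lra.
have c4p : 0 < cos (pi / 4 : R).
  by apply: cos_gt0_pihalf; apply/andP; split; lra.
have cge (u : R) : 0 <= u <= pi / 4 -> cos (pi / 4) <= cos u.
  move=> /andP[u0 u4]; rewrite leNgt ltr_cos ?in_itv /= -?leNgt //; apply/andP; split; lra.
have [->|y0'] := eqVneq y 0; first by rewrite sin0 mul0r.
have h0 : 0 <= y / 2 by lra.
have [c] := @MVT_segment R sin cos 0 (y / 2) h0 (fun _ _ => is_derive_sin _)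
  (continuous_subspaceT (@continuous_sin R)).
rewrite in_itv /= sin0 !subr0 => /andP[c0 c2] sE.
have -> : sin y = (cos (y / 2) * sin (y / 2)) *+ 2.
  by rewrite -sin_mulr2n; congr sin; rewrite mulr2n; lra.
have h1 : cos (pi / 4) <= cos (y / 2) by apply: cge; apply/andP; split; lra.
have h2 : cos (pi / 4) <= cos c by apply: cge; apply/andP; split; lra.
have h3 : cos (pi / 4 : R) * cos (pi / 4) <= cos (y / 2) * cos c.
  by apply: ler_pM => //; exact: ltW.
rewrite -expr2 c4 in h3.
have h4 : 2^-1 * (y / 2) <= cos (y / 2) * cos c * (y / 2) by apply: ler_wpM2r.
rewrite sE mulrA; move: h4; set t := _ * _ * (y / 2) => h4.
by rewrite [t *+ 2]mulr2n; lra.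
Qed.

Lemma norm_1_e_ge x : 0 <= x -> x <= 2^-1 -> 2 * x <= cmod (1 - e x).
Proof.
move=> x0 xh; rewrite norm_1_e.
have pi2 := @pi_ge2 R; have pi0 := @pi_ge0 R.
have hs : pi * x / 2 <= sin (pi * x).
  by apply: sin_ge_half; rewrite mulr_ge0 //=; apply: ler_wpM2l.
have := ler_norm (sin (pi * x)).
have : 2 * x <= pi * x by apply: ler_wpM2r.
lra.
Qed.

(** Lagrange's identity: the difference of the two sides is half of the sum of
    the squares (a_i b_j - a_j b_i)^2. *)
Lemma cauchy_schwarz (I : Type) (r : seq I) (a b : I -> R) :
  (\sum_(i <- r) a i * b i) ^+ 2
    <= (\sum_(i <- r) a i ^+ 2) * (\sum_(i <- r) b i ^+ 2).
Proof.
have H : 0 <= \sum_(i <- r) \sum_(j <- r) (a i * b j - a j * b i) ^+ 2.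
  by apply: sumr_ge0 => i _; apply: sumr_ge0 => j _; exact: sqr_ge0.
have E : \sum_(i <- r) \sum_(j <- r) (a i * b j - a j * b i) ^+ 2
  = 2 * ((\sum_(i <- r) a i ^+ 2) * (\sum_(i <- r) b i ^+ 2))
    - 2 * (\sum_(i <- r) a i * b i) ^+ 2.
  under eq_bigr => i _.
    under eq_bigr => j _.
      rewrite (_ : _ ^+ 2 = a i ^+ 2 * b j ^+ 2 + b i ^+ 2 * a j ^+ 2
        - 2 * ((a i * b i) * (a j * b j))); last by ring.
      over.
    rewrite big_split /= sumrN -!mulr_sumr big_split /= -!mulr_sumr.
    over.
  rewrite big_split /= sumrN -mulr_sumr big_split /= -!mulr_suml; ring.
move: H; rewrite E subr_ge0; lra.
Qed.

(** Summation by parts: the decreasing weights w telescope, so that all partial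
    sums together contribute only w a times their common bound. *)
Lemma abel_antitone (w : nat -> R) (x : nat -> R[i]) (a b : nat) (B : R) :
  (a < b)%N ->
  (forall k, (a <= k < b)%N -> 0 <= w k) ->
  (forall k, (a <= k)%N -> (k.+1 < b)%N -> w k.+1 <= w k) ->
  (forall c, (a <= c <= b)%N -> cmod (\sum_(a <= k < c) x k) <= B) ->
  cmod (\sum_(a <= k < b) toC (w k) * x k) <= w a * B.
Proof.
move=> ab w0 wdec hB.
pose S c := \sum_(a <= k < c) x k.
(* The part of the sum left after summation by parts, bounded by the variation of w. *)
have key c : (a <= c < b)%N ->
    cmod (\sum_(a <= k < c.+1) toC (w k) * x k - toC (w c) * S c.+1)
    <= (w a - w c) * B.
  elim: c => [|c IH] /andP[ac cb].
    move: ac; rewrite leqn0 => /eqP a0; rewrite /S a0 !big_nat1 !subrr mul0r.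
    by rewrite cmod0.
  move: ac; rewrite leq_eqVlt => /orP[/eqP <-|ac].
    by rewrite /S !big_nat1 !subrr mul0r cmod0.
  have {IH} := IH (introT andP (conj ac (ltnW cb))).
  have := hB c.+1 (introT andP (conj (leqW ac) (ltnW cb))).
  rewrite -/(S c.+1) => hS IH.
  have -> : S c.+2 = S c.+1 + x c.+1 by rewrite /S big_nat_recr //= ltnW.
  rewrite big_nat_recr; last exact: ltnW.
  set T := \sum_(a <= k < c.+1) _ in IH *.
  have -> : T + toC (w c.+1) * x c.+1 - toC (w c.+1) * (S c.+1 + x c.+1)
    = (T - toC (w c) * S c.+1) + toC (w c - w c.+1) * S c.+1.
    have -> : toC (w c - w c.+1) = toC (w c) - toC (w c.+1).
      by rewrite /toC; congr Complex; rewrite /= ?subr0.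
    ring.
  apply: le_trans (cmodD _ _) _.
  have dw : 0 <= w c - w c.+1 by rewrite subr_ge0; exact: wdec.
  rewrite cmodM cmod_toC (ger0_norm dw).
  have : (w c - w c.+1) * cmod (S c.+1) <= (w c - w c.+1) * B by apply: ler_wpM2l.
  move: IH; lra.
case: b ab w0 wdec hB key => // b ab w0 wdec hB key.
have := key b; rewrite ltnSn andbT => /(_ ab).
have hS : cmod (S b.+1) <= B by apply: hB; rewrite leqnn (ltnW ab).
set T := \sum_(a <= k < b.+1) _ => h.
have -> : T = (T - toC (w b) * S b.+1) + toC (w b) * S b.+1 by ring.
apply: le_trans (cmodD _ _) _.
have wb : 0 <= w b by apply: w0; rewrite ltnSn andbT.
rewrite cmodM cmod_toC (ger0_norm wb).
have : w b * cmod (S b.+1) <= w b * B by apply: ler_wpM2l.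
lra.
Qed.

(** Apply the antitone case to W - w, at the cost of a factor 2. *)
Lemma abel_isotone (w : nat -> R) (x : nat -> R[i]) (a b : nat) (B W : R) :
  (a < b)%N -> (forall k, (a <= k < b)%N -> 0 <= w k <= W) ->
  (forall k, (a <= k)%N -> (k.+1 < b)%N -> w k <= w k.+1) ->
  (forall c, (a <= c <= b)%N -> cmod (\sum_(a <= k < c) x k) <= B) ->
  cmod (\sum_(a <= k < b) toC (w k) * x k) <= 2 * (W * B).
Proof.
move=> ab w0 winc hB.
have hBb : cmod (\sum_(a <= k < b) x k) <= B by apply: hB; rewrite leqnn ltnW.
have B0 : 0 <= B by exact: le_trans (cmod_ge0 _) hBb.
have /andP[wa0 waW] : 0 <= w a <= W by apply: w0; rewrite leqnn.
have W0 : 0 <= W by exact: le_trans wa0 waW.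
have h : cmod (\sum_(a <= k < b) toC (W - w k) * x k) <= (W - w a) * B.
  apply: (@abel_antitone (fun k => W - w k)) => // k.
    by move=> /w0 /andP[]; lra.
  by move=> ak kb; have := winc k ak kb; lra.
have -> : \sum_(a <= k < b) toC (w k) * x k
  = toC W * (\sum_(a <= k < b) x k) - \sum_(a <= k < b) toC (W - w k) * x k.
  rewrite mulr_sumr -sumrB; apply: eq_bigr => k _; rewrite -mulrBl; congr (_ * _).
  by rewrite /toC; congr Complex; rewrite /= ?subr0; ring.
apply: le_trans (cmodB _ _) _.
rewrite cmodM cmod_toC (ger0_norm W0).
have : W * cmod (\sum_(a <= k < b) x k) <= W * B by apply: ler_wpM2l.
have : (W - w a) * B <= W * B by apply: ler_wpM2r; lra.
lra.
Qed.
End ComplexExponential.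

(** * The Kusmin-Landau inequality *)
Section KusminLandau.
Variable R : realType.

(** The variation of 1/(1 - e(x)) on an interval of (0, 1/2] is controlled by that
    of the monotone function 1/x, which telescopes along a monotone sequence. *)
Lemma inv_1_e_lip (s t : R) : 0 < t -> t <= s -> s <= 2^-1 ->
  cmod ((1 - e s)^-1 - (1 - e t)^-1) <= 2 * (t^-1 - s^-1).
Proof.
move=> t0 ts s2; have s0 : 0 < s by exact: lt_le_trans ts.
have As : 2 * s <= cmod (1 - e s).
  by apply: norm_1_e_ge; rewrite ?(ltW s0).
have At : 2 * t <= cmod (1 - e t).
  by apply: norm_1_e_ge; rewrite ?(ltW t0) //; lra.
have ns : 1 - e s != 0 by apply: contraTneq As => ->; rewrite cmod0 -ltNge; lra.
have nt : 1 - e t != 0 by apply: contraTneq At => ->; rewrite cmod0 -ltNge; lra.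
have -> : (1 - e s)^-1 - (1 - e t)^-1 = (e s - e t) * ((1 - e s) * (1 - e t))^-1.
  by field; rewrite ns nt.
rewrite cmodM /cmod Normc.normcV Normc.normcM -!/(cmod _).
have B : 0 < 4 * (s * t) by rewrite !mulr_gt0.
have B' : 4 * (s * t) <= cmod (1 - e s) * cmod (1 - e t).
  rewrite (_ : 4 * (s * t) = (2 * s) * (2 * t)); last by ring.
  by apply: ler_pM => //; rewrite mulr_ge0 // ltW.
have -> : 2 * (t^-1 - s^-1) = (8 * (s - t)) * (4 * (s * t))^-1.
  by field; rewrite !gt_eqF.
apply: ler_pM; rewrite ?cmod_ge0 ?invr_ge0 ?mulr_ge0 ?cmod_ge0 //.
  by have := e_lip s t; rewrite ger0_norm ?subr_ge0.
by rewrite lef_pV2 // posrE //; exact: lt_le_trans B'.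
Qed.

(** Write e(x_k) = c_k (e(x_k) - e(x_(k+1))) with c_k = 1/(1 - e(x_(k+1) - x_k)) and
    sum by parts: the boundary terms are at most 1/(2 theta) each, and
    [inv_1_e_lip] bounds the variation of the c_k by 2/theta. *)
Lemma kusmin_landau (x : nat -> R) (a b : nat) (theta : R) : 0 < theta ->
  (forall k, (a <= k < b)%N -> theta <= x k.+1 - x k <= 2^-1) ->
  (forall k, (a <= k)%N -> (k.+1 < b)%N -> x k.+2 - x k.+1 <= x k.+1 - x k) ->
  cmod (\sum_(a <= k < b) e (x k)) <= 3 / theta.
Proof.
move=> th0 hd hdec.
have [ba|ab] := leqP b a; first by rewrite big_geq // cmod0 divr_ge0 // ltW.
pose d k := x k.+1 - x k.
pose c k : R[i] := (1 - e (d k))^-1.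
have dpos k : (a <= k < b)%N -> 0 < d k.
  by move=> /hd /andP[h _]; exact: lt_le_trans h.
have dlow k : (a <= k < b)%N -> 2 * d k <= cmod (1 - e (d k)).
  move=> kab; have k0 := dpos k kab; have /andP[_ k2] := hd k kab.
  by apply: norm_1_e_ge; rewrite ?(ltW k0).
have cn k : (a <= k < b)%N -> cmod (c k) <= (2 * theta)^-1.
  move=> kab; have k0 := dpos k kab; have kl := dlow k kab.
  rewrite /c /cmod Normc.normcV -/(cmod _).
  have /andP[h _] := hd k kab; rewrite -/(d k) in h.
  by rewrite lef_pV2 ?posrE ?mulr_gt0 //; lra.
have ek k : (a <= k < b)%N -> e (x k) = c k * (e (x k) - e (x k.+1)).
  move=> kab; have k0 := dpos k kab; have kl := dlow k kab.
  have nz : 1 - e (d k) != 0.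
    by apply: contraTneq kl => ->; rewrite cmod0 -ltNge mulr_gt0.
  have -> : e (x k.+1) = e (x k) * e (d k) by rewrite -eD /d addrC subrK.
  by rewrite /c; field.
have key n : (a + n < b)%N ->
    cmod (\sum_(a <= k < (a + n).+1) e (x k) + c (a + n)%N * e (x (a + n).+1))
    <= (2 * theta)^-1 + 2 * ((d (a + n)%N)^-1 - (d a)^-1).
  elim: n => [|n IH] anb.
    rewrite addn0 big_nat1 (ek a) ?leqnn //.
    have -> : c a * (e (x a) - e (x a.+1)) + c a * e (x a.+1) = c a * e (x a) by ring.
    by rewrite cmodM norm_e mulr1 subrr mulr0 addr0 cn // leqnn.
  have /IH {}IH : (a + n < b)%N by lia.
  rewrite addnS; set m := (a + n)%N in anb IH *.
  have am : (a <= m)%N by rewrite leq_addr.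
  have mab : (a <= m < b)%N by rewrite am /=; lia.
  have mab' : (a <= m.+1 < b)%N by rewrite /m; lia.
  rewrite big_nat_recr; last by rewrite /m; lia.
  rewrite (ek m.+1 mab').
  set T := \sum_(a <= k < m.+1) _ in IH *.
  have -> : T + c m.+1 * (e (x m.+1) - e (x m.+2)) + c m.+1 * e (x m.+2)
     = (T + c m * e (x m.+1)) - (c m - c m.+1) * e (x m.+1) by ring.
  apply: le_trans (cmodB _ _) _; rewrite cmodM norm_e mulr1.
  have : cmod (c m - c m.+1) <= 2 * ((d m.+1)^-1 - (d m)^-1).
    apply: inv_1_e_lip; first exact: dpos.
      by apply: hdec => //; have /andP[] := mab'.
    by have /andP[] := hd m mab.
  move: IH; lra.
case: b ab hd hdec dpos dlow cn ek key => // b ab hd hdec dpos dlow cn ek key.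
have bab : (a <= b < b.+1)%N by rewrite leqnn andbT.
have aab : (a <= a < b.+1)%N by rewrite leqnn ltnS.
have abE : (a + (b - a) = b)%N by lia.
have := key (b - a)%N; rewrite abE ltnSn => /(_ isT); set T := \sum_(a <= k < b.+1) _ => h.
have -> : T = (T + c b * e (x b.+1)) - c b * e (x b.+1) by ring.
apply: le_trans (cmodB _ _) _; rewrite [cmod (c b * _)]cmodM norm_e mulr1.
have hc := cn b bab.
have : (d b)^-1 <= theta^-1.
  by rewrite lef_pV2 ?posrE ?dpos //; have /andP[] := hd b bab.
have : 0 < (d a)^-1 by rewrite invr_gt0 dpos.
have e1 : (2 * theta)^-1 = 2^-1 * theta^-1 by rewrite invfM.
by move: h hc; rewrite e1; lra.
Qed.
End KusminLandau.

(** * Van der Corput's differencing inequality *)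
Section VanDerCorput.
Variable R : realType.

Lemma sum_shift (V : nmodType) (f : nat -> V) (a b H h : nat) :
  (forall m, ~~ (a <= m < b)%N -> f m = 0) -> (h <= H)%N -> (H <= a)%N ->
  \sum_(a - H <= k < b) f (k + h)%N = \sum_(a <= m < b) f m.
Proof.
move=> f0 hH Ha.
have -> : \sum_(a - H <= k < b) f (k + h)%N = \sum_((a - H) + h <= m < b + h) f m.
  by rewrite big_addn addnK.
have [ba|ab] := leqP b a.
  rewrite [RHS]big_geq // big1_seq // => m _; apply: f0.
  by apply/negP => /andP[am mb]; lia.
rewrite (big_cat_nat (n := a)) /=; [|lia|lia].
rewrite big_nat_cond big1 ?add0r; last first.
  by move=> m /andP[/andP[_ ma] _]; apply: f0; rewrite leqNgt ma.
rewrite (big_cat_nat (n := b)) /=; [|lia|lia].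
rewrite [X in _ + X]big_nat_cond [X in _ + X]big1 ?addr0 //.
by move=> m /andP[/andP[bm _] _]; apply: f0; rewrite [(m < b)%N]ltnNge bm andbF.
Qed.

Lemma sum_between (lo hi n : nat) :
  (\sum_(0 <= k < n | (lo <= k < hi)%N) 1 <= hi - lo)%N.
Proof.
suff -> : (\sum_(0 <= k < n | (lo <= k < hi)%N) 1 = minn n hi - minn n lo)%N by lia.
elim: n => [|n IH]; first by rewrite big_geq // !min0n.
by rewrite big_mkcond big_nat_recr //= -big_mkcond /= IH; case: ifP; lia.
Qed.

(** Average the sum S over its translates by h < H = H0 * q, apply the
    Cauchy-Schwarz inequality and open the square: S^2 is bounded by the mean of the
    correlations of shifts h and h', up to the factor 2 M.  At most a proportion 2/q of
    the pairs are closer than H0, and they are bounded trivially; the others are controlled by E.  Excluding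
    the pairs at distance less than H0, and not only the diagonal, keeps the
    derivative of the differenced phase within a factor q. *)
Lemma vdc_inequality (F : nat -> R) (M H0 q : nat) (E : R) :
  (0 < H0)%N -> (0 < q)%N -> (H0 * q <= M)%N -> 0 <= E ->
  (forall h a b, (H0 <= h < H0 * q)%N -> (M <= a)%N -> (b <= 2 * M)%N ->
    cmod (\sum_(a <= m < b) e (F (m + h)%N - F m)) <= M%:R * E) ->
  forall a b, (M <= a)%N -> (b <= 2 * M)%N ->
  cmod (\sum_(a <= m < b) e (F m)) ^+ 2 <= 2 * M%:R ^+ 2 * (2 / q%:R + E).
Proof.
move=> H00 q0 HM E0 hE a b Ma bM.
pose H := (H0 * q)%N; rewrite -/H in HM.
have H_gt0 : (0 < H)%N by rewrite muln_gt0 H00.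
have [ba|ab] := leqP b a.
  rewrite big_geq // cmod0 expr0n /=.
  by rewrite !mulr_ge0 ?addr_ge0 ?exprn_ge0 ?divr_ge0.
(* Extending the summand by zero makes every translate a sum over one common range. *)
pose y m : R[i] := if (a <= m < b)%N then e (F m) else 0.
have y0 m : ~~ (a <= m < b)%N -> y m = 0 by rewrite /y => /negbTE ->.
have Ha : (H <= a)%N by exact: leq_trans Ma.
pose S := \sum_(a <= m < b) e (F m).
have SE h : (h < H)%N -> S = \sum_(a - H <= k < b) y (k + h)%N.
  move=> hH; rewrite (sum_shift (H := H) (h := h) y0 (ltnW hH) Ha).
  by rewrite /S; apply: eq_big_nat => m mab; rewrite /y mab.
pose Y k := \sum_(0 <= h < H) y (k + h)%N.
have HS : toC H%:R * S = \sum_(a - H <= k < b) Y k.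
  rewrite /Y exchange_big_nat /= (eq_big_nat _ _ (F2 := fun=> S)); last first.
    by move=> h /andP[_ hH]; rewrite -SE.
  by rewrite sumr_const_nat subn0 toC_nat mulr_natl.
(* Correlation of the shifts h and h'. *)
pose G h h' := \sum_(a - H <= k < b) y (k + h)%N * cj (y (k + h')%N).
have Gsym h h' : G h' h = cj (G h h').
  rewrite /G cj_sum; apply: eq_bigr => k _.
  by rewrite cjM [cj (cj _)]conjcK mulrC.
have bH : (b - (a - H) <= 2 * M)%N by lia.
have yn m : cmod (y m) <= 1.
  by rewrite /y; case: ifP => _; rewrite ?norm_e ?cmod0.
have Gtriv h h' : (h < H)%N -> cmod (G h h') <= M%:R.
  move=> hH; apply: le_trans (cmod_sum _ _ _) _.
  pose g m : R := if (a <= m < b)%N then 1 else 0.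
  have g0 m : ~~ (a <= m < b)%N -> g m = 0 by rewrite /g => /negbTE ->.
  have gE : \sum_(a - H <= k < b) g (k + h)%N <= M%:R.
    rewrite (sum_shift g0 (ltnW hH) Ha).
    rewrite (eq_big_nat _ _ (F2 := fun=> 1)); last by move=> m mab; rewrite /g mab.
    by rewrite sumr_const_nat ler_nat; lia.
  apply: le_trans gE; apply: ler_sum => k _; rewrite cmodM cmod_cj /g.
  case: ifPn => hk; last by rewrite y0 // cmod0 mul0r.
  by rewrite -[leRHS]mulr1; apply: ler_pM; rewrite ?cmod_ge0.
have Gfar h h' : (h + H0 <= h')%N -> (h' < H)%N -> cmod (G h h') <= M%:R * E.
  move=> hh h'H; pose r := (h' - h)%N.
  have hh' : h' = (h + r)%N by rewrite /r; lia.
  have -> : G h h' = \sum_(a <= m < b) y m * cj (y (m + r)%N).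
    pose g m := y m * cj (y (m + r)%N).
    have g0 m : ~~ (a <= m < b)%N -> g m = 0 by rewrite /g => /y0 ->; rewrite mul0r.
    have hH : (h <= H)%N by lia.
    rewrite -[RHS](sum_shift g0 hH Ha).
    by apply: eq_bigr => k _; rewrite hh' addnA.
  have [br|rb] := leqP (b - r) a.
    rewrite big_nat_cond big1 ?cmod0 ?mulr_ge0 // => m /andP[/andP[am mb] _].
    rewrite [y (m + r)%N]y0; first by rewrite /cj conjc0 mulr0.
    by apply/negP; lia.
  rewrite (big_cat_nat (n := (b - r)%N)) /=; [|lia|lia].
  rewrite [X in _ + X]big_nat_cond [X in _ + X]big1 ?addr0; last first.
    move=> m /andP[/andP[bm mb] _]; rewrite [y (m + r)%N]y0.
      by rewrite /cj conjc0 mulr0.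
    by apply/negP; lia.
  rewrite (eq_big_nat _ _ (F2 := fun m => cj (e (F (m + r)%N - F m)))); last first.
    move=> m /andP[am mb]; rewrite eB cjM [cj (cj _)]conjcK mulrC.
    have -> : y m = e (F m) by rewrite /y ifT //; lia.
    by have -> : y (m + r)%N = e (F (m + r)%N) by rewrite /y ifT //; lia.
  by rewrite -cj_sum cmod_cj; apply: hE => //; rewrite /r -/H; lia.
have Gb h h' : (h < H)%N -> (h' < H)%N -> cmod (G h h') <=
    (if (h < h' + H0)%N && (h' < h + H0)%N then M%:R else 0) + M%:R * E.
  move=> hH h'H.
  have ME0 : 0 <= M%:R * E :> R by rewrite mulr_ge0.
  case: ifPn => [_|]; first by rewrite ler_wpDr // Gtriv.
  rewrite negb_and -!leqNgt add0r => /orP[] hh; last exact: Gfar.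
  by rewrite Gsym cmod_cj; exact: Gfar.
have near h : (h < H)%N ->
   \sum_(0 <= h' < H) (if (h < h' + H0)%N && (h' < h + H0)%N then M%:R else 0 : R)
     <= 2 * H0%:R * M%:R.
  move=> hH; rewrite -big_mkcond /=.
  have -> : \sum_(0 <= h' < H | (h < h' + H0)%N && (h' < h + H0)%N) M%:R
     = M%:R * (\sum_(0 <= h' < H | (h < h' + H0)%N && (h' < h + H0)%N) 1)%N%:R :> R.
    by rewrite natr_sum mulr_sumr; apply: eq_bigr => *; rewrite mulr1.
  rewrite mulrC; apply: ler_wpM2r => //; rewrite -natrM ler_nat.
  rewrite (eq_bigl (fun h' => (h.+1 - H0 <= h' < h + H0)%N)); last by move=> h'; lia.
  by apply: leq_trans (sum_between _ _ _) _; lia.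
have sqY : \sum_(a - H <= k < b) cmod (Y k) ^+ 2
    <= H%:R * (2 * H0%:R * M%:R) + H%:R ^+ 2 * (M%:R * E).
  have pos : 0 <= \sum_(a - H <= k < b) cmod (Y k) ^+ 2.
    by apply: sumr_ge0 => k _; exact: sqr_ge0.
  rewrite -(ger0_norm pos) -cmod_toC toC_sum.
  have -> : \sum_(a - H <= k < b) toC (cmod (Y k) ^+ 2)
      = \sum_(0 <= h < H) \sum_(0 <= h' < H) G h h'.
    under eq_bigr => k _.
      rewrite -mul_cj /Y cj_sum big_distrl /=.
      under eq_bigr => h _ do rewrite big_distrr /=.
      over.
    rewrite exchange_big_nat; apply: eq_bigr => h _ /=.
    by rewrite exchange_big_nat.
  apply: le_trans (cmod_sum _ _ _) _.
  apply: (@le_trans _ _ (\sum_(0 <= h < H) (2 * H0%:R * M%:R + H%:R * (M%:R * E)))).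
    apply: ler_sum_nat => h /andP[_ hH]; apply: le_trans (cmod_sum _ _ _) _.
    apply: (@le_trans _ _ (\sum_(0 <= h' < H)
       ((if (h < h' + H0)%N && (h' < h + H0)%N then M%:R else 0) + M%:R * E))).
      by apply: ler_sum_nat => h' /andP[_ h'H]; exact: Gb.
    rewrite big_split /= sumr_const_nat subn0 -[(_ * E) *+ _]mulr_natl.
    by rewrite lerD2r near.
  rewrite sumr_const_nat subn0 -[leLHS]mulr_natl mulrDr.
  by rewrite lerD2l mulrA -expr2.
have CS : (H%:R * cmod S) ^+ 2 <= (2 * M%:R) * \sum_(a - H <= k < b) cmod (Y k) ^+ 2.
  have h1 : H%:R * cmod S <= \sum_(a - H <= k < b) 1 * cmod (Y k).
    have := cmod_sum (index_iota (a - H) b) xpredT Y; rewrite -HS cmodM cmod_toC.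
    rewrite ger0_norm // => h; apply: le_trans h _.
    by apply: ler_sum => k _; rewrite mul1r.
  have h2 : (H%:R * cmod S) ^+ 2 <= (\sum_(a - H <= k < b) 1 * cmod (Y k)) ^+ 2.
    rewrite lerXn2r ?nnegrE ?mulr_ge0 ?cmod_ge0 //.
    by apply: sumr_ge0 => k _; rewrite mul1r cmod_ge0.
  apply: le_trans h2 _; apply: le_trans (cauchy_schwarz _ _ _) _.
  apply: ler_wpM2r; first by apply: sumr_ge0 => k _; exact: sqr_ge0.
  rewrite expr1n sumr_const_nat -natrM ler_nat.
  exact: bH.
have Hp : 0 < H%:R :> R by rewrite ltr0n.
have qp : 0 < q%:R :> R by rewrite ltr0n.
have H0p : 0 < H0%:R :> R by rewrite ltr0n.
rewrite -/S -(ler_pM2l (exprn_gt0 2 Hp)) -exprMn.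
apply: le_trans CS _.
apply: le_trans (ler_wpM2l _ sqY) _; first by rewrite mulr_ge0.
by rewrite /H natrM le_eqVlt; apply/orP; left; apply/eqP; field; rewrite gt_eqF.
Qed.
End VanDerCorput.

(** * The derivative test of order K + 1 *)
Section DerivativeTest.
Variable R : realType.
Implicit Types (F : nat -> R -> R).

(** A function F 0 together with all its derivatives, as one sequence: differencing
    then acts on the whole sequence ([diff_towerP]), which is what the induction on
    the number of differencing steps needs. *)
Definition tower F := forall i (x : R), 0 < x -> is_derive x 1 (F i) (F i.+1 x).

Lemma tower_MVT F i (x y : R) : tower F -> 0 < x -> x <= y ->
  exists c, [/\ x <= c, c <= y & F i y - F i x = F i.+1 c * (y - x)].
Proof.
move=> tF x0 xy.
have [||c] := @MVT_segment R (F i) (F i.+1) x y xy.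
- move=> t; rewrite in_itv /= => /andP[xt _]; apply: tF; exact: lt_trans xt.
- apply: derivable_within_continuous => t; rewrite in_itv /= => /andP[xt _].
  have [] := tF i t (lt_le_trans x0 xt) => h _; exact: h.
by rewrite in_itv /= => /andP[xc cy] ->; exists c.
Qed.

Definition diff_tower (h : R) F i x := F i (x + h) - F i x.

Lemma diff_towerP h F : 0 <= h -> tower F -> tower (diff_tower h F).
Proof.
move=> h0 tF i x x0.
have D1 : is_derive (x + h) 1 (F i) (F i.+1 (x + h)) by apply: tF; lra.
have D2 : is_derive x 1 (F i) (F i.+1 x) by apply: tF.
have D3 : is_derive x 1 (fun t => t + h) 1.
  by rewrite -[X in is_derive _ _ _ X]addr0; exact: is_deriveD.
have D4 : is_derive x 1 (F i \o (fun t => t + h)) (F i.+1 (x + h) * 1).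
  exact: is_derive1_comp.
rewrite /diff_tower; rewrite mulr1 in D4.
exact: is_deriveB.
Qed.

(** Each of the K differencing steps with shift h between H0 and H0 * q multiplies
    the derivative of the next lower order by h (mean value theorem) and halves the
    exponent of the saving; this is why q has to exceed z^(2^K).  After K steps the
    derivative of the phase lies between lo * H0^K and hi * (H0 * q)^K <= 1/2 and
    decreases, and the Kusmin-Landau bound 3/(lo * H0^K) is at most M/q.
    The bounds are required up to (K + 2) M because every step extends the range by
    a shift, which is at most M. *)
Lemma derivative_test K : forall F (lo hi : R) (M H0 q z : nat), tower F ->
  (0 < z)%N -> (0 < H0)%N -> (z ^ (2 ^ K) <= q)%N -> (H0 * q <= M)%N -> 0 < lo ->
  (forall x, M%:R <= x <= K.+2%:R * M%:R -> lo <= F K.+1 x <= hi) ->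
  (forall x, M%:R <= x <= K.+2%:R * M%:R -> F K.+2 x <= 0) ->
  hi * (H0 * q)%:R ^+ K <= 2^-1 ->
  3 * q%:R <= lo * H0%:R ^+ K * M%:R ->
  forall a b, (M <= a)%N -> (b <= 2 * M)%N ->
  cmod (\sum_(a <= m < b) e (F 0%N m%:R)) <= 8 * M%:R / z%:R.
Proof.
elim: K => [|K IH] F lo hi M H0 q z tF z0 H00 zq HM lo0 hF hF' hhi hlo a b Ma bM.
  have q0 : (0 < q)%N by apply: leq_trans zq; rewrite expn_gt0 z0.
  have M0 : (0 < M)%N by apply: leq_trans HM; rewrite muln_gt0 H00.
  have dom (x : R) : a%:R <= x -> x <= b%:R -> M%:R <= x <= 2 * M%:R.
    move=> ax xb; apply/andP; split.
      by apply: le_trans ax; rewrite ler_nat.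
    by apply: le_trans xb _; rewrite -natrM ler_nat.
  rewrite !expr0 !mulr1 in hhi hlo.
  have kp k : (a <= k)%N -> 0 < k%:R :> R by rewrite ltr0n; lia.
  have S1 k : k%:R <= k.+1%:R :> R by rewrite ler_nat.
  have h : cmod (\sum_(a <= m < b) e (F 0%N m%:R)) <= 3 / lo.
    apply: (@kusmin_landau R (fun m => F 0%N m%:R)) => //.
      move=> k /andP[ak kb].
      have [c [kc ck ->]] := @tower_MVT F 0 k%:R k.+1%:R tF (kp k ak) (S1 k).
      rewrite -natrB // subSnn mulr1.
      have cD : M%:R <= c <= 2 * M%:R.
        by apply: dom; [apply: le_trans kc|apply: le_trans ck _]; rewrite ler_nat.
      have /andP[-> h2] := hF c cD; exact: le_trans hhi.
    move=> k ak kb.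
    have [c [kc ck ->]] := @tower_MVT F 0 k%:R k.+1%:R tF (kp k ak) (S1 k).
    have [d [kd dk ->]] := @tower_MVT F 0 k.+1%:R k.+2%:R tF (kp _ (leqW ak)) (S1 _).
    rewrite -!natrB // !subSnn !mulr1 -subr_le0.
    have c0 : 0 < c by apply: lt_le_trans kc; exact: kp.
    have cd : c <= d by exact: le_trans kd.
    have [u [cu ud ->]] := @tower_MVT F 1 c d tF c0 cd.
    apply: mulr_le0_ge0; last by rewrite subr_ge0.
    apply: hF'; apply: dom.
      by apply: le_trans cu; apply: le_trans kc; rewrite ler_nat.
    by apply: le_trans ud _; apply: le_trans dk _; rewrite ler_nat.
  apply: le_trans h _.
  have zp : 0 < z%:R :> R by rewrite ltr0n.
  rewrite ler_pdivrMr // mulrAC ler_pdivlMr // -mulrA [M%:R * lo]mulrC.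
  have : z%:R <= q%:R :> R by rewrite ler_nat; move: zq; rewrite expn0 expn1.
  have : 0 <= lo * M%:R by rewrite mulr_ge0 // ltW.
  lra.
have q0 : (0 < q)%N by apply: leq_trans zq; rewrite expn_gt0 z0.
have M0 : 0 < M%:R :> R.
  by rewrite ltr0n; apply: leq_trans HM; rewrite muln_gt0 H00.
have z2q : (z ^ 2 <= q)%N.
  by apply: leq_trans zq; apply: leq_pexp2l => //; rewrite expnS leq_pmulr // expn_gt0.
have hstep : forall h a' b', (H0 <= h < H0 * q)%N -> (M <= a')%N -> (b' <= 2 * M)%N ->
    cmod (\sum_(a' <= m < b') e (F 0%N (m + h)%:R - F 0%N m%:R)) <= M%:R * (8 / (z ^ 2)%:R).
  move=> h a' b' /andP[H0h hH] Ma' b'M.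
  have hp : 0 <= h%:R :> R by [].
  have := IH (diff_tower h%:R F) (H0%:R * lo) ((H0 * q)%:R * hi) M H0 q (z ^ 2)%N
    (diff_towerP hp tF).
  rewrite expn_gt0 z0 -expnM -expnS => /(_ isT H00 zq HM).
  have Hlo : 0 < H0%:R * lo by rewrite mulr_gt0 // ltr0n.
  have dom (x c : R) : M%:R <= x <= K.+2%:R * M%:R -> x <= c -> c <= x + h%:R ->
      M%:R <= c <= K.+3%:R * M%:R.
    move=> /andP[Mx xM] xc ch; rewrite (le_trans Mx xc) /=.
    apply: le_trans ch _; rewrite -natr1 mulrDl mul1r; apply: lerD => //.
    by rewrite ler_nat; apply: leq_trans HM; exact: ltnW.
  move=> /(_ Hlo); have -> : M%:R * (8 / (z ^ 2)%:R) = 8 * M%:R / (z ^ 2)%:R :> R.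
    by rewrite mulrA [_ * 8]mulrC.
  have -> : \sum_(a' <= m < b') e (F 0%N (m + h)%:R - F 0%N m%:R)
    = \sum_(a' <= m < b') e (diff_tower h%:R F 0 m%:R).
    by apply: eq_bigr => m _; rewrite /diff_tower natrD.
  apply => //.
  - move=> x xM; have x0 : 0 < x by case/andP: xM => h1 _; exact: lt_le_trans h1.
    have xh : x <= x + h%:R by rewrite lerDl.
    have [c [xc ch]] := @tower_MVT F K.+1 x (x + h%:R) tF x0 xh.
    rewrite /diff_tower => ->; rewrite addrAC subrr add0r.
    have /andP[l1 l2] := hF c (dom x c xM xc ch).
    have H0hR : H0%:R <= h%:R :> R by rewrite ler_nat.
    have hHR : h%:R <= (H0 * q)%:R :> R by rewrite ler_nat ltnW.
    rewrite [_ * h%:R]mulrC; apply/andP; split.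
      by apply: ler_pM => //; exact: ltW.
    apply: ler_pM => //; exact: le_trans (ltW lo0) l1.
  - move=> x xM; have x0 : 0 < x by case/andP: xM => h1 _; exact: lt_le_trans h1.
    have xh : x <= x + h%:R by rewrite lerDl.
    have [c [xc ch]] := @tower_MVT F K.+2 x (x + h%:R) tF x0 xh.
    rewrite /diff_tower => ->; rewrite addrAC subrr add0r.
    by apply: mulr_le0_ge0 => //; exact: hF' (dom x c xM xc ch).
  - by apply: le_trans hhi; rewrite exprS le_eqVlt; apply/orP; left; apply/eqP; ring.
  - by apply: le_trans hlo _; rewrite exprS le_eqVlt; apply/orP; left; apply/eqP; ring.
have E0 : 0 <= 8 / (z ^ 2)%:R :> R by rewrite divr_ge0.
have zp : 0 < z%:R :> R by rewrite ltr0n.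
have := vdc_inequality H00 q0 HM E0 hstep Ma bM.
set S := cmod _ => hS.
rewrite -(@ler_pXn2r _ 2) ?nnegrE ?cmod_ge0 ?divr_ge0 ?mulr_ge0 //; last first.
apply: le_trans hS _.
have qz : q%:R^-1 <= (z%:R ^+ 2)^-1 :> R.
  by rewrite lef_pV2 ?posrE ?exprn_gt0 ?ltr0n // -natrX ler_nat.
have -> : (8 * M%:R / z%:R) ^+ 2 = 2 * M%:R ^+ 2 * (32 / z%:R ^+ 2) :> R.
  by field; rewrite gt_eqF.
rewrite natrX; apply: ler_wpM2l; first by rewrite mulr_ge0 ?exprn_ge0.
have : 0 <= (z%:R ^+ 2)^-1 :> R by rewrite invr_ge0 exprn_ge0.
lra.
Qed.

End DerivativeTest.

(** * Derivatives of sums of inverse powers *)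
Section InversePowerPhase.
Variable R : realType.
Implicit Types (x : R) (C : nat -> R).

(** The rising factorial s (s + 1) ... (s + i - 1), the coefficient of the i-th
    derivative of x^-s up to sign. *)
Definition rising s i : R := \prod_(0 <= k < i) (s + k)%:R.

Lemma risingS s i : rising s i.+1 = rising s i * (s + i)%:R.
Proof. by rewrite /rising big_nat_recr. Qed.

Lemma rising_gt0 s i : (0 < s)%N -> 0 < rising s i.
Proof.
by move=> s0; apply: prodr_gt0 => k _; rewrite ltr0n addn_gt0 s0.
Qed.

Definition phase_tower j0 J C i x : R :=
  \sum_(0 <= j < J.+1) C j * ((-1) ^+ i * rising (j0 + j) i * x ^- (j0 + j + i)).

Lemma is_derive_expN m x : 0 < x ->
  is_derive x 1 (fun y : R => y ^- m) (- (m%:R * x ^- m.+1)).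
Proof.
move=> x0; have xn : x ^+ m != 0 by rewrite expf_neq0 // gt_eqF.
have D : is_derive x 1 (fun y : R => y ^+ m) (m%:R * x ^+ m.-1).
  have := @is_deriveX R R id m x 1 1 (is_derive_id _ _).
  by rewrite exprfctE /GRing.scale /= mulr1.
have := @is_deriveV R (fun y => y ^+ m) x (m%:R * x ^+ m.-1) 1 xn D.
rewrite /GRing.scale /=.
have -> // : - x ^+ m ^- 2 * (m%:R * x ^+ m.-1) = - (m%:R * x ^- m.+1).
case: m {xn D} => [|m]; first by rewrite !mul0r mulr0 oppr0.
rewrite !exprS /=; field; rewrite ?expf_neq0 ?gt_eqF //.
Qed.

Lemma phase_towerP j0 J C : tower (phase_tower j0 J C).
Proof.
move=> i x x0.
have D j : is_derive x 1
   (fun y => C j * ((-1) ^+ i * rising (j0 + j) i * y ^- (j0 + j + i)))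
   (C j * ((-1) ^+ i.+1 * rising (j0 + j) i.+1 * x ^- (j0 + j + i.+1))).
  have -> : (fun y => C j * ((-1) ^+ i * rising (j0 + j) i * y ^- (j0 + j + i)))
     = C j * ((-1) ^+ i * rising (j0 + j) i) \*: (fun y : R => y ^- (j0 + j + i)).
    by apply: funext => y; rewrite /GRing.scale /= !mulrA.
  apply: is_derive_eq (is_deriveZ _ (is_derive_expN (j0 + j + i) x0)) _.
  rewrite /GRing.scale /= addnS risingS [(-1) ^+ i.+1]exprS.
  ring.
rewrite /phase_tower; elim: J => [|J IH].
  under eq_fun do rewrite big_nat1.
  by rewrite big_nat1.
under eq_fun do rewrite (big_nat_recr J.+1) //=.
by rewrite (big_nat_recr J.+1) //=; exact: is_deriveD.
Qed.

(** On the range from M to A * M the leading term of the i-th derivative varies only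
    by a constant factor, so it dominates the other terms as soon as their
    coefficients, rescaled by M^-j, are small compared with D 0.  The constant kappa
    depends only on the exponents. *)
Lemma dominant_bounds (j0 J i : nat) (A : R) : (0 < j0)%N -> 1 <= A ->
  exists2 kappa : R, 0 < kappa & forall (D : nat -> R) (M : R), 0 < M -> 0 < D 0%N ->
  (forall j, (0 < j <= J)%N -> `|D j| * M ^- j <= kappa * D 0%N) ->
  forall x, M <= x <= A * M ->
  2^-1 * A ^- (j0 + i) * rising j0 i * (D 0%N * M ^- (j0 + i))
   <= \sum_(0 <= j < J.+1) D j * (rising (j0 + j) i * x ^- (j0 + j + i))
   <= 2 * rising j0 i * (D 0%N * M ^- (j0 + i)).
Proof.
move=> j00 A1.
pose S := \sum_(1 <= j < J.+1) rising (j0 + j) i.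
have A0 : 0 < A by exact: lt_le_trans A1.
have S0 : 0 <= S.
  by apply: sumr_ge0 => j _; apply/ltW/rising_gt0; rewrite addn_gt0 j00.
pose c := 2^-1 * A ^- (j0 + i) * rising j0 i.
have c0 : 0 < c by rewrite !mulr_gt0 ?invr_gt0 ?exprn_gt0 ?rising_gt0.
have cr : c <= rising j0 i.
  rewrite /c -[leRHS]mul1r; apply: ler_wpM2r; first exact/ltW/rising_gt0.
  rewrite -[leRHS]mulr1; apply: ler_pM; rewrite ?invr_ge0 ?exprn_ge0 ?(ltW A0) //.
    by rewrite invf_le1 ?ler1n.
  by rewrite invf_le1 ?exprn_gt0 // exprn_ege1.
(* The non-leading terms then add up to at most half of the least value of the leading one. *)
exists (c / (S + 1)); first by rewrite divr_gt0 // ltr_wpDl.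
move=> D M M0 D0 hD x /andP[Mx xM].
have x0 : 0 < x by exact: lt_le_trans Mx.
set X := D 0%N * M ^- (j0 + i).
have X0 : 0 < X by rewrite mulr_gt0 ?invr_gt0 ?exprn_gt0.
have xiM n : x ^- n <= M ^- n.
  by rewrite lef_pV2 ?posrE ?exprn_gt0 // lerXn2r ?nnegrE ?(ltW M0) ?(ltW x0).
have Mix n : A ^- n * M ^- n <= x ^- n.
  rewrite -invfM -exprMn lef_pV2 ?posrE ?exprn_gt0 ?mulr_gt0 // lerXn2r ?nnegrE ?(ltW x0) //.
  by rewrite mulr_ge0 // ltW.
rewrite big_nat_recl //= addn0.
set T := \sum_(0 <= j < J) _.
have hT : `|T| <= c * X.
  apply: le_trans (ler_norm_sum _ _ _) _.
  apply: (@le_trans _ _ (\sum_(0 <= j < J) rising (j0 + j.+1) i * (c / (S + 1) * X))).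
    apply: ler_sum_nat => j /andP[_ jJ].
    have r0 : 0 < rising (j0 + j.+1) i by rewrite rising_gt0 // addn_gt0 j00.
    rewrite normrM [`|_ * x ^- _|]ger0_norm; last first.
      by rewrite mulr_ge0 ?invr_ge0 ?exprn_ge0 ?ltW.
    rewrite mulrCA; apply: ler_wpM2l; first exact: ltW.
    apply: (@le_trans _ _ (`|D j.+1| * M ^- (j0 + j.+1 + i))).
      by apply: ler_wpM2l.
    rewrite (addnC j0) -addnA exprD invfM mulrA /X mulrA; apply: ler_wpM2r.
      by rewrite invr_ge0 exprn_ge0 // ltW.
    by apply: hD.
  rewrite -mulr_suml.
  have -> : \sum_(0 <= j < J) rising (j0 + j.+1) i = S by rewrite /S big_add1.
  have -> : S * (c / (S + 1) * X) = (c * X) * (S / (S + 1)).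
    by field; rewrite gt_eqF // ltr_wpDl.
  rewrite -[leRHS]mulr1; apply: ler_wpM2l; first by rewrite mulr_ge0 ?ltW.
  by rewrite ler_pdivrMr ?mul1r ?lerDl // ltr_wpDl.
have m1 : 2 * c * X <= D 0%N * (rising j0 i * x ^- (j0 + i)).
  have -> : 2 * c * X = D 0%N * (rising j0 i * (A ^- (j0 + i) * M ^- (j0 + i))).
    by rewrite /c /X; field; rewrite !expf_neq0 ?gt_eqF.
  by apply: ler_wpM2l; [exact: ltW|apply: ler_wpM2l; [exact/ltW/rising_gt0|]].
have m2 : D 0%N * (rising j0 i * x ^- (j0 + i)) <= rising j0 i * X.
  rewrite mulrCA; apply: ler_wpM2l; first exact/ltW/rising_gt0.
  by apply: ler_wpM2l; [exact: ltW|].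
have : c * X <= rising j0 i * X by apply: ler_wpM2r => //; exact: ltW.
move: hT; rewrite ler_norml -/c => /andP[t1 t2].
by rewrite -mulrA in m1 *; move: m1 m2 t1 t2; set Y := D 0%N * _ => *; apply/andP; split; lra.
Qed.
End InversePowerPhase.

(** * Sums over integers of sums of inverse powers *)
Section SmoothSum.
Variable R : realType.

Definition phase j0 J (C : nat -> R) (x : R) : R :=
  \sum_(0 <= j < J.+1) C j * x ^- (j0 + j).

Definition shift_const (K : nat) (c1 c2 : R) : R :=
  1 + 2 * c2 + 3 * 2 ^+ K / c1 + 6 * c2 * 2 ^+ K / c1.

Lemma shift_const_ge1 K c1 c2 : 0 < c1 -> 0 < c2 -> 1 <= shift_const K c1 c2.
Proof.
move=> c10 c20; rewrite /shift_const -!addrA lerDl.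
by rewrite !addr_ge0 ?divr_ge0 ?mulr_ge0 ?exprn_ge0 // ltW.
Qed.

(** For a phase of size T at M the derivative of order K + 1 has size T M^-(K+1).
    Take H0 maximal with H0 * q <= M and with the required upper bound: H0 + 1, hence
    2 H0, violates one of these two constraints, and either violation bounds H0 from
    below well enough for the last inequality. *)
Lemma shift_parameter (K M q : nat) (c1 c2 T : R) : (0 < q)%N -> 0 < c1 -> 0 < c2 ->
  let B := shift_const K c1 c2 in
  B * q%:R ^+ K.+1 <= M%:R -> B * q%:R ^+ K.+1 <= T -> T <= M%:R ^+ K ->
  exists H0 : nat, [/\ (0 < H0)%N, (H0 * q <= M)%N,
    c2 * (T * M%:R ^- K.+1) * (H0 * q)%:R ^+ K <= 2^-1 &
    3 * q%:R <= c1 * (T * M%:R ^- K.+1) * H0%:R ^+ K * M%:R].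
Proof.
move=> q0 c10 c20 B hM hT TM.
have B1 : 1 <= B by exact: shift_const_ge1.
have BE : B = shift_const K c1 c2 by [].
rewrite /shift_const in BE.
have qR : 0 < q%:R :> R by rewrite ltr0n.
have q1 : 1 <= q%:R :> R by rewrite ler1n.
have qK : q%:R <= q%:R ^+ K.+1 :> R by rewrite exprS ler_peMr ?exprn_ege1 // ltW.
have qKp : 0 < q%:R ^+ K.+1 :> R by rewrite exprn_gt0.
have M0 : 0 < M%:R :> R by apply: lt_le_trans hM; rewrite mulr_gt0 // (lt_le_trans ltr01).
have T0 : 0 < T by apply: lt_le_trans hT; rewrite mulr_gt0 // (lt_le_trans ltr01).
pose P H := (H * q <= M)%N && (2 * c2 * T * (H * q)%:R ^+ K <= M%:R ^+ K.+1).
have P1 : P 1%N.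
  rewrite /P mul1n; apply/andP; split.
    rewrite -(ler_nat R); apply: le_trans hM; apply: le_trans qK _.
    by rewrite ler_peMl // ltW.
  apply: (@le_trans _ _ (2 * c2 * M%:R ^+ K * q%:R ^+ K)).
    by rewrite ler_wpM2r ?exprn_ge0 // ler_wpM2l // mulr_ge0 // ltW.
  rewrite [in leRHS]exprSr mulrAC [leRHS]mulrC; apply: ler_wpM2r; first exact/exprn_ge0/ltW.
  apply: le_trans hM; apply: ler_pM; rewrite ?mulr_ge0 ?exprn_ge0 ?(ltW c20) //.
    rewrite BE (addrC 1) -!addrA lerDl !addr_ge0 ?divr_ge0 ?mulr_ge0 ?exprn_ge0 // ltW //.
  by rewrite exprSr ler_peMr // exprn_ge0.
have Pmax H : P H -> (H <= M)%N.
  by move=> /andP[h _]; apply: leq_trans h; rewrite leq_pmulr.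
case: (ex_maxnP (ex_intro P 1%N P1) Pmax) => H PH Hmax.
have H0 : (0 < H)%N by exact: Hmax.
have HR : 1 <= H%:R :> R by rewrite ler1n.
move: (PH) => /andP[h1 h2].
exists H; split => //.
  have -> : c2 * (T * M%:R ^- K.+1) * (H * q)%:R ^+ K
     = (2 * c2 * T * (H * q)%:R ^+ K) / (2 * M%:R ^+ K.+1).
    by field; rewrite expf_neq0 // gt_eqF.
  rewrite ler_pdivrMr ?mulr_gt0 ?exprn_gt0 //.
  by rewrite mulrA mulVf ?mul1r // pnatr_eq0.
have -> : c1 * (T * M%:R ^- K.+1) * H%:R ^+ K * M%:R
   = c1 * (T * M%:R ^- K * H%:R ^+ K).
  by rewrite exprSr; field; rewrite expf_neq0 ?gt_eqF.
rewrite -ler_pdivrMl //.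
have /negP : ~ P H.+1 by move=> /Hmax; rewrite ltnn.
rewrite negb_and -ltnNge -ltNge => /orP[h|h].
  have MH : M%:R <= 2 * H%:R * q%:R :> R.
    have : M%:R <= (H.+1 * q)%:R :> R by rewrite ler_nat ltnW.
    rewrite natrM => hM'; apply: le_trans hM' _; apply: ler_wpM2r; first exact: ltW.
    by rewrite -natr1; lra.
  apply: (@le_trans _ _ (T * (2 * q%:R) ^- K)).
    rewrite ler_pdivlMr ?exprn_gt0 ?mulr_gt0 //.
    apply: le_trans hT.
    have -> : c1^-1 * (3 * q%:R) * (2 * q%:R) ^+ K
      = (3 * 2 ^+ K / c1) * q%:R ^+ K.+1 by rewrite exprMn exprS; ring.
    apply: ler_wpM2r; first exact: ltW.
    rewrite BE.
    have : 0 < 6 * c2 * 2 ^+ K / c1 by rewrite divr_gt0 ?mulr_gt0 ?exprn_gt0.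
    lra.
  rewrite -mulrA; apply: ler_wpM2l; first exact: ltW.
  rewrite -exprVn -[M%:R ^- K]exprVn -exprMn.
  apply: lerXn2r; rewrite ?nnegrE ?invr_ge0 ?mulr_ge0 ?invr_ge0 ?(ltW M0) //.
  have -> : (2 * q%:R)^-1 = M%:R^-1 * (M%:R / (2 * q%:R)) :> R.
    by field; rewrite !gt_eqF.
  apply: ler_wpM2l; first by rewrite invr_ge0 ltW.
  by rewrite ler_pdivrMr ?mulr_gt0 // mulrA [_ * 2]mulrC.
have h' : M%:R ^+ K.+1 < 2 * c2 * T * (2 * H%:R * q%:R) ^+ K.
  apply: lt_le_trans h _; apply: ler_wpM2l; first by rewrite !mulr_ge0 ?ltW.
  apply: lerXn2r; rewrite ?nnegrE ?mulr_ge0 ?(ltW qR) //.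
  rewrite natrM; apply: ler_wpM2r; first exact: ltW.
  by rewrite -natr1; lra.
have key : M%:R / (2 * c2 * (2 * q%:R) ^+ K) <= T * M%:R ^- K * H%:R ^+ K.
  rewrite ler_pdivrMr ?mulr_gt0 ?exprn_gt0 ?mulr_gt0 //.
  have -> : T * M%:R ^- K * H%:R ^+ K * (2 * c2 * (2 * q%:R) ^+ K)
    = (2 * c2 * T * (2 * H%:R * q%:R) ^+ K) * M%:R ^- K.
    by rewrite !exprMn; ring.
  by rewrite ler_pdivlMr ?exprn_gt0 // -exprS ltW.
apply: le_trans key.
rewrite ler_pdivlMr ?mulr_gt0 ?exprn_gt0 ?mulr_gt0 //.
apply: le_trans hM.
have -> : c1^-1 * (3 * q%:R) * (2 * c2 * (2 * q%:R) ^+ K)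
   = (6 * c2 * 2 ^+ K / c1) * q%:R ^+ K.+1 by rewrite exprMn exprS; ring.
apply: ler_wpM2r; first exact: ltW.
have : 0 < 3 * 2 ^+ K / c1 by rewrite divr_gt0 ?mulr_gt0 ?exprn_gt0.
rewrite BE; lra.
Qed.

(** Combines the derivative test with the choice of shifts.  The leading coefficient
    may be assumed to have the sign of (-1)^(K+1), which makes the derivative of order
    K + 1 positive and decreasing: otherwise pass to the complex conjugate. *)
Lemma smooth_phase_sum (j0 J K : nat) : (0 < j0)%N ->
  exists2 kappa : R, 0 < kappa & exists2 B : R, 1 <= B &
  forall (C : nat -> R) (M z : nat), (0 < z)%N ->
  (forall j, (0 < j <= J)%N -> `|C j| * M%:R ^- j <= kappa * `|C 0%N|) ->
  B * (z ^ (2 ^ K))%:R ^+ K.+1 <= M%:R ->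
  B * (z ^ (2 ^ K))%:R ^+ K.+1 <= `|C 0%N| * M%:R ^- j0 ->
  `|C 0%N| * M%:R ^- j0 <= M%:R ^+ K ->
  forall a b, (M <= a)%N -> (b <= 2 * M)%N ->
  cmod (\sum_(a <= m < b) e (phase j0 J C m%:R)) <= 8 * M%:R / z%:R.
Proof.
move=> j00.
have A1 : 1 <= K.+2%:R :> R by rewrite ler1n.
have [k1 k10 hk1] := dominant_bounds J K.+1 j00 A1.
have [k2 k20 hk2] := dominant_bounds J K.+2 j00 A1.
exists (Num.min k1 k2); first by rewrite lt_min k10.
pose c1 : R := 2^-1 * K.+2%:R ^- (j0 + K.+1) * rising R j0 K.+1.
pose c2 : R := 2 * rising R j0 K.+1.
have c10 : 0 < c1 by rewrite !mulr_gt0 ?invr_gt0 ?exprn_gt0 ?rising_gt0.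
have c20 : 0 < c2 by rewrite mulr_gt0 ?rising_gt0.
exists (shift_const K c1 c2); first exact: shift_const_ge1.
set B := shift_const K c1 c2.
have main (C : nat -> R) (M z : nat) : (0 < z)%N -> 0 < (-1) ^+ K.+1 * C 0%N ->
  (forall j, (0 < j <= J)%N -> `|C j| * M%:R ^- j <= Num.min k1 k2 * `|C 0%N|) ->
  B * (z ^ (2 ^ K))%:R ^+ K.+1 <= M%:R ->
  B * (z ^ (2 ^ K))%:R ^+ K.+1 <= `|C 0%N| * M%:R ^- j0 ->
  `|C 0%N| * M%:R ^- j0 <= M%:R ^+ K ->
  forall a b, (M <= a)%N -> (b <= 2 * M)%N ->
  cmod (\sum_(a <= m < b) e (phase j0 J C m%:R)) <= 8 * M%:R / z%:R.
  move=> z0 C0 tail hM hT TM a b Ma bM.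
  set q := (z ^ 2 ^ K)%N in hM hT.
  have q0 : (0 < q)%N by rewrite expn_gt0 z0.
  set T := `|C 0%N| * M%:R ^- j0 in hT TM.
  have [H0 [H00 HM hhi hlo]] := shift_parameter q0 c10 c20 hM hT TM.
  pose D j := (-1) ^+ K.+1 * C j.
  have DC j : `|D j| = `|C j| by rewrite normrM normrX normrN1 expr1n mul1r.
  have D0 : D 0%N = `|C 0%N| by rewrite -DC gtr0_norm.
  have M0 : 0 < M%:R :> R by rewrite ltr0n; apply: leq_trans HM; rewrite muln_gt0 H00.
  have TE i : D 0%N * M%:R ^- (j0 + i) = T * M%:R ^- i.
    by rewrite D0 /T exprD invfM mulrA.
  have tail1 j : (0 < j <= J)%N -> `|D j| * M%:R ^- j <= k1 * D 0%N.
    move=> /tail; rewrite DC D0 => h; apply: le_trans h _.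
    by rewrite ler_wpM2r // ge_min lexx.
  have tail2 j : (0 < j <= J)%N -> `|D j| * M%:R ^- j <= k2 * D 0%N.
    move=> /tail; rewrite DC D0 => h; apply: le_trans h _.
    by rewrite ler_wpM2r // ge_min lexx orbT.
  have b1 := hk1 D M%:R M0 C0 tail1.
  have b2 := hk2 D M%:R M0 C0 tail2.
  have T0 : 0 < T by rewrite /T -D0 mulr_gt0 // invr_gt0 exprn_gt0.
  have -> : \sum_(a <= m < b) e (phase j0 J C m%:R)
     = \sum_(a <= m < b) e (phase_tower j0 J C 0 m%:R).
    apply: eq_bigr => m _; congr e; apply: eq_bigr => j _.
    by rewrite expr0 /rising big_nil !mul1r addn0.
  apply: (@derivative_test R K (phase_tower j0 J C) (c1 * (T * M%:R ^- K.+1))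
    (c2 * (T * M%:R ^- K.+1)) M H0 q z) => //.
  - exact: phase_towerP.
  - by apply: mulr_gt0 => //; apply: mulr_gt0 => //; rewrite invr_gt0 exprn_gt0.
  - move=> x /b1; rewrite TE /phase_tower => h.
    have -> : \sum_(0 <= j < J.+1) C j * ((-1) ^+ K.+1 * rising R (j0 + j) K.+1 * x ^- (j0 + j + K.+1))
      = \sum_(0 <= j < J.+1) D j * (rising R (j0 + j) K.+1 * x ^- (j0 + j + K.+1)).
      by apply: eq_bigr => j _; rewrite /D; ring.
    exact: h.
  - move=> x /b2 /andP[h _]; rewrite /phase_tower.
    have -> : \sum_(0 <= j < J.+1) C j * ((-1) ^+ K.+2 * rising R (j0 + j) K.+2 * x ^- (j0 + j + K.+2))
      = - \sum_(0 <= j < J.+1) D j * (rising R (j0 + j) K.+2 * x ^- (j0 + j + K.+2)).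
      by rewrite -sumrN; apply: eq_bigr => j _; rewrite /D [(-1) ^+ K.+2]exprS; ring.
    rewrite oppr_le0; apply: le_trans h; rewrite TE.
    by rewrite !mulr_ge0 ?invr_ge0 ?exprn_ge0 ?(ltW T0) ?(ltW M0) // ltW // rising_gt0.
move=> C M z z0 tail hM hT TM a b Ma bM.
have [s|s|s] := ltgtP 0 ((-1) ^+ K.+1 * C 0%N); first exact: main.
  have -> : \sum_(a <= m < b) e (phase j0 J C m%:R)
    = cj (\sum_(a <= m < b) e (phase j0 J (fun j => - C j) m%:R)).
    rewrite cj_sum; apply: eq_bigr => m _; rewrite cj_e; congr e.
    by rewrite /phase -sumrN; apply: eq_bigr => j _; rewrite mulNr opprK.
  rewrite cmod_cj; apply: main; rewrite ?normrN //.
    by rewrite mulrN oppr_gt0.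
  by move=> j; rewrite normrN; exact: tail.
have C0 : C 0%N = 0.
  by apply/eqP; move/esym/eqP: s; rewrite mulf_eq0 signr_eq0.
move: hT; rewrite C0 normr0 mul0r leNgt mulr_gt0 //.
  exact: lt_le_trans ltr01 (shift_const_ge1 K c10 c20).
by rewrite exprn_gt0 // ltr0n expn_gt0 z0.
Qed.
End SmoothSum.

(** * Moebius and von Mangoldt functions, and Vaughan's identity *)
Section Arithmetic.
Variable R : realType.

Definition mobius (n : nat) : R :=
  if all (fun p => logn p n == 1%N) (primes n) then (-1) ^+ size (primes n) else 0.

Lemma mobius1 : mobius 1 = 1. Proof. by []. Qed.

Lemma norm_mobius n : `|mobius n| <= 1.
Proof.
by rewrite /mobius; case: ifP => _; rewrite ?normr0 // normrX normrN1 expr1n.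
Qed.

Lemma mobius_dvd p d : prime p -> (0 < d)%N -> (p %| d)%N -> mobius (p * d) = 0.
Proof.
move=> pp d0 pd; have pd0 : (0 < p * d)%N by rewrite muln_gt0 prime_gt0.
rewrite /mobius; case: ifPn => // /allP /(_ p).
rewrite mem_primes pp pd0 dvdn_mulr //= => /(_ isT).
have : (0 < logn p d)%N by rewrite logn_gt0 mem_primes pp d0.
have p0 := prime_gt0 pp.
by rewrite lognM // (logn_prime p pp) eqxx; case: logn.
Qed.

Lemma mobius_ndvd p d : prime p -> (0 < d)%N -> ~~ (p %| d)%N ->
  mobius (p * d) = - mobius d.
Proof.
move=> pp d0 pd; have pd0 : (0 < p * d)%N by rewrite muln_gt0 prime_gt0.
have pr : perm_eq (primes (p * d)) (p :: primes d).
  apply: uniq_perm; first exact: primes_uniq.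
    by rewrite /= mem_primes (negbTE pd) !andbF primes_uniq.
  by move=> q; rewrite (primesM _ (prime_gt0 pp) d0) (primes_prime pp) !inE.
have lp : logn p (p * d) = 1%N.
  have p0 := prime_gt0 pp.
  rewrite lognM // (logn_prime p pp) eqxx (_ : logn p d = 0%N) //.
  by rewrite lognE pp d0 (negbTE pd).
have aE : all (fun q => logn q (p * d) == 1%N) (primes (p * d))
   = all (fun q => logn q d == 1%N) (primes d).
  rewrite (perm_all _ pr) /= lp eqxx /=; apply: eq_in_all => q.
  rewrite mem_primes => /and3P[pq _ qd].
  have p0 := prime_gt0 pp.
  rewrite lognM // (logn_prime q pp).
  by case: (q =P p) => [qp|]; [move: pd; rewrite -qp qd | rewrite add0n].
rewrite /mobius aE (perm_size pr) /=; case: ifP; rewrite ?oppr0 // exprS mulN1r //.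
Qed.

Lemma sum_mult (V : nmodType) (h : nat -> V) (X k : nat) : (0 < k)%N ->
  (forall m, (X <= m)%N -> h m = 0) ->
  \sum_(1 <= m < X | (k %| m)%N) h m = \sum_(1 <= j < X) h (j * k)%N.
Proof.
move=> k0 hX.
transitivity (\sum_(1 <= m < X) \sum_(1 <= j < X) (if m == (j * k)%N then h m else 0)).
  rewrite big_mkcond /=; apply: eq_big_nat => m /andP[m1 mX].
  case: ifPn => [/dvdnP[j mE]|kn]; last first.
    rewrite big1 // => j _; case: eqP => // mE; move: kn; rewrite mE dvdn_mull //.
  rewrite -big_mkcond /= (eq_bigl (fun i => i == j)); last first.
    by move=> i; rewrite mE eqn_pmul2r // eq_sym.
  rewrite big_nat1_eq ifT //; apply/andP; split.
    by move: m1; rewrite mE; case: (j).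
  by apply: leq_ltn_trans mX; rewrite mE leq_pmulr.
rewrite exchange_big_nat; apply: eq_big_nat => j /andP[j1 jX].
rewrite -big_mkcond /= big_nat1_eq; case: ifPn => // /nandP; rewrite -!leqNgt => -[|h1].
  by rewrite leqn0 muln_eq0; case: (j) j1 => //; case: (k) k0.
by rewrite hX.
Qed.

(** With p a prime factor of m, the divisors d not divisible by p cancel against
    the divisors p d, and the multiples of p^2 contribute nothing. *)
Lemma sum_mobius X m : (0 < m < X)%N ->
  \sum_(1 <= d < X | (d %| m)%N) mobius d = (m == 1%N)%:R.
Proof.
move=> /andP[m0 mX].
have [-> | m1] := eqVneq m 1%N.
  rewrite (eq_bigl (fun d => d == 1%N)); last by move=> d; rewrite dvdn1.
  by rewrite big_nat1_eq mobius1 /=; case: ifP => //; case: m m0 mX => // n _; lia.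
have m2 : (1 < m)%N by lia.
pose p := pdiv m; have pp : prime p by rewrite pdiv_prime.
have pm : (p %| m)%N by exact: pdiv_dvd.
have [n mE] := dvdnP pm.
have n0 : (0 < n)%N by move: m0; rewrite mE muln_gt0 => /andP[].
rewrite (bigID (fun d => (p %| d)%N)) /=.
rewrite (eq_bigl (fun d => (p %| d)%N && (d %| m)%N)); last by move=> d; rewrite andbC.
rewrite big_mkcondr /=.
rewrite (@sum_mult _ (fun d => if (d %| m)%N then mobius d else 0)) ?prime_gt0 //; last first.
  move=> d Xd; case: ifP => // dm; have := dvdn_leq m0 dm; lia.
rewrite (eq_big_nat _ _ (F2 := fun j => if ~~ (p %| j)%N && (j %| m)%N then - mobius j else 0)).
  rewrite -big_mkcond /= sumrN.
  under [X in _ + X]eq_bigl => d do rewrite andbC.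
  by rewrite addNr.
move=> j /andP[j0 jX]; rewrite mulnC mE [(n * p)%N]mulnC dvdn_pmul2l ?prime_gt0 //.
have [pj|pj] := boolP (p %| j)%N => /=.
  by rewrite mobius_dvd //; case: ifP.
rewrite mobius_ndvd //; rewrite Gauss_dvdr //.
by rewrite coprime_sym prime_coprime.
Qed.

(** Log p when m = p^k with k > 0, and 0 otherwise; written as a sum over all pairs
    (p, k), at most one of which contributes, because sums of this form can be
    exchanged with sums over m. *)
Definition mangoldt (m : nat) : R :=
  \sum_(1 <= p < m.+1 | prime p) \sum_(1 <= k < m.+1 | (p ^ k == m)%N) ln p%:R.

Lemma ln_nat_ge0 n : 0 <= ln n%:R :> R.
Proof.
case: n => [|n]; first by rewrite ln0.
by rewrite ln_ge0 // ler1n.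
Qed.

Lemma mangoldt_ge0 m : 0 <= mangoldt m.
Proof.
by apply: sumr_ge0 => p _; apply: sumr_ge0 => k _; exact: ln_nat_ge0.
Qed.

(** The defining sum may be extended, so that all m < X share one range for p and k. *)
Lemma mangoldtE X m : (0 < m < X)%N -> mangoldt m =
  \sum_(1 <= p < X | prime p) \sum_(1 <= k < X | (p ^ k == m)%N) ln p%:R.
Proof.
move=> /andP[m0 mX]; rewrite /mangoldt.
have out p k : prime p -> (m < p)%N || (m < k)%N -> (p ^ k == m)%N -> (k == 0)%N.
  move=> pp + /eqP pk; apply: contraTT; rewrite -lt0n => k0.
  rewrite negb_or -!leqNgt -pk; apply/andP; split.
    by rewrite -{1}(expn1 p); apply: leq_pexp2l => //; exact: prime_gt0.
  by apply/ltnW/ltn_expl/prime_gt1.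
rewrite [RHS](big_cat_nat (n := m.+1)) //= [X in _ = _ + X]big_nat_cond.
rewrite [X in _ = _ + X]big1 ?addr0; last first.
  move=> p /andP[/andP[mp _] pp]; rewrite big_nat_cond big1 // => k /andP[/andP[k1 _] pk].
  by have := out p k pp; rewrite mp => /(_ isT pk); lia.
apply: eq_bigr => p pp.
rewrite [RHS](big_cat_nat (n := m.+1)) //= [X in _ = _ + X]big_nat_cond.
rewrite [X in _ = _ + X]big1 ?addr0 // => k /andP[/andP[mk _] pk].
by have := out p k pp; rewrite mk orbT => /(_ isT pk); lia.
Qed.

Lemma ln_nat_sum n X : (0 < n < X)%N ->
  ln n%:R = \sum_(1 <= p < X | prime p) (logn p n)%:R * ln p%:R :> R.
Proof.
move=> /andP[n0 nX].
have h : (n = \prod_(1 <= p < X | prime p) p ^ logn p n)%N.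
  rewrite -{1}(partnT n0) /partn (big_ltn (ltn0Sn n)) /= lognE /= mul1n.
  rewrite [RHS](big_cat_nat (n := n.+1)) //=.
  rewrite [X in _ = (_ * X)%N]big_nat_cond [X in _ = (_ * X)%N]big1 ?muln1; last first.
    move=> p /andP[/andP[np _] pp]; rewrite (_ : logn p n = 0%N) //.
    apply/eqP; rewrite -leqn0 leqNgt logn_gt0 mem_primes pp n0 /=.
    by apply/negP => /(dvdn_leq n0); lia.
  rewrite [RHS]big_mkcond; apply: eq_bigr => p _; case: ifPn => // pp.
  by rewrite lognE (negbTE pp).
rewrite {1}h natr_prod.
suff : let x : R := \prod_(1 <= p < X | prime p) (p ^ logn p n)%:R in
   0 < x /\ ln x = \sum_(1 <= p < X | prime p) (logn p n)%:R * ln p%:R by case.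
rewrite /=; elim/big_rec2: _ => [|p y1 y2 pp [y0 yE]]; first by rewrite ln1.
have p0 : 0 < p%:R :> R by rewrite ltr0n prime_gt0.
have pk : 0 < (p ^ logn p n)%:R :> R by rewrite natrX exprn_gt0.
split; first by rewrite mulr_gt0.
by rewrite lnM ?posrE // natrX lnXn // yE mulr_natl.
Qed.

Lemma sum_mangoldt X m : (0 < m < X)%N ->
  \sum_(1 <= d < X | (d %| m)%N) mangoldt d = ln m%:R.
Proof.
move=> /andP[m0 mX].
transitivity (\sum_(1 <= d < X) \sum_(1 <= p < X | prime p)
   \sum_(1 <= k < X) (if (p ^ k == d)%N then (if (d %| m)%N then ln p%:R else 0 : R) else 0)).
  rewrite big_mkcond /=; apply: eq_big_nat => d dX; case: ifPn => dm.
    by rewrite (mangoldtE dX); apply: eq_bigr => p _; rewrite big_mkcond.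
  by rewrite big1 // => p _; rewrite big1 // => k _; case: ifP.
rewrite exchange_big /= (ln_nat_sum (X := X)) ?m0 //; apply: eq_bigr => p pp.
rewrite exchange_big /=.
transitivity (\sum_(1 <= k < X) (if (k <= logn p m)%N then ln p%:R else 0 : R)).
  apply: eq_big_nat => k /andP[k1 kX].
  rewrite -big_mkcond /= (eq_bigl (fun i => i == (p ^ k)%N)); last by move=> i; rewrite eq_sym.
  rewrite big_nat1_eq -pfactor_dvdn //.
  case: (boolP (p ^ k %| m)%N) => [h|_]; last by case: ifP.
  rewrite ifT // expn_gt0 prime_gt0 //=.
  by apply: leq_ltn_trans mX; exact: dvdn_leq.
have lm : (logn p m < X)%N.
  apply: leq_ltn_trans mX; apply: leq_trans (ltnW (ltn_expl _ (prime_gt1 pp))) _.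
  by apply: dvdn_leq => //; exact: pfactor_dvdnn.
rewrite (big_cat_nat (n := (logn p m).+1)) //=.
rewrite [X in _ + X]big_nat_cond [X in _ + X]big1 ?addr0; last first.
  by move=> k /andP[/andP[k1 _] _]; rewrite leqNgt k1.
rewrite (eq_big_nat _ _ (F2 := fun=> ln p%:R)); last by move=> k /andP[_ k1]; rewrite -ltnS k1.
by rewrite sumr_const_nat subn1 mulr_natl.
Qed.

Lemma mangoldt_le_ln m : (0 < m)%N -> mangoldt m <= ln m%:R.
Proof.
move=> m0; rewrite -(@sum_mangoldt m.+1) ?m0 ?ltnSn //.
rewrite big_mkcond big_nat_recr //= dvdnn lerDr.
by apply: sumr_ge0 => d _; case: ifP => // _; exact: mangoldt_ge0.
Qed.

Lemma mangoldt1 : mangoldt 1 = 0.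
Proof.
apply/eqP; rewrite eq_le mangoldt_ge0 andbT.
by have := @mangoldt_le_ln 1; rewrite ln1; exact.
Qed.

Lemma mangoldt_prime p : prime p -> mangoldt p = ln p%:R.
Proof.
move=> pp; rewrite -(@sum_mangoldt p.+1) ?prime_gt0 ?ltnSn //.
rewrite big_mkcond big_nat_recr ?prime_gt0 //= dvdnn.
rewrite big_nat_cond big1 ?add0r // => d /andP[/andP[d1 dp] _].
case: ifP => // dvd; move: (primeP pp) => [_ /(_ d dvd) /orP[/eqP ->|/eqP dE]].
  exact: mangoldt1.
by move: dp; rewrite dE ltnn.
Qed.

(** Proper prime powers below X <= s^2 are powers of primes below s, and for each such
    prime the terms add up to at most log X. *)
Lemma sum_mangoldt_nonprime (X s : nat) : (X <= s * s)%N ->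
  \sum_(1 <= m < X | ~~ prime m) mangoldt m <= s%:R * ln X%:R.
Proof.
move=> Xs.
have [X2|X2] := leqP X 1; first by rewrite big_geq // mulr_ge0 // ln_nat_ge0.
apply: (@le_trans _ _ (\sum_(1 <= p < X | prime p)
   (if (p < s)%N then \sum_(1 <= k < X | (p ^ k < X)%N) ln p%:R else 0 : R))).
  rewrite [leLHS](_ : _ = \sum_(1 <= m < X) \sum_(1 <= p < X | prime p)
     \sum_(1 <= k < X) (if (m == p ^ k)%N then (if ~~ prime m then ln p%:R else 0 : R) else 0)).
    rewrite exchange_big /=; apply: ler_sum => p pp.
    rewrite exchange_big /=.
    apply: (@le_trans _ _ (\sum_(1 <= k < X) (if (p ^ k < X)%N && ~~ prime (p ^ k) then ln p%:R else 0 : R))).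
      apply: ler_sum_nat => k /andP[k1 kX].
      rewrite -big_mkcond /= big_nat1_eq expn_gt0 prime_gt0 //=.
      by case: (p ^ k < X)%N; case: (prime (p ^ k)).
    case: ifPn => ps.
      rewrite [leRHS]big_mkcond /=; apply: ler_sum => k _.
      by case: (p ^ k < X)%N; case: (prime (p ^ k)) => /=; rewrite ?ln_nat_ge0.
    rewrite big_nat_cond big1 // => k /andP[/andP[k1 _] _].
    case: ifP => // /andP[pkX]; case: k k1 pkX => // -[|k] _ pkX; first by rewrite expn1 pp.
    have : (p ^ 2 <= p ^ k.+2)%N by rewrite leq_pexp2l // prime_gt0.
    have : (s * s <= p ^ 2)%N by rewrite expnS expn1 leq_mul // leqNgt.
    lia.
  rewrite big_mkcond; apply: eq_big_nat => m mX; case: ifPn => pm.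
    rewrite (mangoldtE mX); apply: eq_bigr => p _; rewrite big_mkcond.
    by apply: eq_bigr => k _; rewrite eq_sym.
  by rewrite big1 // => p _; rewrite big1 // => k _; case: ifP.
apply: (@le_trans _ _ (\sum_(1 <= p < X) (if (p < s)%N then ln X%:R else 0 : R))).
  rewrite big_mkcond; apply: ler_sum_nat => p /andP[p1 pX].
  case: ifP => pp; last by case: ifP => // _; exact: ln_nat_ge0.
  case: ifP => // ps.
  pose t := trunc_log p X.
  have /andP[tX Xt] := trunc_log_bounds (prime_gt1 pp) (ltnW X2).
  apply: (@le_trans _ _ (\sum_(1 <= k < X) (if (1 <= k < t.+1)%N then ln p%:R else 0 : R))).
    rewrite big_mkcond; apply: ler_sum_nat => k /andP[k1 kX].
    case: ifP => pk; last by case: ifP => // _; exact: ln_nat_ge0.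
    rewrite ifT // k1 /= ltnS -ltnS -(ltn_exp2l _ _ (prime_gt1 pp)).
    by apply: ltn_trans pk Xt.
  rewrite -big_mkcond /=.
  have -> : \sum_(1 <= k < X | (1 <= k < t.+1)%N) ln p%:R
     = ln p%:R * (\sum_(1 <= k < X | (1 <= k < t.+1)%N) 1)%N%:R :> R.
    by rewrite natr_sum mulr_sumr; apply: eq_bigr => *; rewrite mulr1.
  apply: (@le_trans _ _ (ln p%:R * t%:R)).
    apply: ler_wpM2l; first exact: ln_nat_ge0.
    rewrite ler_nat.
    have le1 : (\sum_(1 <= k < X | (1 <= k < t.+1)%N) 1 <= \sum_(0 <= k < X | (1 <= k < t.+1)%N) 1)%N.
      by rewrite [leqRHS]big_mkcond big_ltn ?(ltnW X2) //= -big_mkcond.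
    apply: leq_trans le1 _.
    by apply: leq_trans (sum_between 1 t.+1 X) _; rewrite subn1.
  have pR : 0 < p%:R :> R by rewrite ltr0n prime_gt0.
  rewrite mulr_natr -lnXn // ler_ln ?posrE ?exprn_gt0 ?ltr0n ?(ltnW X2) //.
  by rewrite -natrX ler_nat.
rewrite -big_mkcond /= -big_filter big_const_seq count_predT iter_addr addr0 -[leLHS]mulr_natl.
apply: ler_wpM2r; first exact: ln_nat_ge0.
rewrite ler_nat -[leqRHS](size_iota 0).
apply: uniq_leq_size; first by rewrite filter_uniq // iota_uniq.
by move=> p; rewrite mem_filter mem_iota /= add0n => /andP[].
Qed.

Lemma sum_mangoldt_regroup (h : nat -> R[i]) (X : nat) (v : nat -> R) (d : nat) : (0 < d)%N ->
  (forall m, (X <= m)%N -> h m = 0) ->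
  \sum_(1 <= j < X) \sum_(1 <= k < X) toC (v k) * h (d * (j * k))%N
  = \sum_(1 <= m < X) toC (\sum_(1 <= k < X | (k %| m)%N) v k) * h (d * m)%N.
Proof.
move=> d0 hX; rewrite exchange_big_nat /=.
under [RHS]eq_bigr => m _ do rewrite toC_sum big_distrl /=.
rewrite [RHS](eq_bigr (fun m => \sum_(1 <= k < X)
   (if (k %| m)%N then toC (v k) * h (d * m)%N else 0))); last first.
  by move=> m _; rewrite big_mkcond.
rewrite [RHS]exchange_big_nat; apply: eq_big_nat => k /andP[k1 kX].
rewrite -[RHS]big_mkcond /=.
rewrite (@sum_mult _ (fun m => toC (v k) * h (d * m)%N)) // => m Xm.
by rewrite hX ?mulr0 //; apply: leq_trans Xm _; rewrite leq_pmull.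
Qed.

(** The truncation at U of the sum in [sum_mobius]: it still vanishes for 1 < l <= U,
    so it lives on l = 1 and l > U. *)
Definition mobius_trunc (U l : nat) : R :=
  \sum_(1 <= d < U.+1 | (d %| l)%N) mobius d.

(** Evaluate in two ways the sum over l and over k > V of
    mobius_trunc U l * mangoldt k * h(l k).  Splitting off l = 1, with the truncated
    sum vanishing for 1 < l <= U, produces the left side and the bilinear sum.
    Opening mobius_trunc and completing the sum over k to all k, with
    [sum_mangoldt] producing log, yields the two type I sums.  The support condition
    on h replaces all truncations of the ranges by the common bound X. *)
Lemma vaughan_identity (h : nat -> R[i]) (U V X : nat) :
  (0 < U)%N -> (U < X)%N -> (V < X)%N ->
  (forall m, (X <= m)%N -> h m = 0) -> (forall m, (m <= V)%N -> h m = 0) ->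
  \sum_(1 <= m < X) toC (mangoldt m) * h m =
    \sum_(1 <= d < U.+1) toC (mobius d) * (\sum_(1 <= k < X) toC (ln k%:R) * h (d * k)%N)
  - \sum_(1 <= d < U.+1) \sum_(1 <= v < V.+1) toC (mobius d * mangoldt v) *
       (\sum_(1 <= k < X) h (d * v * k)%N)
  - \sum_(U.+1 <= l < X) \sum_(V.+1 <= k < X)
       toC (mobius_trunc U l * mangoldt k) * h (l * k)%N.
Proof.
move=> U0 UX VX hX hV.
pose S0 := \sum_(1 <= l < X) toC (mobius_trunc U l) * \sum_(V.+1 <= k < X) toC (mangoldt k) * h (l * k)%N.
have A : S0 = \sum_(1 <= m < X) toC (mangoldt m) * h m
   + \sum_(U.+1 <= l < X) \sum_(V.+1 <= k < X)
       toC (mobius_trunc U l * mangoldt k) * h (l * k)%N.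
  rewrite /S0 (big_cat_nat (n := U.+1)) //=; congr (_ + _); last first.
    apply: eq_bigr => l _; rewrite mulr_sumr; apply: eq_bigr => k _.
    by rewrite toCM mulrA.
  rewrite big_ltn // [X in _ + X]big_nat_cond [X in _ + X]big1 ?addr0; last first.
    move=> l /andP[/andP[l1 lU] _].
    rewrite /mobius_trunc sum_mobius ?lU ?(ltnW l1) //.
    by rewrite (gtn_eqF l1) mul0r.
  rewrite /mobius_trunc sum_mobius // eqxx mul1r.
  rewrite [RHS](big_cat_nat (n := V.+1)) //= [X in _ = X + _]big_nat_cond.
  rewrite [X in _ = X + _]big1 ?add0r; last first.
    by move=> m /andP[/andP[_ mV] _]; rewrite hV ?mulr0.
  by apply: eq_bigr => k _; rewrite mul1n.
have B : S0 = \sum_(1 <= d < U.+1) toC (mobius d) *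
    \sum_(1 <= j < X) \sum_(V.+1 <= k < X) toC (mangoldt k) * h (d * (j * k))%N.
  rewrite /S0 /mobius_trunc.
  pose G l := \sum_(V.+1 <= k < X) toC (mangoldt k) * h (l * k)%N.
  have GX l : (X <= l)%N -> G l = 0.
    move=> Xl; rewrite /G big_nat_cond big1 // => k /andP[/andP[k1 _] _].
    rewrite hX ?mulr0 //; apply: leq_trans Xl _; rewrite leq_pmulr //.
    exact: leq_ltn_trans (leq0n V) k1.
  rewrite -/(G _).
  rewrite (eq_bigr (fun l => \sum_(1 <= d < U.+1)
    (if (d %| l)%N then toC (mobius d) * G l else 0))); last first.
    by move=> l _; rewrite toC_sum big_distrl /= big_mkcond.
  rewrite exchange_big_nat; apply: eq_big_nat => d /andP[d1 dU] /=.
  rewrite -big_mkcond /= (@sum_mult _ (fun l => toC (mobius d) * G l)) //; last first.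
    by move=> m /GX ->; rewrite mulr0.
  rewrite mulr_sumr; apply: eq_bigr => j _; congr (_ * _); apply: eq_bigr => k _.
  by congr (_ * h _); rewrite mulnA (mulnC d).
have -> : \sum_(1 <= m < X) toC (mangoldt m) * h m = S0
   - \sum_(U.+1 <= l < X) \sum_(V.+1 <= k < X)
       toC (mobius_trunc U l * mangoldt k) * h (l * k)%N by rewrite A addrK.
congr (_ - _); rewrite B -sumrB; apply: eq_big_nat => d /andP[d1 dU].
rewrite [X in _ = _ - X](eq_bigr (fun v => toC (mobius d) * (toC (mangoldt v) * \sum_(1 <= k < X) h (d * v * k)%N))); last first.
  by move=> v _; rewrite toCM mulrA.
rewrite -mulr_sumr -mulrBr; congr (_ * _).
have -> : \sum_(1 <= k < X) toC (ln k%:R) * h (d * k)%N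
   = \sum_(1 <= m < X) toC (\sum_(1 <= k < X | (k %| m)%N) mangoldt k) * h (d * m)%N.
  by apply: eq_big_nat => m mX; rewrite (sum_mangoldt mX).
rewrite -sum_mangoldt_regroup //.
rewrite [X in _ = _ - X](eq_bigr (fun v => \sum_(1 <= j < X) toC (mangoldt v) * h (d * (j * v))%N)); last first.
  move=> v _; rewrite mulr_sumr; apply: eq_bigr => j _; congr (_ * h _).
  by rewrite -mulnA (mulnC v).
rewrite [X in _ = _ - X]exchange_big_nat -sumrB; apply: eq_bigr => j _ /=.
rewrite [X in _ = X - _](big_cat_nat (n := V.+1)) //=.
by rewrite addrAC subrr add0r.
Qed.
End Arithmetic.

(** * Divisor sums and differences of inverse powers *)
Section DivisorBounds.
Variable R : realType.

Lemma harmonic_le n : (0 < n)%N ->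
  \sum_(1 <= d < n.+1) (d%:R^-1 : R) <= 1 + ln n%:R.
Proof.
elim: n => // -[|n] IH _; first by rewrite big_nat1 invr1 ln1 addr0.
rewrite big_nat_recr //=; have := IH isT.
have n1 : 0 < n.+1%:R :> R by rewrite ltr0n.
have n2 : 0 < n.+2%:R :> R by rewrite ltr0n.
have h : ln (n.+1%:R / n.+2%:R) <= - n.+2%:R^-1 :> R.
  have -> : n.+1%:R / n.+2%:R = 1 + (- n.+2%:R^-1) :> R.
    have gen (x : R) : x + 1 != 0 -> x / (x + 1) = 1 + - (x + 1)^-1 by move=> x1; field.
    by rewrite -(natr1 n.+1) gen // natr1 pnatr_eq0.
  apply: le_ln1Dx; rewrite ltrN2 invf_lt1 // ltr1n //.
move: h; rewrite ln_div ?posrE //.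
set x := ln n.+1%:R; set y := ln n.+2%:R; set u := _^-1; set v := \sum_(_ <= _ < _) _.
lra.
Qed.

Lemma sum_inv_multiples_le n g : (0 < n)%N -> (0 < g)%N ->
  \sum_(1 <= d < n.+1 | (g %| d)%N) (d%:R^-1 : R) <= g%:R^-1 * (1 + ln n%:R).
Proof.
move=> n0 g0.
have -> : \sum_(1 <= d < n.+1 | (g %| d)%N) (d%:R^-1 : R) =
   \sum_(1 <= d < n.+1 | (g %| d)%N) (if (d <= n)%N then d%:R^-1 else 0 : R).
  by rewrite big_nat_cond [RHS]big_nat_cond; apply: eq_bigr => d /andP[/andP[_ dn] _]; rewrite -ltnS dn.
rewrite sum_mult //; last by move=> m nm; rewrite leqNgt nm.
apply: le_trans (ler_wpM2l _ (harmonic_le n0)); last by rewrite invr_ge0.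
rewrite mulr_sumr; apply: ler_sum => j _; rewrite natrM invfM mulrC.
by case: ifP => // _; rewrite mulr_ge0 ?invr_ge0.
Qed.

Lemma count_multiples_le n c : (0 < c)%N ->
  \sum_(1 <= l < n.+1 | (c %| l)%N) (1 : R) <= n%:R / c%:R.
Proof.
move=> c0.
have -> : \sum_(1 <= l < n.+1 | (c %| l)%N) (1 : R)
  = \sum_(1 <= l < n.+1 | (c %| l)%N) (if (l <= n)%N then 1 else 0 : R).
  by rewrite big_nat_cond [RHS]big_nat_cond; apply: eq_bigr => d /andP[/andP[_ dn] _]; rewrite -ltnS dn.
rewrite sum_mult //; last by move=> m nm; rewrite leqNgt nm.
have -> : \sum_(1 <= j < n.+1) (if (j * c <= n)%N then 1 else 0 : R)
   = (\sum_(1 <= j < n.+1 | (j * c <= n)%N) 1)%N%:R.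
  by rewrite natr_sum -big_mkcond.
rewrite ler_pdivlMr ?ltr0n // -natrM ler_nat.
apply: leq_trans (leq_divM n c); rewrite leq_pmul2r //.
have le1 : (\sum_(1 <= j < n.+1 | (j * c <= n)%N) 1
   <= \sum_(0 <= j < n.+1 | (1 <= j < (n %/ c).+1)%N) 1)%N.
  rewrite [leqRHS]big_mkcond big_ltn //= add0n -big_mkcond /=.
  rewrite big_nat_cond [leqRHS]big_nat_cond.
  apply: eq_leq; apply: eq_bigl => j; rewrite [(j < (n %/ c).+1)%N]ltnS leq_divRL //.
  by case: (1 <= j)%N; rewrite ?andbF.
by apply: leq_trans le1 _; apply: leq_trans (sum_between _ _ _) _; rewrite subn1.
Qed.

Definition divisor_count n l : R := \sum_(1 <= d < n.+1 | (d %| l)%N) 1.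

(** The square counts pairs (d, f) with lcm(d, f) | l, hence is at most the sum of
    n gcd(d, f)/(d f).  Bounding gcd(d, f) by the sum of all common divisors g
    decouples d and f and leaves harmonic sums. *)
Lemma divisor_count_square_le n : (0 < n)%N ->
  \sum_(1 <= l < n.+1) divisor_count n l ^+ 2 <= n%:R * (1 + ln n%:R) ^+ 3.
Proof.
move=> n0; set Lg := 1 + ln n%:R.
have Lg0 : 0 <= Lg by rewrite addr_ge0 // ln_nat_ge0.
apply: (@le_trans _ _ (\sum_(1 <= d < n.+1) \sum_(1 <= f < n.+1)
    n%:R * (d%:R^-1 * f%:R^-1 * \sum_(1 <= g < n.+1 | (g %| d)%N && (g %| f)%N) g%:R))).
  rewrite [leLHS](_ : _ = \sum_(1 <= d < n.+1) \sum_(1 <= f < n.+1)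
      \sum_(1 <= l < n.+1 | (d %| l)%N && (f %| l)%N) 1); last first.
    under eq_bigr => l _.
      rewrite expr2 /divisor_count big_mkcond big_distrl /=.
      under eq_bigr => d _ do rewrite big_mkcond big_distrr /=.
      over.
    rewrite exchange_big_nat; apply: eq_bigr => d _ /=.
    rewrite exchange_big_nat; apply: eq_bigr => f _ /=.
    rewrite [RHS]big_mkcond; apply: eq_bigr => l _ /=.
    by case: (d %| l)%N; case: (f %| l)%N; rewrite ?mulr0 ?mul0r ?mulr1.
  apply: ler_sum_nat => d /andP[d1 dn]; apply: ler_sum_nat => f /andP[f1 fn].
  rewrite (eq_bigl (fun l => (lcmn d f %| l)%N)); last by move=> l; rewrite dvdn_lcm.
  apply: le_trans (count_multiples_le _ _) _; first by rewrite lcmn_gt0 d1.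
  apply: ler_wpM2l => //.
  have gp : (0 < gcdn d f)%N by rewrite gcdn_gt0 d1.
  have -> : (lcmn d f)%:R^-1 = d%:R^-1 * f%:R^-1 * (gcdn d f)%:R :> R.
    have : (lcmn d f)%:R * (gcdn d f)%:R = d%:R * f%:R :> R by rewrite -!natrM muln_lcm_gcd.
    have l0 : (lcmn d f)%:R != 0 :> R by rewrite pnatr_eq0 -lt0n lcmn_gt0 d1.
    have d0 : d%:R != 0 :> R by rewrite pnatr_eq0 -lt0n.
    have f0 : f%:R != 0 :> R by rewrite pnatr_eq0 -lt0n.
    move: l0; set L := _%:R => l0 h; apply: (mulfI l0); rewrite mulfV //.
    rewrite (_ : L * (d%:R^-1 * f%:R^-1 * (gcdn d f)%:R)
      = L * (gcdn d f)%:R * (d%:R^-1 * f%:R^-1)); last by ring.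
    by rewrite h; field; rewrite d0 f0.
  apply: ler_wpM2l; first by rewrite mulr_ge0 ?invr_ge0.
  rewrite big_mkcond (bigD1_seq (gcdn d f)) /= ?iota_uniq //; last first.
    rewrite mem_index_iota gp ltnS; apply: leq_trans (dvdn_leq d1 (dvdn_gcdl d f)) _.
    by rewrite -ltnS.
  by rewrite dvdn_gcdl dvdn_gcdr lerDl sumr_ge0 // => g _; case: ifP.
rewrite [leLHS](_ : _ = n%:R * \sum_(1 <= g < n.+1) g%:R *
   (\sum_(1 <= d < n.+1 | (g %| d)%N) d%:R^-1) ^+ 2); last first.
  under [LHS]eq_bigr => d _ do rewrite -mulr_sumr.
  rewrite -mulr_sumr; congr (_ * _).
  transitivity (\sum_(1 <= d < n.+1) \sum_(1 <= f < n.+1) \sum_(1 <= g < n.+1)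
     (g%:R * ((if (g %| d)%N then d%:R^-1 else 0) * (if (g %| f)%N then f%:R^-1 else 0 : R)))).
    apply: eq_bigr => d _; apply: eq_bigr => f _; rewrite mulr_sumr big_mkcond.
    apply: eq_bigr => g _.
    by case: (g %| d)%N; case: (g %| f)%N; rewrite /= ?mul0r ?mulr0 // mulrC.
  under eq_bigr => d _ do rewrite exchange_big_nat /=.
  rewrite exchange_big_nat; apply: eq_bigr => g _ /=.
  rewrite expr2 [X in _ = _ * (X * _)]big_mkcond /= big_distrl mulr_sumr.
  apply: eq_bigr => d _; rewrite -mulr_sumr; congr (_ * _).
  by rewrite -mulr_sumr [in RHS]big_mkcond.
apply: ler_wpM2l => //.
apply: (@le_trans _ _ (\sum_(1 <= g < n.+1) Lg ^+ 2 * g%:R^-1)).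
  apply: ler_sum_nat => g /andP[g1 gn].
  have gR : 0 < g%:R :> R by rewrite ltr0n.
  have -> : Lg ^+ 2 * g%:R^-1 = g%:R * (g%:R^-1 * Lg) ^+ 2 by field; rewrite gt_eqF.
  apply: ler_wpM2l => //; rewrite lerXn2r ?nnegrE ?mulr_ge0 ?invr_ge0 //.
    by apply: sumr_ge0 => d _; rewrite invr_ge0.
  exact: sum_inv_multiples_le.
rewrite -mulr_sumr [Lg ^+ 3]exprSr; apply: ler_wpM2l; first exact: exprn_ge0.
exact: harmonic_le.
Qed.

Lemma mobius_trunc_square_le U n : (0 < n)%N -> (U <= n)%N ->
  \sum_(1 <= l < n.+1) mobius_trunc R U l ^+ 2 <= n%:R * (1 + ln n%:R) ^+ 3.
Proof.
move=> n0 Un; apply: le_trans (divisor_count_square_le n0).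
apply: ler_sum => l _; rewrite -real_normK ?num_real //.
rewrite lerXn2r ?nnegrE //; first by apply: sumr_ge0.
apply: le_trans (ler_norm_sum _ _ _) _.
rewrite /divisor_count [leRHS](big_cat_nat (n := U.+1)) //=.
rewrite -[leLHS]addr0; apply: lerD; last exact: sumr_ge0.
by apply: ler_sum => d _; exact: norm_mobius.
Qed.

(** k^-s - k'^-s is k' - k times a sum of s products of inverse powers, each comparable to Y^-(s+1). *)
Lemma inv_pow_diff (s : nat) (k k' Y : R) : (0 < s)%N -> 0 < Y -> Y <= k -> k <= k' ->
  k' <= 4 * Y ->
  (k' - k) * (4 * Y) ^- s.+1 <= k ^- s - k' ^- s <= s%:R * (k' - k) * Y ^- s.+1.
Proof.
move=> s0 Y0 Yk kk k4.
have k0 : 0 < k by exact: lt_le_trans Yk.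
have k'0 : 0 < k' by exact: lt_le_trans kk.
have Y40 : 0 < 4 * Y by rewrite mulr_gt0.
have d0 : 0 <= k' - k by rewrite subr_ge0.
have Y4 : Y <= 4 * Y by lra.
pose P := \sum_(i < s) k' ^+ (s.-1 - i) * k ^+ i.
have E : k ^- s - k' ^- s = (k' - k) * P * (k ^+ s * k' ^+ s)^-1.
  rewrite /P -subrXX.
  by field; rewrite !gt_eqF ?exprn_gt0.
have Plow : k' ^+ s.-1 <= P.
  rewrite /P; case: s s0 {P E} => // s _; rewrite big_ord_recl /= subn0 expr0 mulr1 lerDl.
  by apply: sumr_ge0 => i _; rewrite mulr_ge0 ?exprn_ge0 // ltW.
have Pup : P <= s%:R * k' ^+ s.-1.
  apply: (@le_trans _ _ (\sum_(i < s) k' ^+ s.-1)).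
    apply: ler_sum => i _; have {2}-> : s.-1 = (s.-1 - i + i)%N.
      by rewrite subnK // -ltnS prednK.
    rewrite exprD; apply: ler_wpM2l; first by rewrite exprn_ge0 // ltW.
    by rewrite lerXn2r ?nnegrE ?(ltW k0) ?(ltW k'0).
  by rewrite sumr_const card_ord mulr_natl.
have kk's : k' ^+ s.-1 * (k ^+ s * k' ^+ s)^-1 = (k' * k ^+ s)^-1.
  case: s s0 {P E Plow Pup} => // s _ /=; rewrite !exprS.
  by field; rewrite !expf_neq0 ?gt_eqF.
have kp : 0 <= (k ^+ s * k' ^+ s)^-1 by rewrite invr_ge0 mulr_ge0 ?exprn_ge0 ?ltW.
have L : (4 * Y) ^- s.+1 <= P * (k ^+ s * k' ^+ s)^-1.
  apply: le_trans (ler_wpM2r kp Plow); rewrite kk's.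
  rewrite lef_pV2 ?posrE ?mulr_gt0 ?exprn_gt0 // exprS.
  apply: ler_pM; rewrite ?exprn_ge0 ?(ltW k0) ?(ltW k'0) //.
  by rewrite lerXn2r ?nnegrE ?(ltW k0) ?(ltW Y40) // (le_trans kk).
have U : P * (k ^+ s * k' ^+ s)^-1 <= s%:R * Y ^- s.+1.
  apply: le_trans (ler_wpM2r kp Pup) _; rewrite -mulrA kk's; apply: ler_wpM2l => //.
  rewrite lef_pV2 ?posrE ?mulr_gt0 ?exprn_gt0 // exprS.
  apply: ler_pM; rewrite ?exprn_ge0 ?(ltW Y0) //; first exact: le_trans kk.
  by rewrite lerXn2r ?nnegrE ?(ltW k0) ?(ltW Y0).
rewrite E -mulrA; apply/andP; split; first by apply: ler_wpM2l.
by rewrite [s%:R * _]mulrC -[_ * s%:R * _]mulrA; apply: ler_wpM2l.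
Qed.
End DivisorBounds.

(** * The inner sums of Vaughan's identity *)
Section PhaseSums.
Variable R : realType.
Variables (j0 J K : nat) (c : nat -> R).
Hypotheses (j00 : (0 < j0)%N) (c0 : c 0%N != 0).

Definition wave (n : nat) (m : nat) : R[i] := e (n%:R * phase j0 J c m%:R).

(** Size conditions for a block of integers of size N.  The cutoff U of Vaughan's
    identity is at most N^(1/4), so that for r <= U^2 an interval of length N/r is
    still longer than U; [adm_n] makes K differencing steps sufficient; [adm_U]
    and [adm_T] say that both the lengths and the phase n N^-j0 exceed the
    (K + 2)-nd power of q = z^(2^K): one factor q more than [smooth_phase_sum] asks
    for, to absorb the loss of z in the second part of [inner_sums]. *)
Record admissible (A : R) (n N U z : nat) : Prop := Admissible {
  adm_z : (0 < z)%N;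
  adm_N : (U ^ 4 <= N)%N;
  adm_n : (n <= U ^ K)%N;
  adm_U : A * (z ^ 2 ^ K)%:R ^+ K.+2 <= U%:R;
  adm_T : A * (z ^ 2 ^ K)%:R ^+ K.+2 * N%:R ^+ j0 <= n%:R }.

Lemma inv_pow_le1 (x : R) j : 1 <= x -> (0 < j)%N -> x ^- j <= x^-1.
Proof.
move=> x1; case: j => // j _; have x0 : 0 < x by exact: lt_le_trans x1.
by rewrite lef_pV2 ?posrE ?exprn_gt0 // exprS ler_peMr ?exprn_ege1 // ltW.
Qed.

(** Both kinds of sums have a phase of the form treated by [smooth_phase_sum].  In
    the first the coefficients are n c_j r^-(j0+j).  In the second they are
    n c_j (k^-s - k'^-s) with s = j0 + j, of size n c_j (k' - k)/Y^(s+1) by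
    [inv_pow_diff]; as k' - k is at least Y/z, the phase is smaller by at most a
    factor z. *)
Lemma inner_sums : exists2 A : R, 1 <= A & forall n N U z, admissible A n N U z ->
  (forall r a b, (0 < r <= U ^ 2)%N -> ((N %/ r).+1 <= a)%N -> (b <= 2 * (N %/ r).+1)%N ->
    cmod (\sum_(a <= k < b) wave n (r * k)%N) <= 8 * (N %/ r).+1%:R / z%:R) /\
  (forall L Y k k' a b, (U <= L)%N -> (0 < Y)%N -> (N <= 2 * (L * Y))%N -> (L * Y <= N)%N ->
    (Y <= k)%N -> (k < k')%N -> (k' < 4 * Y)%N -> (Y <= z * (k' - k))%N ->
    (L <= a)%N -> (b <= 2 * L)%N ->
    cmod (\sum_(a <= l < b) wave n (l * k)%N * cj (wave n (l * k')%N)) <= 8 * L%:R / z%:R).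
Proof.
have [kappa k0 [B B1 hS]] := smooth_phase_sum R J K j00.
pose Sc := \sum_(0 <= j < J.+1) `|c j|.
have Scj j : (j <= J)%N -> `|c j| <= Sc.
  move=> jJ; rewrite /Sc (bigD1_seq j) ?iota_uniq ?mem_index_iota ?ltnS //=.
  by rewrite lerDl sumr_ge0.
have cp : 0 < `|c 0%N| by rewrite normr_gt0.
have Sc0 : 0 <= Sc by apply: sumr_ge0.
pose W := Sc * (j0 + J)%:R * 2 * 4 ^+ j0.+1.
have W0 : 0 <= W by rewrite !mulr_ge0 ?exprn_ge0.
(* One summand for each of the inequalities a1, ..., a5 that A has to satisfy. *)
pose A := B + B * 2 ^+ j0 / `|c 0%N| + B * 4 ^+ j0.+1 / `|c 0%N|
   + W / (kappa * `|c 0%N|) + 6 * `|c 0%N| * j0%:R.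
have B0 : 0 < B by exact: lt_le_trans B1.
have p1 : 0 <= B * 2 ^+ j0 / `|c 0%N| by rewrite divr_ge0 ?mulr_ge0 ?exprn_ge0 // ltW.
have p2 : 0 <= B * 4 ^+ j0.+1 / `|c 0%N| by rewrite divr_ge0 ?mulr_ge0 ?exprn_ge0 // ltW.
have p3 : 0 <= W / (kappa * `|c 0%N|) by rewrite divr_ge0 ?mulr_ge0 // ltW.
have p4 : 0 <= 6 * `|c 0%N| * j0%:R by rewrite !mulr_ge0.
have a1 : B <= A by rewrite /A -!addrA lerDl !addr_ge0.
have a2 : B * 2 ^+ j0 <= A * `|c 0%N|.
  by rewrite -ler_pdivrMr // /A; move: (ltW B0) p1 p2 p3 p4; lra.
have a3 : B * 4 ^+ j0.+1 <= A * `|c 0%N|.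
  by rewrite -ler_pdivrMr // /A; move: (ltW B0) p1 p2 p3 p4; lra.
have a4 : W <= A * (kappa * `|c 0%N|).
  by rewrite -ler_pdivrMr ?mulr_gt0 // /A; move: (ltW B0) p1 p2 p3 p4; lra.
have a5 : 6 * `|c 0%N| * j0%:R <= A by rewrite /A; move: (ltW B0) p1 p2 p3 p4; lra.
have A1 : 1 <= A by exact: le_trans a1.
have A0 : 0 < A by exact: lt_le_trans A1.
exists A => // n N U z [z0 UN nU AU AT].
clearbody A.
set q := (z ^ 2 ^ K)%N in AU AT *.
have zq : (z <= q)%N by rewrite /q -[leqLHS]expn1 leq_pexp2l // expn_gt0.
have q1 : 1 <= q%:R :> R by rewrite ler1n; exact: leq_trans zq.
have q0 : 0 < q%:R :> R by exact: lt_le_trans q1.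
set Q : R := q%:R ^+ K.+2 in AU AT.
have Q1 : 1 <= Q by rewrite exprn_ege1.
have Q0 : 0 < Q by exact: lt_le_trans Q1.
have qQ : z%:R * q%:R ^+ K.+1 <= Q.
  by rewrite /Q [q%:R ^+ K.+2]exprS ler_wpM2r ?exprn_ge0 ?ler_nat // ltW.
have qQ' : q%:R ^+ K.+1 <= Q.
  by apply: le_trans qQ; rewrite ler_peMl ?exprn_ge0 ?(ltW q0) // ler1n.
have AU' : A <= U%:R by apply: le_trans AU; rewrite ler_peMr // ltW.
have U0 : (0 < U)%N by rewrite -(ltr_nat R); apply: lt_le_trans AU'.
have UN' : (U <= N)%N by apply: leq_trans UN; rewrite -[leqLHS]expn1 leq_pexp2l.
have AN : A <= N%:R by apply: le_trans AU' _; rewrite ler_nat.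
have N0 : (0 < N)%N by exact: leq_trans UN'.
have NR : 0 < N%:R :> R by rewrite ltr0n.
have nR0 : 0 <= n%:R :> R by [].
have nU' : n%:R <= U%:R ^+ K :> R by rewrite -natrX ler_nat.
split.
  move=> r a b /andP[r0 rU] Ma bM; set M := (N %/ r).+1 in Ma bM *.
  pose C j := n%:R * c j * r%:R ^- (j0 + j).
  have rR : 0 < r%:R :> R by rewrite ltr0n.
  have MR : 0 < M%:R :> R by rewrite ltr0n.
  have nr s : `|r%:R ^- s| = r%:R ^- s :> R by rewrite ger0_norm // invr_ge0 exprn_ge0.
  have UM : (U <= M)%N.
    apply: leqW; rewrite leq_divRL //; apply: leq_trans UN.
    apply: (@leq_trans (U * U ^ 2)%N); first by rewrite leq_mul2l rU orbT.
    by rewrite -expnS leq_pexp2l.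
  have UMR : U%:R <= M%:R :> R by rewrite ler_nat.
  have rM1 : N%:R <= r%:R * M%:R :> R.
    by rewrite -natrM ler_nat ltnW // mulnC; exact: ltn_ceil.
  have rN : (r <= N)%N.
    apply: leq_trans rU _; apply: leq_trans UN; exact: leq_pexp2l.
  have rM2 : r%:R * M%:R <= 2 * N%:R :> R.
    rewrite -!natrM ler_nat /M mulnS mul2n -addnn leq_add // mulnC leq_divM //.
  have rM0 : 0 < r%:R * M%:R :> R by rewrite mulr_gt0.
  have rMge1 : 1 <= r%:R * M%:R :> R by apply: le_trans rM1; rewrite ler1n.
  have TE : `|C 0%N| * M%:R ^- j0 = n%:R * `|c 0%N| * (r%:R * M%:R) ^- j0.
    rewrite /C addn0 !normrM (ger0_norm nR0) nr.
    by rewrite exprMn invfM !mulrA.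
  have -> : \sum_(a <= k < b) wave n (r * k)%N = \sum_(a <= k < b) e (phase j0 J C k%:R).
    apply: eq_bigr => k _; congr e; rewrite /phase mulr_sumr; apply: eq_bigr => j _.
    by rewrite /C natrM exprMn invfM !mulrA.
  apply: hS => //.
  - move=> j /andP[j1 jJ].
    rewrite /C !normrM (ger0_norm nR0) !nr addn0.
    have -> : n%:R * `|c j| * r%:R ^- (j0 + j) * M%:R ^- j
       = (n%:R * r%:R ^- j0) * (`|c j| * (r%:R * M%:R) ^- j).
      by rewrite exprD exprMn !invfM; ring.
    have -> : kappa * (n%:R * `|c 0%N| * r%:R ^- j0) = (n%:R * r%:R ^- j0) * (kappa * `|c 0%N|).
      by ring.
    apply: ler_wpM2l; first by rewrite mulr_ge0 ?invr_ge0 ?exprn_ge0 // ltW.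
    apply: (@le_trans _ _ (Sc * (r%:R * M%:R)^-1)).
      apply: ler_pM; rewrite ?invr_ge0 ?exprn_ge0 ?(ltW rM0) //; first exact: Scj.
      exact: inv_pow_le1.
    rewrite ler_pdivrMr //.
    have : Sc <= W.
      rewrite /W -!mulrA ler_peMr //.
      rewrite mulr_ege1 ?ler1n ?addn_gt0 ?j00 // mulr_ege1 ?ler1n // exprn_ege1 // ler1n //.
    move=> h; apply: le_trans h _; apply: le_trans a4 _.
    rewrite mulrC ler_pM2l ?mulr_gt0 //; exact: le_trans rM1.
  - apply: le_trans UMR; apply: le_trans AU.
    by apply: ler_pM => //; rewrite ?exprn_ge0 ?(ltW q0) ?(ltW B0).
  - rewrite TE; rewrite ler_pdivlMr ?exprn_gt0 //.
    apply: (@le_trans _ _ (B * Q * (2 * N%:R) ^+ j0)).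
      apply: ler_pM; rewrite ?mulr_ge0 ?exprn_ge0 ?(ltW q0) ?(ltW B0) ?(ltW rM0) //.
        by apply: ler_wpM2l => //; exact: ltW.
      by rewrite lerXn2r ?nnegrE ?(ltW rM0) // mulr_ge0.
    rewrite exprMn; have -> : B * Q * (2 ^+ j0 * N%:R ^+ j0) = B * 2 ^+ j0 * (Q * N%:R ^+ j0) by ring.
    apply: (@le_trans _ _ (A * `|c 0%N| * (Q * N%:R ^+ j0))).
      by apply: ler_wpM2r => //; rewrite mulr_ge0 ?exprn_ge0 // ltW.
    have -> : A * `|c 0%N| * (Q * N%:R ^+ j0) = (A * Q * N%:R ^+ j0) * `|c 0%N| by ring.
    by apply: ler_wpM2r.
  - rewrite TE; apply: (@le_trans _ _ n%:R); last first.
      by apply: le_trans nU' _; rewrite lerXn2r ?nnegrE.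
    rewrite -mulrA -[leRHS]mulr1; apply: ler_wpM2l => //.
    apply: (@le_trans _ _ (`|c 0%N| * (r%:R * M%:R)^-1)).
      by apply: ler_wpM2l => //; exact: inv_pow_le1.
    rewrite ler_pdivrMr // mul1r; apply: le_trans rM1; apply: le_trans AN.
    apply: le_trans a5; rewrite mulrAC -mulrA mulrC mulr_natl -mulr_natr -mulrA.
    by rewrite ler_peMr // mulr_ege1 ?ler1n.
move=> L Y k k' a b UL Y0 NLY LYN Yk kk k'Y Yz La bL.
pose d s : R := k%:R ^- s - k'%:R ^- s.
pose C j := n%:R * c j * d (j0 + j)%N.
have YR : 0 < Y%:R :> R by rewrite ltr0n.
have L0 : (0 < L)%N by exact: leq_trans UL.
have LR : 0 < L%:R :> R by rewrite ltr0n.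
have ULR : U%:R <= L%:R :> R by rewrite ler_nat.
pose D : R := k'%:R - k%:R.
have D0 : 0 < D by rewrite subr_gt0 ltr_nat.
have hd s : (0 < s)%N -> D * (4 * Y%:R) ^- s.+1 <= d s <= s%:R * D * Y%:R ^- s.+1.
  move=> s0; apply: inv_pow_diff => //; rewrite ?ler_nat ?(ltnW kk) //.
  by rewrite -natrM ler_nat ltnW.
have d0 s : (0 < s)%N -> 0 <= d s.
  move=> s0; have /andP[h _] := hd s s0; apply: le_trans h.
  by rewrite mulr_ge0 ?invr_ge0 ?exprn_ge0 ?mulr_ge0 ?(ltW D0).
have DY : Y%:R <= z%:R * D.
  by rewrite /D -natrB ?(ltnW kk) // -natrM ler_nat.
have DY3 : D <= 3 * Y%:R.
  have : k'%:R <= 4 * Y%:R :> R by rewrite -natrM ler_nat ltnW.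
  have : Y%:R <= k%:R :> R by rewrite ler_nat.
  rewrite /D; lra.
have LY1 : N%:R <= 2 * (L%:R * Y%:R) :> R by rewrite -!natrM ler_nat.
have LY2 : L%:R * Y%:R <= N%:R :> R by rewrite -natrM ler_nat.
have LY0 : 0 < L%:R * Y%:R :> R by rewrite mulr_gt0.
have LYge1 : 1 <= L%:R * Y%:R :> R by rewrite -natrM ler1n muln_gt0 L0.
have CE j : `|C j| = n%:R * `|c j| * d (j0 + j)%N.
  by rewrite /C !normrM (ger0_norm nR0) [`|d _|]ger0_norm // d0 // addn_gt0 j00.
have -> : \sum_(a <= l < b) wave n (l * k)%N * cj (wave n (l * k')%N)
   = \sum_(a <= l < b) e (phase j0 J C l%:R).
  apply: eq_bigr => l _; rewrite /wave -eB; congr e; rewrite -mulrBr /phase -sumrB mulr_sumr.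
  apply: eq_bigr => j _; rewrite /C /d !natrM !exprMn !invfM; ring.
apply: hS => //.
- move=> j /andP[j1 jJ]; rewrite !CE addn0.
  have j0j : (0 < j0 + j)%N by rewrite addn_gt0 j00.
  have /andP[_ hj] := hd _ j0j; have /andP[h0 _] := hd _ j00.
  apply: (@le_trans _ _ (kappa * (n%:R * `|c 0%N| * (D * (4 * Y%:R) ^- j0.+1)))); last first.
    by apply: ler_wpM2l; [exact: ltW|apply: ler_wpM2l => //; rewrite mulr_ge0].
  apply: (@le_trans _ _ (n%:R * Sc * ((j0 + J)%:R * D * Y%:R ^- (j0 + j).+1) * L%:R ^- j)).
    apply: ler_wpM2r; first by rewrite invr_ge0 exprn_ge0.
    apply: ler_pM; rewrite ?mulr_ge0 ?d0 //; first by apply: ler_wpM2l => //; exact: Scj.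
    apply: le_trans hj _; apply: ler_wpM2r; first by rewrite invr_ge0 exprn_ge0.
    by apply: ler_wpM2r; [exact: ltW|rewrite ler_nat leq_add2l].
  have -> : n%:R * Sc * ((j0 + J)%:R * D * Y%:R ^- (j0 + j).+1) * L%:R ^- j
    = (n%:R * D * Y%:R ^- j0.+1) * (Sc * (j0 + J)%:R * (L%:R * Y%:R) ^- j).
    by rewrite -addSn exprD exprMn !invfM; ring.
  have -> : kappa * (n%:R * `|c 0%N| * (D * (4 * Y%:R) ^- j0.+1))
    = (n%:R * D * Y%:R ^- j0.+1) * (kappa * `|c 0%N| * 4 ^- j0.+1).
    by rewrite exprMn invfM; ring.
  apply: ler_wpM2l; first by rewrite !mulr_ge0 ?invr_ge0 ?exprn_ge0 ?(ltW D0).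
  apply: (@le_trans _ _ (Sc * (j0 + J)%:R * (L%:R * Y%:R)^-1)).
    by apply: ler_wpM2l; [rewrite mulr_ge0|exact: inv_pow_le1].
  rewrite ler_pdivrMr // mulrAC ler_pdivlMr ?exprn_gt0 //.
  have h : W <= 2 * (kappa * `|c 0%N| * (L%:R * Y%:R)).
    apply: le_trans a4 _; rewrite mulrC mulrCA; apply: ler_wpM2l.
      by rewrite mulr_ge0 // ltW.
    exact: le_trans LY1.
  move: h; rewrite /W mulrAC; set u := Sc * _ * 4 ^+ _; set v := kappa * _ * _; lra.
- apply: le_trans ULR; apply: le_trans AU.
  by apply: ler_pM => //; rewrite ?exprn_ge0 ?(ltW q0) ?(ltW B0).
- rewrite CE addn0; have /andP[h0 _] := hd _ j00.
  apply: (@le_trans _ _ (n%:R * `|c 0%N| * (D * (4 * Y%:R) ^- j0.+1) * L%:R ^- j0)); last first.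
    by apply: ler_wpM2r; [rewrite invr_ge0 exprn_ge0|apply: ler_wpM2l => //; rewrite mulr_ge0].
  apply: (@le_trans _ _ (n%:R * `|c 0%N| * 4 ^- j0.+1 * (L%:R * Y%:R) ^- j0 * z%:R^-1)); last first.
    have -> : n%:R * `|c 0%N| * (D * (4 * Y%:R) ^- j0.+1) * L%:R ^- j0
      = n%:R * `|c 0%N| * 4 ^- j0.+1 * (L%:R * Y%:R) ^- j0 * (D * Y%:R^-1).
      by rewrite !exprMn [Y%:R ^+ j0.+1]exprS !invfM; ring.
    apply: ler_wpM2l; first by rewrite !mulr_ge0 ?invr_ge0 ?exprn_ge0 ?(ltW LY0).
    by rewrite ler_pdivlMr // mulrC ler_pdivrMr ?ltr0n // mulrC.
  rewrite ler_pdivlMr ?ltr0n // ler_pdivlMr ?exprn_gt0 // ler_pdivlMr ?exprn_gt0 //.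
  apply: (@le_trans _ _ (B * 4 ^+ j0.+1 * (Q * N%:R ^+ j0))).
    have -> : B * q%:R ^+ K.+1 * z%:R * (L%:R * Y%:R) ^+ j0 * 4 ^+ j0.+1
      = B * 4 ^+ j0.+1 * ((z%:R * q%:R ^+ K.+1) * (L%:R * Y%:R) ^+ j0) by ring.
    apply: ler_wpM2l; first by rewrite mulr_ge0 ?exprn_ge0 // ltW.
    apply: ler_pM => //; rewrite ?mulr_ge0 ?exprn_ge0 ?(ltW q0) ?(ltW LY0) //.
    by rewrite lerXn2r ?nnegrE ?(ltW LY0).
  apply: (@le_trans _ _ (A * `|c 0%N| * (Q * N%:R ^+ j0))).
    by apply: ler_wpM2r => //; rewrite mulr_ge0 ?exprn_ge0 // ltW.
  have -> : A * `|c 0%N| * (Q * N%:R ^+ j0) = (A * Q * N%:R ^+ j0) * `|c 0%N| by ring.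
  by apply: ler_wpM2r.
- rewrite CE addn0; have /andP[_ h0] := hd _ j00.
  apply: (@le_trans _ _ n%:R); last first.
    by apply: le_trans nU' _; rewrite lerXn2r ?nnegrE.
  apply: (@le_trans _ _ (n%:R * `|c 0%N| * (j0%:R * (3 * Y%:R) * Y%:R ^- j0.+1) * L%:R ^- j0)).
    apply: ler_wpM2r; first by rewrite invr_ge0 exprn_ge0.
    apply: ler_wpM2l; first by rewrite mulr_ge0.
    apply: le_trans h0 _; apply: ler_wpM2r; first by rewrite invr_ge0 exprn_ge0.
    exact: ler_wpM2l.
  have -> : n%:R * `|c 0%N| * (j0%:R * (3 * Y%:R) * Y%:R ^- j0.+1) * L%:R ^- j0
    = n%:R * (3 * `|c 0%N| * j0%:R * (L%:R * Y%:R) ^- j0).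
    by rewrite !exprMn exprS; field; rewrite !expf_neq0 ?gt_eqF.
  rewrite -[leRHS]mulr1; apply: ler_wpM2l => //.
  apply: (@le_trans _ _ (3 * `|c 0%N| * j0%:R * (L%:R * Y%:R)^-1)).
    by apply: ler_wpM2l; [rewrite !mulr_ge0|exact: inv_pow_le1].
  rewrite ler_pdivrMr // mul1r.
  move: a5 AN LY1; set u := `|c 0%N|; set w := j0%:R.
  have -> : 6 * u * w = 2 * (3 * u * w) by ring.
  set v := 3 * u * w; lra.
Qed.
End PhaseSums.

(** * Sums of a wave against the von Mangoldt function *)
(** The contexts of this part hold many facts about real and complex numbers, and
    few inequalities between naturals; clearing the former keeps the arithmetic
    procedures fast. *)
Ltac keep_nat := repeat match goal with H : ?P |- _ =>
  lazymatch P with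
  | is_true (leq _ _) => fail
  | is_true (andb _ _) => fail
  | is_true (negb _) => fail
  | nat => fail
  | @eq nat _ _ => fail
  | _ => clear H
  end end.
Ltac nlia := keep_nat; lia.
Ltac nnia := keep_nat; nia.

Section PrimeSums.
Variable R : realType.

Lemma sum_mask (V : nmodType) (F : nat -> V) lo hi a b :
  \sum_(lo <= k < hi) (if (a <= k < b)%N then F k else 0)
  = \sum_(maxn lo a <= k < minn hi b) F k.
Proof.
rewrite -big_mkcond /= [RHS](big_nat_widenl _ lo) ?leq_maxl //.
rewrite [RHS](big_nat_widen _ _ hi) ?geq_minl //.
rewrite big_nat_cond [RHS]big_nat_cond; apply: eq_bigl => k.
rewrite geq_max leq_min.
by case: (lo <= k)%N; case: (k < hi)%N; case: (a <= k)%N; case: (k < b)%N.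
Qed.

Lemma ln2_ge_half : 2^-1 <= ln 2 :> R.
Proof.
have := @le_ln1Dx R (- 2^-1).
have -> : 1 + - 2^-1 = 2^-1 :> R by lra.
by rewrite lnV ?posrE //; lra.
Qed.

Lemma ln2_le1 : ln 2 <= 1 :> R.
Proof. by have := @le_ln1Dx R 1; rewrite -[1 + 1]/2; apply; lra. Qed.

Lemma trunc_log2_le_ln n : (0 < n)%N -> (trunc_log 2 n)%:R <= 2 * ln n%:R :> R.
Proof.
move=> n0; have h : (trunc_log 2 n)%:R * ln 2 <= ln n%:R :> R.
  rewrite mulr_natl -lnXn // ler_ln ?posrE ?exprn_gt0 ?ltr0n //.
  by rewrite -natrX ler_nat trunc_logP.
have : (trunc_log 2 n)%:R * 2^-1 <= (trunc_log 2 n)%:R * ln 2 :> R.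
  by apply: ler_wpM2l => //; exact: ln2_ge_half.
lra.
Qed.

(** A single logarithm that majorizes 1 + log m for every m up to 4 N, hence for all
    the integers of the argument. *)
Definition log4 N : R := 1 + ln (4 * N%:R).

Lemma log4_ge1 N : (0 < N)%N -> 1 <= log4 N.
Proof.
move=> N0; rewrite /log4 lerDl -natrM; exact: ln_nat_ge0.
Qed.

Lemma ln_le_log4 N m : (0 < N)%N -> (m <= 4 * N)%N -> 1 + ln m%:R <= log4 N.
Proof.
case: m => [|m] N0 mN.
  by rewrite ln0 // addr0 log4_ge1.
by rewrite /log4 lerD2l -natrM ler_ln ?posrE ?ltr0n ?muln_gt0 // ler_nat.
Qed.

Variables (j0 J K : nat) (c : nat -> R).
Hypotheses (j00 : (0 < j0)%N) (c0 : c 0%N != 0).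
Notation wv := (wave j0 J c).

Section Fixed.
Variables (A : R) (n N N' U y : nat).
Hypothesis A4 : 4 <= A.
(* The type II sums are bounded through their squares, so they save only y = sqrt z. *)
Let z := (y ^ 2)%N.
Hypothesis adm : admissible j0 K A n N U z.
Hypothesis NN' : (N' <= 2 * N)%N.
Hypothesis typeI : forall r a b, (0 < r <= U ^ 2)%N -> ((N %/ r).+1 <= a)%N ->
    (b <= 2 * (N %/ r).+1)%N ->
    cmod (\sum_(a <= k < b) wv n (r * k)%N) <= 8 * (N %/ r).+1%:R / z%:R.
Hypothesis typeII : forall L Y k k' a b, (U <= L)%N -> (0 < Y)%N -> (N <= 2 * (L * Y))%N ->
   (L * Y <= N)%N ->
    (Y <= k)%N -> (k < k')%N -> (k' < 4 * Y)%N -> (Y <= z * (k' - k))%N ->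
    (L <= a)%N -> (b <= 2 * L)%N ->
    cmod (\sum_(a <= l < b) wv n (l * k)%N * cj (wv n (l * k')%N)) <= 8 * L%:R / z%:R.

Let z0 : (0 < z)%N. Proof. by case: adm. Qed.
Let y0 : (0 < y)%N. Proof. by move: z0; rewrite /z expn_gt0 orbF. Qed.
Let zR : 0 < z%:R :> R. Proof. by rewrite ltr0n. Qed.

Lemma adm_zU : (4 * z <= U)%N.
Proof.
case: adm => _ _ _ h _; rewrite -(ler_nat R); apply: le_trans h.
rewrite natrM; apply: ler_pM => //.
rewrite -natrX ler_nat -[z in leqLHS]expn1.
apply: (@leq_trans ((z ^ 2 ^ K) ^ 1)%N); first by rewrite [leqRHS]expn1 leq_pexp2l // expn_gt0.
by rewrite leq_pexp2l // expn_gt0 z0.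
Qed.
Let U4 : (4 <= U)%N.
Proof. by apply: leq_trans adm_zU; rewrite -[leqLHS]muln1 leq_mul2l z0. Qed.
Let U0 : (0 < U)%N. Proof. exact: leq_trans U4. Qed.
Let U2N : (U ^ 2 <= N)%N.
Proof. by case: adm => _ h _ _ _; apply: leq_trans h; exact: leq_pexp2l. Qed.
Let UN : (U <= N)%N.
Proof. by apply: leq_trans U2N; rewrite -[leqLHS]expn1 leq_pexp2l. Qed.
Let N0 : (0 < N)%N. Proof. exact: leq_trans UN. Qed.
Let NR : 0 < N%:R :> R. Proof. by rewrite ltr0n. Qed.
Notation Lg := (log4 N).
Let Lg1 : 1 <= Lg. Proof. exact: log4_ge1. Qed.
Let Lg0 : 0 <= Lg. Proof. exact: le_trans Lg1. Qed.

(* The wave cut off to the block, as Vaughan's identity requires. *)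
Let h m : R[i] := if (N < m <= N')%N then wv n m else 0.

Lemma norm_h m : cmod (h m) <= 1.
Proof. by rewrite /h /wave; case: ifP => _; rewrite ?norm_e ?cmod0. Qed.

Lemma sum_h (w : nat -> R[i]) r : (0 < r)%N ->
  \sum_(1 <= k < N'.+1) w k * h (r * k)%N =
  \sum_((N %/ r).+1 <= k < (N' %/ r).+1) w k * wv n (r * k)%N.
Proof.
move=> r0.
have -> : \sum_(1 <= k < N'.+1) w k * h (r * k)%N
  = \sum_(1 <= k < N'.+1) (if ((N %/ r).+1 <= k < (N' %/ r).+1)%N
       then w k * wv n (r * k)%N else 0).
  apply: eq_bigr => k _; rewrite /h ltnS ltn_divLR // leq_divRL // (mulnC r).
  by case: ifP; rewrite ?mulr0.
rewrite sum_mask; congr bigop.body; congr index_iota.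
  by rewrite (maxn_idPr _).
by apply/minn_idPr; rewrite ltnS leq_div.
Qed.

Lemma div_bounds r : (0 < r <= U ^ 2)%N ->
  ((N' %/ r).+1 <= 2 * (N %/ r).+1)%N /\ (N %/ r).+1%:R <= 2 * N%:R / r%:R :> R.
Proof.
move=> /andP[r0 rU]; split.
  rewrite ltn_divLR //; apply: leq_ltn_trans NN' _.
  by rewrite -mulnA ltn_mul2l /=; exact: ltn_ceil.
rewrite ler_pdivlMr ?ltr0n // -!natrM ler_nat mulSn mul2n -addnn.
by rewrite leq_add ?leq_divM // (leq_trans rU).
Qed.

(** The logarithm is removed by summation by parts; the sum over d of N/d costs
    another logarithm. *)
Lemma typeI_log_bound :
  cmod (\sum_(1 <= d < U.+1) toC (mobius R d) *
    (\sum_(1 <= k < N'.+1) toC (ln k%:R) * h (d * k)%N)) <= 32 * (N%:R / z%:R) * Lg ^+ 2.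
Proof.
apply: le_trans (cmod_sum _ _ _) _.
apply: (@le_trans _ _ (\sum_(1 <= d < U.+1) 32 * (N%:R / z%:R) * Lg * d%:R^-1)).
  apply: ler_sum_nat => d /andP[d1 dU].
  have dU2 : (0 < d <= U ^ 2)%N.
    by rewrite d1 /=; apply: (@leq_trans U); [|rewrite expnS expn1 leq_pmulr].
  have [b1 b2] := div_bounds dU2.
  have dR : 0 < d%:R :> R by rewrite ltr0n.
  rewrite cmodM cmod_toC -[leRHS]mul1r.
  apply: ler_pM; rewrite ?cmod_ge0 ?norm_mobius // sum_h //.
  have R0 : 0 <= 32 * (N%:R / z%:R) * Lg / d%:R :> R by rewrite !mulr_ge0 ?invr_ge0.
  have [ba|ab] := leqP (N' %/ d).+1 (N %/ d).+1; first by rewrite big_geq // cmod0.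
  apply: (@le_trans _ _ (2 * (Lg * (8 * (N %/ d).+1%:R / z%:R)))).
    apply: (@abel_isotone _ (fun k => ln k%:R)) => //.
    - move=> k /andP[k1 k2]; rewrite ln_nat_ge0 /=.
      apply: le_trans (ln_le_log4 (m := k) N0 _); first by rewrite lerDr.
      have := leq_div N' d; nlia.
    - by move=> k k1 k2; rewrite ler_ln ?posrE ?ler_nat ?ltr0n //; nlia.
    - move=> f /andP[f1 f2]; apply: typeI => //; exact: leq_trans b1.
  have -> : 32 * (N%:R / z%:R) * Lg / d%:R = 2 * (Lg * (8 * (2 * N%:R / d%:R) / z%:R)) :> R.
    by field; rewrite !gt_eqF.
  apply: ler_wpM2l => //; apply: ler_wpM2l => //.
  by apply: ler_wpM2r; [rewrite invr_ge0|apply: ler_wpM2l].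
have -> : 32 * (N%:R / z%:R) * Lg ^+ 2 = 32 * (N%:R / z%:R) * Lg * Lg by ring.
rewrite -mulr_sumr; apply: ler_wpM2l; first by rewrite !mulr_ge0 ?invr_ge0.
by apply: le_trans (harmonic_le R U0) _; apply: ln_le_log4 => //; nlia.
Qed.

Lemma typeI_bound :
  cmod (\sum_(1 <= d < U.+1) \sum_(1 <= v < U.+1) toC (mobius R d * mangoldt R v) *
       (\sum_(1 <= k < N'.+1) h (d * v * k)%N)) <= 16 * (N%:R / z%:R) * Lg ^+ 3.
Proof.
apply: le_trans (cmod_sum _ _ _) _.
apply: (@le_trans _ _ (\sum_(1 <= d < U.+1) \sum_(1 <= v < U.+1)
    16 * (N%:R / z%:R) * Lg * d%:R^-1 * v%:R^-1)).
  apply: ler_sum_nat => d /andP[d1 dU]; apply: le_trans (cmod_sum _ _ _) _.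
  apply: ler_sum_nat => v /andP[v1 vU].
  have dvU : (0 < d * v <= U ^ 2)%N by rewrite muln_gt0 d1 v1 expnS expn1 leq_mul.
  have [b1 b2] := div_bounds dvU.
  have dR : 0 < d%:R :> R by rewrite ltr0n.
  have vR : 0 < v%:R :> R by rewrite ltr0n.
  rewrite cmodM cmod_toC normrM.
  have -> : \sum_(1 <= k < N'.+1) h (d * v * k)%N
    = \sum_(1 <= k < N'.+1) 1 * h (d * v * k)%N.
    by apply: eq_bigr => k _; rewrite mul1r.
  rewrite sum_h ?muln_gt0 ?d1 //.
  under eq_bigr => k _ do rewrite mul1r.
  apply: (@le_trans _ _ (Lg * (8 * (N %/ (d * v)).+1%:R / z%:R))).
    apply: ler_pM; rewrite ?mulr_ge0 ?cmod_ge0 //; last by apply: typeI.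
    rewrite -[leRHS]mul1r; apply: ler_pM; rewrite ?norm_mobius // ger0_norm ?mangoldt_ge0 //.
    apply: le_trans (mangoldt_le_ln R v1) _.
    apply: le_trans (ln_le_log4 (m := v) N0 _); first by rewrite lerDr.
    nlia.
  have -> : 16 * (N%:R / z%:R) * Lg / d%:R / v%:R
     = Lg * (8 * (2 * N%:R / (d * v)%:R) / z%:R) :> R.
    by rewrite natrM; field; rewrite !gt_eqF.
  apply: ler_wpM2l => //.
  by apply: ler_wpM2r; [rewrite invr_ge0|apply: ler_wpM2l].
have H : \sum_(1 <= d < U.+1) (d%:R^-1 : R) <= Lg.
  by apply: le_trans (harmonic_le R U0) _; apply: ln_le_log4 => //; nlia.
have H0 : 0 <= \sum_(1 <= d < U.+1) (d%:R^-1 : R).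
  by apply: sumr_ge0 => d _; rewrite invr_ge0.
under eq_bigr => d _ do rewrite -mulr_sumr.
rewrite -mulr_suml -mulr_sumr.
have -> : 16 * (N%:R / z%:R) * Lg ^+ 3 = 16 * (N%:R / z%:R) * Lg * Lg * Lg by ring.
have P0 : 0 <= 16 * (N%:R / z%:R) * Lg by rewrite !mulr_ge0 ?invr_ge0.
apply: ler_pM => //; first by rewrite mulr_ge0.
by apply: ler_wpM2l.
Qed.

(* Extended by zero, so that k may range over an interval that depends only on N and L. *)
Let Lam k : R := if (U < k <= N')%N then mangoldt R k else 0.

Lemma norm_Lam k : `|Lam k| <= Lg.
Proof.
rewrite /Lam; case: ifPn => [/andP[k1 k2]|_]; last by rewrite normr0.
have k0 : (0 < k)%N by nlia.
rewrite ger0_norm ?mangoldt_ge0 //; apply: le_trans (mangoldt_le_ln R k0) _.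
apply: le_trans (ln_le_log4 (m := k) N0 _); first by rewrite lerDr.
nlia.
Qed.

Let G l := \sum_(U.+1 <= k < N'.+1) toC (mangoldt R k) * h (l * k)%N.

(* One dyadic block L <= l < 2 L of the bilinear sum; the products l k that
   contribute are of size N, which confines k to the interval from Y to 4 Y. *)
Section Block.
Variable L : nat.
Hypotheses (UL : (U <= L)%N) (LU : (L * U.+1 <= N')%N).
Let Y := (N %/ (2 * L)).+1.

Let L0 : (0 < L)%N. Proof. exact: leq_trans UL. Qed.
Lemma block_L2 : (2 * L <= N)%N.
Proof. by have := LU; have := NN'; have := U4; nnia. Qed.
Lemma block_NLY : (N < 2 * (L * Y))%N.
Proof. by rewrite mulnA mulnC; apply: ltn_ceil; rewrite muln_gt0. Qed.
Lemma block_LYN : (L * Y <= N)%N.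
Proof.
have h1 := leq_divM N (2 * L); have h2 := block_L2.
by rewrite /Y mulnS; nlia.
Qed.
Lemma block_zY : (z <= Y)%N.
Proof. by have := block_NLY; have := LU; have := NN'; have := adm_zU; nnia. Qed.

Lemma G_block l : (L <= l < 2 * L)%N ->
  G l = \sum_(Y <= k < 4 * Y) toC (Lam k) * h (l * k)%N.
Proof.
move=> /andP[Ll lL].
have -> : G l = \sum_(0 <= k < N'.+1 + 4 * Y)
     (if (U.+1 <= k < N'.+1)%N then toC (mangoldt R k) * h (l * k)%N else 0).
  by rewrite sum_mask max0n (minn_idPr _) ?leq_addr.
have -> : \sum_(Y <= k < 4 * Y) toC (Lam k) * h (l * k)%N = \sum_(0 <= k < N'.+1 + 4 * Y)
     (if (Y <= k < 4 * Y)%N then toC (Lam k) * h (l * k)%N else 0).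
  by rewrite sum_mask max0n (minn_idPr _) ?leq_addl.
apply: eq_bigr => k _; rewrite /Lam [(k < N'.+1)%N]ltnS.
have [hk|hk] := boolP (N < l * k <= N')%N; last first.
  by rewrite /h (negbTE hk) !mulr0; case: ifP; case: ifP.
have [k1 k2] : (Y <= k)%N /\ (k < 4 * Y)%N.
  case/andP: hk => hk1 hk2; split.
    by rewrite /Y ltn_divLR ?muln_gt0 //; apply: leq_trans hk1 _; nnia.
  by have := block_NLY; have := NN'; nnia.
by rewrite k1 k2; case: ifP => _; rewrite ?mul0r.
Qed.

(** Pairs (k, k') at distance at most Y/z are bounded trivially by the length of the
    sum; the others are type II sums. *)
Lemma pair_bound k k' : (Y <= k)%N -> (k < 4 * Y)%N -> (Y <= k')%N -> (k' < 4 * Y)%N ->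
  cmod (\sum_(L <= l < 2 * L) h (l * k)%N * cj (h (l * k')%N)) <=
   (if (k - Y %/ z <= k' < k + (Y %/ z).+1)%N then L%:R else 0) + 8 * L%:R / z%:R.
Proof.
have far u v : (Y <= u)%N -> (u < v)%N -> (v < 4 * Y)%N -> (Y <= z * (v - u))%N ->
   cmod (\sum_(L <= l < 2 * L) h (l * u)%N * cj (h (l * v)%N)) <= 8 * L%:R / z%:R.
  move=> Yu uv vY far.
  have u0 : (0 < u)%N by apply: leq_trans Yu.
  have v0 : (0 < v)%N by apply: leq_trans uv.
  have -> : \sum_(L <= l < 2 * L) h (l * u)%N * cj (h (l * v)%N)
    = \sum_(L <= l < 2 * L) (if ((N %/ u).+1 <= l < (N' %/ v).+1)%N
        then wv n (l * u)%N * cj (wv n (l * v)%N) else 0).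
    apply: eq_bigr => l _; rewrite ltnS ltn_divLR // leq_divRL // /h.
    have uvl : (l * u <= l * v)%N by rewrite leq_mul2l (ltnW uv) orbT.
    have [/andP[g1 g2]|g] := boolP ((N < l * u)%N && (l * v <= N')%N).
      have e1 : (N < l * u <= N')%N by nlia.
      have e2 : (N < l * v <= N')%N by nlia.
      by rewrite e1 e2.
    have [e1|_] := boolP (N < l * u <= N')%N; last by rewrite mul0r.
    by rewrite ifF ?[cj 0]conjc0 ?mulr0 //; apply/negbTE; nlia.
  rewrite sum_mask; apply: (typeII (Y := Y)) => //.
  - exact: ltnW block_NLY.
  - exact: block_LYN.
  - exact: leq_maxl.
  - exact: geq_minl.
have E0 : 0 <= 8 * L%:R / z%:R :> R by rewrite !mulr_ge0 ?invr_ge0.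
move=> Yk kY Yk' k'Y; case: ifPn => near.
  rewrite ler_wpDr //; apply: le_trans (cmod_sum _ _ _) _.
  apply: (@le_trans _ _ (\sum_(L <= l < 2 * L) 1)).
    apply: ler_sum => l _; rewrite cmodM cmod_cj -[leRHS]mulr1.
    by apply: ler_pM; rewrite ?cmod_ge0 ?norm_h.
  by rewrite sumr_const_nat ler_nat; nlia.
rewrite add0r.
have [kk|kk|kk] := ltngtP k k'; last first.
- by move: near; rewrite kk leq_subr /= addnS ltnS leq_addr.
- have -> : \sum_(L <= l < 2 * L) h (l * k)%N * cj (h (l * k')%N)
    = cj (\sum_(L <= l < 2 * L) h (l * k')%N * cj (h (l * k)%N)).
    rewrite cj_sum; apply: eq_bigr => l _; rewrite cjM [cj (cj _)]conjcK; exact: mulrC.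
  rewrite cmod_cj; apply: far => //.
  have : (Y %/ z < k - k')%N by move: near; move: (Y %/ z)%N => t near; nlia.
  by rewrite ltn_divLR // mulnC => /ltnW.
apply: far => //.
have : (Y %/ z < k' - k)%N by move: near; move: (Y %/ z)%N => t near; nlia.
by rewrite ltn_divLR // mulnC => /ltnW.
Qed.

(** Open the square and exchange the sums.  For each of the 3 Y values of k, at most
    3 Y/z values of k' are close to k, and the 3 Y others contribute 8 L/z each:
    81 = 3 * (3 + 3 * 8). *)
Lemma block_square : \sum_(L <= l < 2 * L) cmod (G l) ^+ 2
  <= 81 * Lg ^+ 2 * (Y%:R ^+ 2 * L%:R / z%:R).
Proof.
have pos : 0 <= \sum_(L <= l < 2 * L) cmod (G l) ^+ 2.
  by apply: sumr_ge0 => l _; exact: sqr_ge0.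
rewrite -(ger0_norm pos) -cmod_toC toC_sum.
have -> : \sum_(L <= l < 2 * L) toC (cmod (G l) ^+ 2) =
   \sum_(Y <= k < 4 * Y) \sum_(Y <= k' < 4 * Y) toC (Lam k * Lam k') *
      \sum_(L <= l < 2 * L) h (l * k)%N * cj (h (l * k')%N).
  rewrite (eq_big_nat _ _ (F2 := fun l => \sum_(Y <= k < 4 * Y) \sum_(Y <= k' < 4 * Y)
      toC (Lam k * Lam k') * (h (l * k)%N * cj (h (l * k')%N)))); last first.
    move=> l lL; rewrite -mul_cj (G_block lL) cj_sum big_distrl /=.
    apply: eq_bigr => k _; rewrite big_distrr /=; apply: eq_bigr => k' _.
    by rewrite cjM cj_toC toCM; ring.
  rewrite exchange_big_nat; apply: eq_bigr => k _ /=.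
  rewrite exchange_big_nat; apply: eq_bigr => k' _ /=.
  by rewrite mulr_sumr.
have z2 : z%:R != 0 :> R by rewrite gt_eqF.
have YR : 0 <= Y%:R :> R by [].
apply: le_trans (cmod_sum _ _ _) _.
apply: (@le_trans _ _ (\sum_(Y <= k < 4 * Y) Lg ^+ 2 * (27 * Y%:R * L%:R / z%:R))); last first.
  rewrite sumr_const_nat -[leLHS]mulr_natl.
  have -> : (4 * Y - Y = 3 * Y)%N by nlia.
  rewrite natrM le_eqVlt; apply/orP; left; apply/eqP; field.
  exact: z2.
apply: ler_sum_nat => k /andP[k1 k2]; apply: le_trans (cmod_sum _ _ _) _.
apply: (@le_trans _ _ (\sum_(Y <= k' < 4 * Y) Lg ^+ 2 *
   ((if (k - Y %/ z <= k' < k + (Y %/ z).+1)%N then L%:R else 0) + 8 * L%:R / z%:R))).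
  apply: ler_sum_nat => k' /andP[k1' k2']; rewrite cmodM cmod_toC normrM expr2.
  by apply: ler_pM; rewrite ?mulr_ge0 ?cmod_ge0 ?pair_bound // ler_pM ?norm_Lam.
rewrite -mulr_sumr; apply: ler_wpM2l; first exact: exprn_ge0.
rewrite big_split /= sum_mask !sumr_const_nat.
have -> : (4 * Y - Y = 3 * Y)%N by nlia.
rewrite -[L%:R *+ _]mulr_natl -[(_ / _) *+ _]mulr_natl.
have -> : 27 * Y%:R * L%:R / z%:R = 3 * (Y%:R / z%:R) * L%:R + (3 * Y)%:R * (8 * L%:R / z%:R) :> R.
  by rewrite natrM; field; exact: z2.
rewrite lerD2r; apply: ler_wpM2r => //.
rewrite mulrA ler_pdivlMr // -!natrM ler_nat.
have t1 : (0 < Y %/ z)%N by rewrite divn_gt0 // block_zY.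
have := leq_divM Y z; move: t1; set t := (Y %/ z)%N => t1 tY.
apply: (@leq_trans (3 * t * z)); last by rewrite -mulnA leq_mul2l.
by rewrite leq_mul2r; apply/orP; right; nlia.
Qed.

(** Cauchy-Schwarz, with the mean square of the truncated Moebius sums.  The constant
    is explained by 2 * 81 <= 13^2. *)
Lemma block_bound : cmod (\sum_(L <= l < 2 * L) toC (mobius_trunc R U l) * G l)
  <= 13 * N%:R * Lg ^+ 3 / y%:R.
Proof.
have yR : 0 < y%:R :> R by rewrite ltr0n.
rewrite -(@ler_pXn2r _ 2) ?nnegrE ?cmod_ge0 ?divr_ge0 ?mulr_ge0 ?exprn_ge0 //.
apply: (@le_trans _ _ ((\sum_(L <= l < 2 * L) `|mobius_trunc R U l| * cmod (G l)) ^+ 2)).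
  rewrite lerXn2r ?nnegrE ?cmod_ge0 //.
    by apply: sumr_ge0 => l _; rewrite mulr_ge0 ?cmod_ge0.
  apply: le_trans (cmod_sum _ _ _) _.
  by apply: ler_sum => l _; rewrite cmodM cmod_toC.
apply: le_trans (cauchy_schwarz _ _ _) _.
apply: (@le_trans _ _ ((2 * L%:R * Lg ^+ 3) * (81 * Lg ^+ 2 * (Y%:R ^+ 2 * L%:R / z%:R)))).
  apply: ler_pM; [by apply: sumr_ge0 => l _; exact: sqr_ge0|
    by apply: sumr_ge0 => l _; exact: sqr_ge0| |exact: block_square].
  apply: (@le_trans _ _ (\sum_(1 <= l < (2 * L).+1) mobius_trunc R U l ^+ 2)).
    rewrite [leRHS](big_cat_nat (n := L)) ?(leqW (leq_pmull _ _)) //=.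
    rewrite -[leLHS]add0r; apply: lerD; first by apply: sumr_ge0 => l _; exact: sqr_ge0.
    rewrite [leRHS]big_nat_recr ?leq_pmull //= -[leLHS]addr0; apply: lerD; last exact: sqr_ge0.
    by apply: ler_sum => l _; rewrite real_normK ?num_real.
  have L20 : (0 < 2 * L)%N by rewrite muln_gt0.
  have UL2 : (U <= 2 * L)%N by nlia.
  apply: le_trans (mobius_trunc_square_le R L20 UL2) _.
  rewrite -natrM; apply: ler_wpM2l => //.
  have lnL0 : 0 <= 1 + ln (2 * L)%:R :> R by rewrite addr_ge0 // ln_nat_ge0.
  rewrite lerXn2r ?nnegrE //.
  by apply: ln_le_log4 => //; have := block_L2; nlia.
have -> : 2 * L%:R * Lg ^+ 3 * (81 * Lg ^+ 2 * (Y%:R ^+ 2 * L%:R / z%:R))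
  = 162 * Lg ^+ 5 * (L%:R * Y%:R) ^+ 2 / y%:R ^+ 2 :> R.
  by rewrite /z natrX; field; rewrite gt_eqF.
have -> : (13 * N%:R * Lg ^+ 3 / y%:R) ^+ 2 = 169 * Lg ^+ 6 * N%:R ^+ 2 / y%:R ^+ 2 :> R.
  by field; rewrite gt_eqF.
apply: ler_wpM2r; first by rewrite invr_ge0 exprn_ge0.
have s1 : (L%:R * Y%:R) ^+ 2 <= N%:R ^+ 2 :> R.
  by rewrite lerXn2r ?nnegrE ?mulr_ge0 // -natrM ler_nat block_LYN.
have s2 : Lg ^+ 5 <= Lg ^+ 6 by rewrite [leRHS]exprS ler_peMl ?exprn_ge0.
apply: ler_pM; rewrite ?mulr_ge0 ?exprn_ge0 ?sqr_ge0 //.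
by apply: ler_pM; rewrite ?exprn_ge0 //; lra.
Qed.
End Block.

Lemma block_bound_all L : (U <= L)%N ->
  cmod (\sum_(L <= l < 2 * L) toC (mobius_trunc R U l) * G l) <= 13 * N%:R * Lg ^+ 3 / y%:R.
Proof.
move=> UL; have [LU|LU] := leqP (L * U.+1) N'; first exact: block_bound.
rewrite big_nat_cond big1 ?cmod0 ?divr_ge0 ?mulr_ge0 ?exprn_ge0 //.
move=> l /andP[/andP[l1 l2] _]; rewrite /G big_nat_cond big1 ?mulr0 // => k /andP[/andP[k1 k2] _].
rewrite /h ifF ?mulr0 //; apply/negbTE; rewrite negb_and -!leqNgt; apply/orP; right.
rewrite -ltnNge; apply: leq_trans LU _; exact: leq_mul.
Qed.

(** At most 2 Lg dyadic blocks cover the range of l. *)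
Lemma typeII_bound :
  cmod (\sum_(U.+1 <= l < N'.+1) toC (mobius_trunc R U l) * G l) <= 26 * N%:R * Lg ^+ 4 / y%:R.
Proof.
pose F l := toC (mobius_trunc R U l) * G l.
have dy I : \sum_(U.+1 <= l < U.+1 * 2 ^ I) F l
   = \sum_(0 <= i < I) \sum_(U.+1 * 2 ^ i <= l < 2 * (U.+1 * 2 ^ i)) F l.
  elim: I => [|I IH]; first by rewrite expn0 muln1 !big_geq.
  rewrite big_nat_recr //= -IH -big_cat_nat //=; [by rewrite expnS mulnCA|by rewrite leq_pmulr ?expn_gt0|by rewrite leq_pmull].
pose I := (trunc_log 2 N'.+1).+1.
have NI : (N'.+1 <= U.+1 * 2 ^ I)%N.
  have := trunc_log_ltn N'.+1 (isT : 1 < 2)%N; rewrite -/I => /ltnW h1.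
  by apply: leq_trans h1 _; rewrite leq_pmull.
have -> : \sum_(U.+1 <= l < N'.+1) F l = \sum_(U.+1 <= l < U.+1 * 2 ^ I) F l.
  have [UN'|UN'] := leqP U.+1 N'.+1; last first.
    rewrite big_geq ?(ltnW UN') // big_nat_cond big1 // => l /andP[/andP[l1 l2] _].
    by rewrite /F /G big_geq ?mulr0 // ltnW.
  rewrite [RHS](big_cat_nat (n := N'.+1)) //= [X in _ = _ + X]big_nat_cond.
  rewrite [X in _ = _ + X]big1 ?addr0 // => l /andP[/andP[l1 l2] _].
  rewrite /F /G big_nat_cond big1 ?mulr0 // => k /andP[/andP[k1 k2] _].
  rewrite /h ifF ?mulr0 //; apply/negbTE; rewrite negb_and -!leqNgt; apply/orP; right.
  by rewrite -ltnNge; apply: leq_trans l1 _; rewrite leq_pmulr //; nlia.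
rewrite dy; apply: le_trans (cmod_sum _ _ _) _.
apply: (@le_trans _ _ (\sum_(0 <= i < I) 13 * N%:R * Lg ^+ 3 / y%:R)).
  apply: ler_sum => i _; apply: block_bound_all.
  by apply: leq_trans (leqnSn U) _; rewrite leq_pmulr // expn_gt0.
rewrite sumr_const_nat subn0 -[leLHS]mulr_natl.
have IL : I%:R <= 2 * Lg.
  have t2 := trunc_log2_le_ln (ltn0Sn N').
  have t3 : 1 + ln N'.+1%:R <= Lg by apply: ln_le_log4 => //; nlia.
  by rewrite /I -natr1; lra.
have -> : 26 * N%:R * Lg ^+ 4 / y%:R = 2 * Lg * (13 * N%:R * Lg ^+ 3 / y%:R) :> R.
  by rewrite [Lg ^+ 4]exprS; ring.
apply: ler_wpM2r => //.
by rewrite !mulr_ge0 ?invr_ge0 ?exprn_ge0.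
Qed.

Lemma mangoldt_wave_bound :
  cmod (\sum_(N.+1 <= m < N'.+1) toC (mangoldt R m) * wv n m) <= 74 * N%:R * Lg ^+ 4 / y%:R.
Proof.
have [N'N|N'N] := leqP N'.+1 N.+1.
  by rewrite big_geq // cmod0 !mulr_ge0 ?invr_ge0 ?exprn_ge0.
have -> : \sum_(N.+1 <= m < N'.+1) toC (mangoldt R m) * wv n m
  = \sum_(1 <= m < N'.+1) toC (mangoldt R m) * h m.
  rewrite [RHS](big_cat_nat (n := N.+1)) //=; last exact: ltnW.
  rewrite [X in _ = X + _]big_nat_cond [X in _ = X + _]big1 ?add0r; last first.
    by move=> m /andP[/andP[_ m1] _]; rewrite /h ifF ?mulr0 //; apply/negbTE; nlia.
  by apply: eq_big_nat => m /andP[m1 m2]; rewrite /h ifT //; nlia.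
rewrite (@vaughan_identity R h U U) //; [|nlia|nlia| |]; last first.
- by move=> m mU; rewrite /h ifF //; apply/negbTE; nlia.
- by move=> m mN; rewrite /h ifF //; apply/negbTE; nlia.
have -> : \sum_(U.+1 <= l < N'.+1) \sum_(U.+1 <= k < N'.+1)
       toC (mobius_trunc R U l * mangoldt R k) * h (l * k)%N
   = \sum_(U.+1 <= l < N'.+1) toC (mobius_trunc R U l) * G l.
  by apply: eq_bigr => l _; rewrite mulr_sumr; apply: eq_bigr => k _; rewrite toCM mulrA.
apply: le_trans (cmodB _ _) _.
apply: le_trans (lerD (cmodB _ _) (lexx _)) _.
have b1 := typeI_log_bound; have b2 := typeI_bound; have b3 := typeII_bound.
apply: le_trans (lerD (lerD b1 b2) b3) _.
have yR : 0 < y%:R :> R by rewrite ltr0n.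
have zy : z%:R^-1 <= y%:R^-1 :> R.
  rewrite lef_pV2 ?posrE // ler_nat /z -[leqLHS]expn1; exact: leq_pexp2l.
have l24 : Lg ^+ 2 <= Lg ^+ 4 by apply: ler_weXn2l.
have l34 : Lg ^+ 3 <= Lg ^+ 4 by apply: ler_weXn2l.
have g1 : 32 * (N%:R / z%:R) * Lg ^+ 2 <= 32 * (N%:R / y%:R) * Lg ^+ 4.
  apply: ler_pM; rewrite ?exprn_ge0 ?mulr_ge0 ?invr_ge0 //.
  by apply: ler_wpM2l => //; apply: ler_wpM2l.
have g2 : 16 * (N%:R / z%:R) * Lg ^+ 3 <= 16 * (N%:R / y%:R) * Lg ^+ 4.
  apply: ler_pM; rewrite ?exprn_ge0 ?mulr_ge0 ?invr_ge0 //.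
  by apply: ler_wpM2l => //; apply: ler_wpM2l.
have -> : 74 * N%:R * Lg ^+ 4 / y%:R = 32 * (N%:R / y%:R) * Lg ^+ 4
   + 16 * (N%:R / y%:R) * Lg ^+ 4 + 26 * N%:R * Lg ^+ 4 / y%:R by field; rewrite gt_eqF.
by rewrite lerD2r lerD.
Qed.
End Fixed.
End PrimeSums.

(** * Sums of a wave over the primes of a dyadic block *)
Section PrimeWaveSmall.
Variable R : realType.

Lemma expn2_ge_pow5 m : (m.+1 ^ 5 <= 5 ^ 5 * 2 ^ m)%N.
Proof.
have h : (m.+1 <= 5 * (m %/ 5).+1)%N by lia.
apply: (@leq_trans ((5 * (m %/ 5).+1) ^ 5)); first by rewrite leq_exp2r.
rewrite expnMn leq_mul2l; apply/orP; right.
apply: (@leq_trans ((2 ^ (m %/ 5)) ^ 5)); first by rewrite leq_exp2r // ltn_expl.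
by rewrite -expnM leq_pexp2l // leq_divM.
Qed.

Lemma ex_pow2_ge (x : R) : exists w : nat, x <= 2 ^+ w.
Proof. by exists (Num.bound x); apply/ltW/upper_nthrootP. Qed.

Lemma poly_le_exp2 (C kappa : R) (M : nat) : 0 < kappa -> (0 < M)%N ->
  exists L0 : nat, forall L, (L0 <= L)%N ->
    C * L%:R ^+ 4 <= kappa * 2 ^+ (L %/ M).
Proof.
move=> k0 M0; pose C' := `|C| * M%:R ^+ 4 * 5 ^+ 5 / kappa.
have C'0 : 0 <= C' by rewrite divr_ge0 ?mulr_ge0 ?exprn_ge0 // ltW.
exists (Num.bound C' * M)%N => L LL.
set m := (L %/ M)%N.
have mC : C' <= m.+1%:R.
  apply: le_trans (ltW (archi_boundP C'0)) _; rewrite ler_nat.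
  by apply: leqW; rewrite leq_divRL.
have LM : L%:R <= m.+1%:R * M%:R :> R.
  by rewrite -natrM ler_nat ltnW // ltn_ceil.
apply: (@le_trans _ _ (`|C| * (m.+1%:R * M%:R) ^+ 4)).
  apply: (@le_trans _ _ (`|C| * L%:R ^+ 4)).
    by apply: ler_wpM2r; rewrite ?exprn_ge0 ?ler_norm.
  by apply: ler_wpM2l => //; rewrite lerXn2r ?nnegrE ?mulr_ge0.
have m5 : m.+1%:R ^+ 5 <= 5 ^+ 5 * 2 ^+ m :> R.
  by rewrite -!natrX -natrM ler_nat; exact: expn2_ge_pow5.
have -> : `|C| * (m.+1%:R * M%:R) ^+ 4 = C' * m.+1%:R ^+ 4 * (kappa / 5 ^+ 5).
  have u0 : 5 ^+ 5 != 0 :> R by rewrite expf_neq0 // pnatr_eq0.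
  have kn : kappa != 0 by rewrite gt_eqF.
  by rewrite /C' exprMn; move: u0; set u := 5 ^+ 5 => u0; field; rewrite ?u0 ?kn.
have -> : kappa * 2 ^+ m = 5 ^+ 5 * 2 ^+ m * (kappa / 5 ^+ 5).
  by rewrite mulrC [RHS]mulrAC mulrCA mulfV ?mulr1 1?mulrC // expf_neq0 // pnatr_eq0.
apply: ler_wpM2r; first by rewrite divr_ge0 // ltW.
apply: le_trans m5; rewrite exprS; apply: ler_wpM2r => //; exact: exprn_ge0.
Qed.

(** Specializes the previous bound to N = 2^i, U = 2^(i/4) and y = 2^t, where the size
    conditions become linear inequalities between exponents; the prime powers are
    removed with [sum_mangoldt_nonprime] for s = 2^(i-t). *)
Lemma prime_wave_bound (j0 J K : nat) (c : nat -> R) : (0 < j0)%N -> c 0%N != 0 ->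
  exists w : nat, forall n L i t N', trunc_log 2 n = L -> (0 < n)%N ->
    (4 * (i %/ 4) <= i)%N -> (L.+1 <= i %/ 4 * K)%N ->
    let E := (2 * 2 ^ K * K.+2)%N in
    (w + t * E <= i %/ 4)%N -> (w + t * E + i * j0 <= L)%N -> (2 * t + 2 <= i)%N ->
    (2 ^ i <= N')%N -> (N' <= 2 * 2 ^ i)%N ->
  cmod (\sum_((2 ^ i).+1 <= p < N'.+1 | prime p) toC (ln p%:R) * wave j0 J c n p)
   <= 75 * (2 ^ i)%:R * log4 R (2 ^ i) ^+ 4 / 2 ^+ t.
Proof.
move=> j00 c0; have [A A1 hA] := @inner_sums R j0 J K c j00 c0.
have [w Aw] := ex_pow2_ge (A + 4).
exists w => n L i t N' nL n0 u4 LK E wU wT ti NN' N'N.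
set u := (i %/ 4)%N in u4 LK wU *.
pose N := (2 ^ i)%N; pose y := (2 ^ t)%N; pose U := (2 ^ u)%N.
have A40 : 0 <= A + 4 by rewrite addr_ge0 // (le_trans ler01 A1).
have QE : ((y ^ 2) ^ 2 ^ K)%:R ^+ K.+2 = 2 ^+ (t * E) :> R.
  by rewrite /y -!expnM -natrX -expnM -natrX; congr (_ ^ _)%:R; rewrite /E !mulnA.
have nlow : (2 ^ L <= n)%N by rewrite -nL trunc_logP.
have nup : (n < 2 ^ L.+1)%N by rewrite -nL trunc_log_ltn.
(* A + 4 rather than A ensures U >= 4 z, used to bound the number of close pairs. *)
have adm4 : admissible j0 K (A + 4) n N U (y ^ 2).
  split; first by rewrite !expn_gt0.
  - by rewrite /U /N -expnM leq_pexp2l // mulnC.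
  - by apply: ltnW; apply: leq_trans nup _; rewrite /U -expnM leq_pexp2l.
  - rewrite QE; apply: (@le_trans _ _ (2 ^+ w * 2 ^+ (t * E))).
      by apply: ler_wpM2r; rewrite ?exprn_ge0.
    by rewrite -exprD /U natrX ler_weXn2l // ler1n.
  - rewrite QE; apply: (@le_trans _ _ (2 ^+ w * 2 ^+ (t * E) * N%:R ^+ j0)).
      by rewrite !ler_wpM2r ?exprn_ge0.
    rewrite /N natrX -exprM -!exprD; apply: (@le_trans _ _ (2 ^+ L)).
      by rewrite ler_weXn2l // ler1n.
    by rewrite -natrX ler_nat.
have adm1 : admissible j0 K A n N U (y ^ 2).
  case: adm4 => h1 h2 h3 h4 h5; split => //.
    by apply: le_trans h4; rewrite ler_wpM2r ?exprn_ge0 // lerDl.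
  apply: le_trans h5; apply: ler_wpM2r; first exact: exprn_ge0.
  by apply: ler_wpM2r; [exact: exprn_ge0|rewrite lerDl].
have A4 : 4 <= A + 4 by rewrite lerDr (le_trans ler01 A1).
have [hI hII] := hA _ _ _ _ adm1.
have main := mangoldt_wave_bound j00 c0 A4 adm4 N'N hI hII.
have N0 : (0 < N)%N by rewrite expn_gt0.
have Lg1 : 1 <= log4 R N by exact: log4_ge1.
have yR : 0 < y%:R :> R by rewrite ltr0n expn_gt0.
have split_sum : \sum_(N.+1 <= m < N'.+1) toC (mangoldt R m) * wave j0 J c n m
  = \sum_(N.+1 <= p < N'.+1 | prime p) toC (ln p%:R) * wave j0 J c n p
   + \sum_(N.+1 <= m < N'.+1 | ~~ prime m) toC (mangoldt R m) * wave j0 J c n m.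
  rewrite (bigID prime) /=; congr (_ + _).
  by apply: eq_bigr => p pp; rewrite mangoldt_prime.
have -> : \sum_(N.+1 <= p < N'.+1 | prime p) toC (ln p%:R) * wave j0 J c n p
  = \sum_(N.+1 <= m < N'.+1) toC (mangoldt R m) * wave j0 J c n m
   - \sum_(N.+1 <= m < N'.+1 | ~~ prime m) toC (mangoldt R m) * wave j0 J c n m.
  by rewrite split_sum addrK.
apply: le_trans (cmodB _ _) _.
have pp : cmod (\sum_(N.+1 <= m < N'.+1 | ~~ prime m) toC (mangoldt R m) * wave j0 J c n m)
   <= N%:R * log4 R N ^+ 4 / y%:R.
  apply: le_trans (cmod_sum _ _ _) _.
  pose s := (2 ^ (i - t))%N.
  have ti' : (t <= i)%N by clear -ti; lia.
  have Xs : (N'.+1 <= s * s)%N.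
    rewrite /s -expnD; apply: (@leq_trans (2 ^ (i + 2))%N).
      rewrite addn2 !expnS; apply: leq_ltn_trans N'N _.
      by rewrite mulnA ltn_pmul2r ?expn_gt0.
    by rewrite leq_pexp2l //; clear -ti; lia.
  apply: (@le_trans _ _ (\sum_(1 <= m < N'.+1 | ~~ prime m) mangoldt R m)).
    rewrite [leRHS](big_cat_nat (n := N.+1)) // -[leLHS]add0r; apply: lerD.
      by apply: sumr_ge0 => m _; exact: mangoldt_ge0.
    apply: ler_sum => m _; rewrite cmodM cmod_toC ger0_norm ?mangoldt_ge0 //.
    by rewrite /wave norm_e mulr1.
  apply: le_trans (sum_mangoldt_nonprime R Xs) _.
  have sE : s%:R = N%:R / y%:R :> R.
    have -> : N = (s * y)%N by rewrite /s /y /N -expnD subnK //; lia.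
    by rewrite natrM mulfK // gt_eqF.
  rewrite sE mulrAC; apply: ler_wpM2r; first by rewrite invr_ge0.
  apply: ler_wpM2l => //.
  have h : 1 + ln N'.+1%:R <= log4 R N.
    apply: ln_le_log4 => //; have := N'N; rewrite -/N; move: N0; nlia.
  apply: (@le_trans _ _ (log4 R N)); first by lra.
  by rewrite exprS ler_peMr ?exprn_ege1 // (le_trans ler01).
apply: le_trans (lerD main pp) _.
rewrite -/N -natrX -/y le_eqVlt; apply/orP; left; apply/eqP.
by field; rewrite gt_eqF.
Qed.

(** With L the binary logarithm of n, the conditions on i say that 2^i and n/2^(i j0) are
    at least n^(1/D), up to constants.  A number K = 8 D of steps is
    then enough, and t = L/(8 D E) is admissible for a constant E; the saving
    2^t is a power of n and beats the fourth power of the logarithm. *)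
Lemma prime_wave_small (j0 J D : nat) (c : nat -> R) (kappa : R) :
  (0 < j0)%N -> (0 < D)%N -> c 0%N != 0 -> 0 < kappa ->
  exists L0 : nat, forall n i N', (L0 <= trunc_log 2 n)%N ->
    (trunc_log 2 n <= D * i)%N -> (D * (i * j0) + trunc_log 2 n <= D * trunc_log 2 n)%N ->
    (2 ^ i <= N')%N -> (N' <= 2 * 2 ^ i)%N ->
  cmod (\sum_((2 ^ i).+1 <= p < N'.+1 | prime p) toC (ln p%:R) * wave j0 J c n p)
   <= kappa * (2 ^ i)%:R.
Proof.
move=> j00 D0 c0 k0.
pose K := (8 * D)%N; pose E := (2 * 2 ^ K * K.+2)%N.
have E0 : (0 < E)%N by rewrite !muln_gt0 expn_gt0.
have M0 : (0 < 8 * D * E)%N by rewrite muln_gt0 E0 andbT muln_gt0.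
have [w hw] := @prime_wave_bound j0 J K c j00 c0.
have [L1 hL1] := poly_le_exp2 (75 * 256) k0 M0.
exists (maxn L1 (D * (8 * w + 20)))%N => n i N'.
set L := trunc_log 2 n; rewrite geq_max => /andP[LL1 LD] Li iL Ni N'i.
pose t := (L %/ (8 * D * E))%N.
have tE : (8 * D * (t * E) <= L)%N.
  by have := leq_divM L (8 * D * E); rewrite -/t mulnCA mulnA.
have Lw : (w < L)%N.
  apply: leq_trans LD; apply: leq_trans (leq_pmull _ D0); clear; lia.
have i8 : (8 * w + 20 <= i)%N by rewrite -(leq_pmul2l D0); exact: leq_trans LD Li.
have ti : (8 * (t * E) <= i)%N.
  by rewrite -(leq_pmul2l D0); apply: leq_trans Li; rewrite mulnCA mulnA.
have u1 := divn_eq i 4; have u2 : (i %% 4 < 4)%N by rewrite ltn_mod.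
have tE' : (t <= t * E)%N by rewrite leq_pmulr.
have n0 : (0 < n)%N by case: (n) @L Lw {LL1 LD Li iL t tE ti tE'} => // ; rewrite trunc_log0.
have iL' : (i <= L)%N.
  have h : (D * (i * j0) <= D * L)%N by apply: leq_trans iL; rewrite leq_addr.
  by apply: (@leq_trans (i * j0)%N); [rewrite leq_pmulr|rewrite -(leq_pmul2l D0)].
apply: le_trans (hw n L i t N' erefl n0 _ _ _ _ _ Ni N'i) _.
- by rewrite mulnC leq_divM.
- have D20 : (D * 20 <= L)%N by apply: leq_trans LD; rewrite leq_mul2l leq_addl orbT.
  have h1 : (L + 6 * D < 2 * L)%N by clear -D20 D0; lia.
  have h2 : (2 * (D * i) <= i %/ 4 * K + 6 * D)%N.
    rewrite /K; have i43 : (i <= 4 * (i %/ 4) + 3)%N by clear -u1 u2; lia.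
    have := leq_mul (leqnn D) i43; move: (i %/ 4)%N => u; clear; lia.
  by clear -h1 h2 Li; lia.
- by rewrite -/E; move: ti i8 u1 u2; move: (t * E)%N (i %/ 4)%N => x u; clear; lia.
- rewrite -/E -(leq_pmul2l D0) !mulnDr.
  have h1 : (D * w + D * (t * E) <= L)%N.
    by move: LD tE; move: (t * E)%N => x; clear; lia.
  by move: h1 iL; move: (t * E)%N => x; clear; lia.
- by move: tE' ti i8; move: (t * E)%N => x; clear; lia.
have Lg : log4 R (2 ^ i) <= 4 * L%:R.
  rewrite /log4 (_ : 4 * (2 ^ i)%:R = 2 ^+ (i + 2) :> R); last first.
    by rewrite exprD natrX expr2 mulrC -natrM.
  rewrite lnXn // -[ln 2 *+ _]mulr_natl.
  have l2 := ln2_le1 R.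
  have : (i + 2)%:R * ln 2 <= (i + 2)%:R :> R by rewrite ler_piMr.
  have : (i + 2)%:R + 1 <= 4 * L%:R :> R by rewrite -natrM natr1 ler_nat; clear -iL' Lw; lia.
  lra.
have Lg0 : 0 <= log4 R (2 ^ i) by rewrite (le_trans ler01) ?log4_ge1 ?expn_gt0.
have tp : 0 < 2 ^+ t :> R by rewrite exprn_gt0.
rewrite ler_pdivrMr //; move: (log4 R (2 ^ i)) Lg Lg0 => l Lg Lg0.
have -> : 75 * (2 ^ i)%:R * l ^+ 4 = (2 ^ i)%:R * (75 * l ^+ 4) by ring.
have -> : kappa * (2 ^ i)%:R * 2 ^+ t = (2 ^ i)%:R * (kappa * 2 ^+ t) by ring.
apply: ler_wpM2l => //.
apply: le_trans (hL1 L LL1); rewrite -/t.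
apply: (@le_trans _ _ (75 * (4 * L%:R) ^+ 4)).
  by apply: ler_wpM2l => //; rewrite lerXn2r ?nnegrE ?mulr_ge0.
by rewrite exprMn mulrA; apply: ler_wpM2r; rewrite ?exprn_ge0 // -natrX -natrM.
Qed.
End PrimeWaveSmall.

(** * Trigonometric approximation of characters of the floor *)
Section Fejer.
Variable R : realType.

(** Trigonometric polynomials without constant term, with arbitrary real frequencies. *)
Definition trig_poly0 (F : R -> R[i]) : Prop :=
  exists2 s : seq (R[i] * R), all (fun x => x.2 != 0) s &
    forall u, F u = \sum_(x <- s) x.1 * e (x.2 * u).

Lemma trig_poly0_zero : trig_poly0 (fun=> 0).
Proof. by exists [::] => // u; rewrite big_nil. Qed.

Lemma trig_poly0_term (a : R[i]) (al : R) : al != 0 -> trig_poly0 (fun u => a * e (al * u)).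
Proof. by move=> al0; exists [:: (a, al)]; rewrite /= ?al0 // => u; rewrite big_seq1. Qed.

Lemma trig_poly0_sum (r : seq nat) (F : nat -> R -> R[i]) :
  (forall d, trig_poly0 (F d)) -> trig_poly0 (fun u => \sum_(d <- r) F d u).
Proof.
move=> hF; elim: r => [|d r [s hs sE]].
  by exists [::] => // u; rewrite !big_nil.
have [t ht tE] := hF d; exists (t ++ s); first by rewrite all_cat ht.
by move=> u; rewrite big_cons big_cat /= tE sE.
Qed.

Lemma trig_poly0_ext F G : (forall u, F u = G u) -> trig_poly0 F -> trig_poly0 G.
Proof. by move=> FG [s hs sE]; exists s => // u; rewrite -FG sE. Qed.

(** The geometric sum whose squared modulus is D times the Fejer kernel. *)
Definition geom (D : nat) (x : R) : R[i] := \sum_(0 <= d < D) e (d%:R * x).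

Lemma geom_square D x : toC (cmod (geom D x) ^+ 2) =
  \sum_(0 <= d < D) \sum_(0 <= d' < D) e ((d%:R - d'%:R) * x).
Proof.
rewrite -mul_cj /geom cj_sum big_distrl /=; apply: eq_bigr => d _.
by rewrite big_distrr /=; apply: eq_bigr => d' _; rewrite -eB mulrBl.
Qed.

Lemma geom_mul D x : (1 - e x) * geom D x = 1 - e (D%:R * x).
Proof.
elim: D => [|D IH]; first by rewrite /geom big_geq // mulr0 mul0r e0 subrr.
have -> : e (D.+1%:R * x) = e (D%:R * x) * e x by rewrite -natr1 mulrDl mul1r eD.
rewrite /geom big_nat_recr // mulrDr -/(geom D x) IH; ring.
Qed.

Lemma geom_le D x : 0 < cmod (1 - e x) -> cmod (geom D x) <= 2 / cmod (1 - e x).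
Proof.
move=> h; rewrite ler_pdivlMr // mulrC -cmodM geom_mul.
apply: le_trans (cmodB _ _) _.
by rewrite cmod1 norm_e.
Qed.

(** The chord bound applies to x = m/D when x <= 1/2, and to 1 - x otherwise. *)
Lemma e_frac_neq1 (m D : nat) : (0 < m)%N -> (m < D)%N -> e (m%:R / D%:R) != 1 :> R[i].
Proof.
move=> m0 mD; apply/eqP => h.
have DR : 0 < D%:R :> R by rewrite ltr0n; exact: leq_trans mD.
have mR : 0 < m%:R :> R by rewrite ltr0n.
have x0 : 0 < m%:R / D%:R :> R by rewrite divr_gt0.
have x1 : m%:R / D%:R < 1 :> R by rewrite ltr_pdivrMr // mul1r ltr_nat.
have [le|gt] := leP (m%:R / D%:R) (2^-1 : R).
  by have := norm_1_e_ge (ltW x0) le; rewrite h subrr cmod0; lra.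
have y0 : 0 <= 1 - m%:R / D%:R :> R by lra.
have y2 : 1 - m%:R / D%:R <= 2^-1 :> R by lra.
have := norm_1_e_ge y0 y2.
have -> : e (1 - m%:R / D%:R) = 1 :> R[i].
  by rewrite eB h [cj 1]conjc1 mulr1; exact: (e_nat R 1).
by rewrite subrr cmod0; lra.
Qed.

Lemma sum_roots (m D : nat) : (m < D)%N ->
  \sum_(0 <= i < D) e (i%:R * (m%:R / D%:R)) = if m == 0%N then D%:R else 0 :> R[i].
Proof.
move=> mD; case: eqP => [->|/eqP m0].
  under eq_bigr => i _ do rewrite mul0r mulr0 e0.
  by rewrite sumr_const_nat subn0.
have D0 : D%:R != 0 :> R by rewrite pnatr_eq0; case: (D) mD.
have := geom_mul D (m%:R / D%:R); rewrite mulrCA mulfV // mulr1 e_nat subrr.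
move/eqP; rewrite mulf_eq0 subr_eq0 eq_sym (negbTE (e_frac_neq1 _ mD)) ?lt0n //=.
by move/eqP.
Qed.

Lemma sum_roots_diff (d d' D : nat) : (d < D)%N -> (d' < D)%N ->
  \sum_(0 <= i < D) e ((d%:R - d'%:R) * - (i%:R / D%:R)) = if d == d' then D%:R else 0 :> R[i].
Proof.
have pos a b : (a < D)%N -> (b <= a)%N ->
    \sum_(0 <= i < D) e ((a%:R - b%:R) * (i%:R / D%:R)) = if a == b then D%:R else 0 :> R[i].
  move=> aD ba; rewrite -natrB //.
  rewrite (eq_bigr (fun i => e (i%:R * ((a - b)%:R / D%:R)))); last first.
    by move=> i _; congr e; ring.
  rewrite sum_roots ?subn_eq0; last by apply: leq_ltn_trans aD; exact: leq_subr.
  by rewrite eqn_leq ba andbT.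
move=> dD d'D; have [le|gt] := leqP d d'.
  rewrite (eq_bigr (fun i => e ((d'%:R - d%:R) * (i%:R / D%:R)))); last first.
    by move=> i _; congr e; ring.
  by rewrite pos // eq_sym.
rewrite (eq_bigr (fun i => cj (e ((d%:R - d'%:R) * (i%:R / D%:R))))); last first.
  by move=> i _; rewrite cj_e; congr e; ring.
rewrite -cj_sum pos //; last exact: ltnW.
by case: ifP => _; rewrite ?[cj _]conjc_nat // [cj _]conjc0.
Qed.

Variables (Q h0 : nat).
Hypotheses (h00 : (0 < h0)%N) (h0Q : (h0 < Q)%N).
(* A nontrivial Q-th root of unity, not necessarily primitive. *)
Let om : R[i] := e (h0%:R / Q%:R).
Let Q0 : (0 < Q)%N. Proof. exact: leq_trans h0Q. Qed.
Let QR : 0 < Q%:R :> R. Proof. by rewrite ltr0n. Qed.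

Lemma omE a : om ^+ a = e (a%:R * (h0%:R / Q%:R)).
Proof. by rewrite /om eX. Qed.

Lemma norm_om a : cmod (om ^+ a) = 1.
Proof. by rewrite omE norm_e. Qed.

Lemma omQ : om ^+ Q = 1.
Proof. by rewrite omE mulrCA mulfV ?gt_eqF // mulr1 e_nat. Qed.

Lemma om_mod a : om ^+ a = om ^+ (a %% Q).
Proof. by rewrite {1}(divn_eq a Q) exprD mulnC exprM omQ expr1n mul1r. Qed.

Lemma sum_om : \sum_(0 <= r < Q) om ^+ r = 0.
Proof.
by under eq_bigr => r _ do rewrite omE; rewrite sum_roots // gtn_eqF.
Qed.

Section Kernel.
Variable K : nat.
Hypothesis K0 : (0 < K)%N.
Let D := (K * Q)%N.
Let D0 : (0 < D)%N. Proof. by rewrite muln_gt0 K0. Qed.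
Let DR : 0 < D%:R :> R. Proof. by rewrite ltr0n. Qed.
Let KR : 0 < K%:R :> R. Proof. by rewrite ltr0n. Qed.

(** A Fejer kernel of period Q, scaled so that its values at the D = K * Q points
    u - i/K add up to 1 ([fejer_sum]).  Sampling at finitely many points replaces the
    convolution integral by a finite sum. *)
Definition fejer (x : R) : R := cmod (geom D (x / Q%:R)) ^+ 2 / D%:R ^+ 2.

Lemma fejer_ge0 x : 0 <= fejer x.
Proof. by rewrite divr_ge0 ?sqr_ge0. Qed.

Lemma sum_om_div : \sum_(0 <= i < D) om ^+ (i %/ K) = 0.
Proof.
have H n : \sum_(0 <= i < K * n) om ^+ (i %/ K) = K%:R * \sum_(0 <= r < n) om ^+ r.
  elim: n => [|n IH]; first by rewrite muln0 !big_geq // mulr0.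
  rewrite [in RHS]big_nat_recr // mulnS addnC.
  rewrite [LHS](big_cat_nat (n := (K * n)%N)) ?leq_addr // IH mulrDr; congr (_ + _).
  rewrite (eq_big_nat _ _ (F2 := fun=> om ^+ n)).
    by rewrite sumr_const_nat addnC addnK mulr_natl.
  move=> i /andP[i1 i2]; congr (_ ^+ _); apply/eqP; rewrite eqn_leq -ltnS.
  by rewrite ltn_divLR // leq_divRL // [(n * K)%N]mulnC i1 andbT mulSn mulnC addnC.
by rewrite /D H sum_om mulr0.
Qed.

(** The discrete convolution of u |-> om^floor(u), sampled at the points i/K, with
    the Fejer kernel. *)
Definition smoothed (u : R) : R[i] :=
  \sum_(0 <= i < D) om ^+ (i %/ K) * toC (fejer (u - i%:R / K%:R)).

Lemma fejerE u i : toC (fejer (u - i%:R / K%:R)) = toC (D%:R ^- 2) *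
   \sum_(0 <= d < D) \sum_(0 <= d' < D)
     e ((d%:R - d'%:R) / Q%:R * u) * e ((d%:R - d'%:R) * - (i%:R / D%:R)).
Proof.
rewrite /fejer mulrC toCM geom_square; congr (_ * _).
apply: eq_bigr => d _; apply: eq_bigr => d' _; rewrite -eD; congr e.
by rewrite /D natrM; field; rewrite !gt_eqF.
Qed.

Lemma fejer_sum u : \sum_(0 <= i < D) fejer (u - i%:R / K%:R) = 1.
Proof.
have toC_inj (x y : R) : toC x = toC y -> x = y by move=> [].
apply: toC_inj; rewrite toC_sum toC1.
under eq_bigr => i _ do rewrite fejerE.
rewrite -mulr_sumr exchange_big_nat /=.
rewrite (eq_big_nat _ _ (F2 := fun=> D%:R)); last first.
  move=> d /andP[_ dD]; rewrite exchange_big_nat /=.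
  rewrite (eq_big_nat _ _ (F2 := fun d' => if d' == d then D%:R else 0)); last first.
    move=> d' /andP[_ d'D]; rewrite -mulr_sumr sum_roots_diff // eq_sym.
    by case: eqP => [->|]; rewrite ?mulr0 // subrr !mul0r e0 mul1r.
  by rewrite -big_mkcond /= big_nat1_eq dD.
rewrite sumr_const_nat subn0.
have -> : D%:R *+ D = toC (D%:R ^+ 2) :> R[i].
  by rewrite expr2 toCM toC_nat mulr_natl.
by rewrite -toCM mulVf ?toC1 // expf_neq0 // gt_eqF.
Qed.

(** The constant term comes from the pairs d = d' of the kernel, and carries the
    factor [sum_om_div], which vanishes since om is not 1. *)
Lemma smoothed_trig : trig_poly0 smoothed.
Proof.
pose C d d' : R[i] := toC (D%:R ^- 2) *
  \sum_(0 <= i < D) om ^+ (i %/ K) * e ((d%:R - d'%:R) * - (i%:R / D%:R)).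
apply: (@trig_poly0_ext (fun u => \sum_(d <- index_iota 0 D) \sum_(d' <- index_iota 0 D)
    (if d == d' then 0 else C d d' * e ((d%:R - d'%:R) / Q%:R * u)))); last first.
  apply: trig_poly0_sum => d; apply: trig_poly0_sum => d'.
  case: eqP => [_|/eqP dd']; first exact: trig_poly0_zero.
  apply: trig_poly0_term.
  by rewrite mulf_eq0 invr_eq0 (gt_eqF QR) orbF subr_eq0 eqr_nat.
move=> u; rewrite /smoothed.
transitivity (\sum_(0 <= d < D) \sum_(0 <= d' < D) C d d' * e ((d%:R - d'%:R) / Q%:R * u)).
  apply: eq_bigr => d _; apply: eq_bigr => d' _; case: eqP => // ->.
  rewrite /C (eq_bigr (fun i => om ^+ (i %/ K))); last first.
    by move=> i _; rewrite subrr mul0r e0 mulr1.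
  by rewrite sum_om_div mulr0 mul0r.
under [RHS]eq_bigr => i _ do rewrite fejerE mulrCA mulr_sumr.
rewrite -mulr_sumr [in RHS]exchange_big_nat mulr_sumr; apply: eq_bigr => d _ /=.
under [X in _ = _ * X]eq_bigr => i _ do rewrite mulr_sumr.
rewrite [in RHS]exchange_big_nat mulr_sumr; apply: eq_bigr => d' _ /=.
rewrite /C -mulrA; congr (_ * _); rewrite mulr_suml; apply: eq_bigr => i _.
by ring.
Qed.

(** If u = a + f is at distance at least del from the integers, then every sample
    point where the character takes another value is at distance at least del from u
    on the circle of length Q. *)
Lemma cell_far (a i : nat) (f del : R) : 0 < del -> del <= f -> f <= 1 - del ->
  om ^+ a != om ^+ (i %/ K) ->
  2 * del / Q%:R <= cmod (1 - e ((a%:R + f - i%:R / K%:R) / Q%:R)).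
Proof.
move=> d0 df f1 neq.
pose b := (i %/ K)%N; pose g : R := (i %% K)%:R / K%:R.
have g0 : 0 <= g by rewrite divr_ge0.
have g1 : g < 1 by rewrite ltr_pdivrMr // mul1r ltr_nat ltn_mod.
have iE : i%:R / K%:R = b%:R + g.
  by rewrite {1}(divn_eq i K) natrD natrM /g /b; field; rewrite gt_eqF.
(* The difference a - b modulo Q, which is not 0 because om^a and om^b differ. *)
pose m := ((a + Q - b %% Q) %% Q)%N.
have bQ : (b %% Q < Q)%N by rewrite ltn_mod.
have m0 : (0 < m)%N.
  rewrite lt0n; apply: contraNneq neq => mm.
  have := divn_eq (a + Q - b %% Q) Q; rewrite -/m mm addn0 => h.
  apply/eqP; rewrite om_mod [RHS]om_mod; congr (_ ^+ _).
  have h' : (a + Q = ((a + Q - b %% Q) %/ Q) * Q + b %% Q)%N by rewrite -h subnK // ltnW // ltn_addl.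
  by rewrite -(modnDr a Q) h' modnMDl modn_mod.
have mQ : (m < Q)%N by rewrite ltn_mod.
pose y : R := (m%:R + f - g) / Q%:R.
have eE : e ((a%:R + f - i%:R / K%:R) / Q%:R) = e y :> R[i].
  have hk := divn_eq (a + Q - b %% Q) Q; rewrite -/m in hk.
  have hb := divn_eq b Q.
  have hsum : (a + Q = (a + Q - b %% Q) %/ Q * Q + m + b %% Q)%N.
    by rewrite -hk subnK // ltnW // ltn_addl.
  set k := ((a + Q - b %% Q) %/ Q)%N in hsum; set l := (b %/ Q)%N in hb.
  have -> : (a%:R + f - i%:R / K%:R) / Q%:R = y + (k%:Z - 1 - l%:Z)%:~R.
    have hR : a%:R + Q%:R = k%:R * Q%:R + m%:R + (b %% Q)%:R :> R.
      by rewrite -!natrM -!natrD hsum.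
    have hbR : b%:R = l%:R * Q%:R + (b %% Q)%:R :> R by rewrite -natrM -natrD -hb.
    have aE : a%:R = k%:R * Q%:R + m%:R + (b %% Q)%:R - Q%:R :> R by rewrite -hR addrK.
    rewrite iE aE hbR /y !intrD !mulrNz -!pmulrn.
    by field; rewrite gt_eqF.
  by rewrite eDint.
rewrite eE.
have m1R : 1 <= m%:R :> R by rewrite ler1n.
have mQR : m%:R + 1 <= Q%:R :> R by rewrite natr1 ler_nat.
have y1 : del / Q%:R <= y by rewrite /y ler_pM2r ?invr_gt0 //; lra.
have y2 : y <= 1 - del / Q%:R.
  have -> : 1 - del / Q%:R = (Q%:R - del) / Q%:R by field; rewrite gt_eqF.
  by rewrite /y ler_pM2r ?invr_gt0 //; lra.
have dQ0 : 0 < del / Q%:R by rewrite divr_gt0.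
rewrite -mulrA; move: y1 y2 dQ0; set z := del / Q%:R => y1 y2 z0.
have [yh|yh] := leP y 2^-1.
  by apply: le_trans (norm_1_e_ge _ yh); lra.
have y10 : 0 <= 1 - y by lra.
have y12 : 1 - y <= 2^-1 by lra.
have := norm_1_e_ge y10 y12.
have -> : cmod (1 - e (1 - y)) = cmod (1 - e y).
  rewrite eB (e_nat R 1) mul1r -[in RHS]cmod_cj; congr cmod.
  by rewrite /cj rmorphB rmorph1.
by apply: le_trans; lra.
Qed.

(** The kernel has mass 1, so the error is the mass of the samples where the
    character differs from om^a; by [cell_far] the kernel is O((Q/(del D))^2) there. *)
Lemma smoothed_close (a : nat) (f del : R) : 0 < del -> del <= f -> f <= 1 - del ->
  cmod (om ^+ a - smoothed (a%:R + f)) <= 2 * Q%:R / (K%:R * del ^+ 2).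
Proof.
move=> d0 df f1.
have -> : om ^+ a - smoothed (a%:R + f) =
   \sum_(0 <= i < D) (om ^+ a - om ^+ (i %/ K)) * toC (fejer (a%:R + f - i%:R / K%:R)).
  rewrite /smoothed; under [RHS]eq_bigr => i _ do rewrite mulrBl.
  by rewrite sumrB -mulr_sumr -toC_sum fejer_sum toC1 mulr1.
apply: le_trans (cmod_sum _ _ _) _.
apply: (@le_trans _ _ (\sum_(0 <= i < D) 2 * (Q%:R ^+ 2 / (D%:R ^+ 2 * del ^+ 2)))); last first.
  rewrite sumr_const_nat subn0 -[leLHS]mulr_natl.
  rewrite le_eqVlt; apply/orP; left; apply/eqP.
  by rewrite /D natrM; field; rewrite !gt_eqF.
apply: ler_sum => i _; rewrite cmodM cmod_toC (ger0_norm (fejer_ge0 _)).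
have B0 : 0 <= 2 * (Q%:R ^+ 2 / (D%:R ^+ 2 * del ^+ 2)).
  apply: mulr_ge0 => //; apply: divr_ge0; first exact: sqr_ge0.
  by apply: mulr_ge0; exact: sqr_ge0.
have [->|neq] := eqVneq (om ^+ a) (om ^+ (i %/ K)); first by rewrite subrr cmod0 mul0r.
apply: ler_pM; rewrite ?cmod_ge0 ?fejer_ge0 //.
  by apply: le_trans (cmodB _ _) _; rewrite !norm_om.
have far := cell_far d0 df f1 neq.
have p0 : 0 < 2 * del / Q%:R by rewrite divr_gt0 ?mulr_gt0.
have cp : 0 < cmod (1 - e ((a%:R + f - i%:R / K%:R) / Q%:R)) by exact: lt_le_trans far.
have g := geom_le D cp.
have g' : cmod (geom D ((a%:R + f - i%:R / K%:R) / Q%:R)) <= Q%:R / del.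
  apply: le_trans g _; rewrite ler_pdivrMr //.
  apply: (@le_trans _ _ (Q%:R / del * (2 * del / Q%:R))).
    by rewrite le_eqVlt; apply/orP; left; apply/eqP; field; rewrite !gt_eqF.
  by apply: ler_wpM2l => //; rewrite divr_ge0 // ltW.
rewrite /fejer.
have -> : Q%:R ^+ 2 / (D%:R ^+ 2 * del ^+ 2) = (Q%:R / del) ^+ 2 / D%:R ^+ 2.
  by field; rewrite !gt_eqF.
apply: ler_wpM2r; first by rewrite invr_ge0 sqr_ge0.
by rewrite lerXn2r ?nnegrE ?cmod_ge0 ?divr_ge0 // ltW.
Qed.

Lemma smoothed_bound (u : R) : cmod (smoothed u) <= 1.
Proof.
apply: le_trans (cmod_sum _ _ _) _; rewrite -[leRHS](fejer_sum u).
apply: ler_sum => i _; rewrite cmodM cmod_toC norm_om mul1r.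
by rewrite ger0_norm ?fejer_ge0.
Qed.
End Kernel.

(** For d < E and |f| <= 1/(16 E), each term e(d (a + f)) = e(d f) is within 1/2 of 1,
    as e is 8-Lipschitz. *)
Lemma near_int_majorant (E a : nat) (f : R) : (0 < E)%N ->
  `|f| <= (16 * E%:R)^-1 -> E%:R ^+ 2 / 4 <= cmod (geom E (a%:R + f)) ^+ 2.
Proof.
move=> E0 fE; have ER : 0 < E%:R :> R by rewrite ltr0n.
have h : cmod (geom E (a%:R + f) - toC E%:R) <= E%:R / 2.
  have -> : geom E (a%:R + f) - toC E%:R = \sum_(0 <= d < E) (e (d%:R * f) - e 0).
    rewrite sumrB sumr_const_nat subn0 e0 toC_nat; congr (_ - _).
    apply: eq_bigr => d _; rewrite mulrDr addrC -natrM.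
    exact: (eDint (d%:R * f) (d * a)%:Z).
  apply: le_trans (cmod_sum _ _ _) _.
  apply: (@le_trans _ _ (\sum_(0 <= d < E) 2^-1)); last first.
    by rewrite sumr_const_nat subn0 -[leLHS]mulr_natl.
  apply: ler_sum_nat => d /andP[_ dE]; apply: le_trans (e_lip _ _) _.
  rewrite subr0 normrM ger0_norm //.
  have : d%:R * `|f| <= E%:R * (16 * E%:R)^-1.
    by apply: ler_pM => //; rewrite ler_nat ltnW.
  have -> : E%:R * (16 * E%:R)^-1 = 16^-1 :> R by field; rewrite gt_eqF.
  lra.
have h2 : E%:R / 2 <= cmod (geom E (a%:R + f)).
  have : cmod (toC E%:R) <= cmod (geom E (a%:R + f)) + cmod (geom E (a%:R + f) - toC E%:R).
    have {1}-> : toC E%:R = geom E (a%:R + f) - (geom E (a%:R + f) - toC E%:R) by ring.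
    exact: cmodB.
  rewrite cmod_toC ger0_norm //; lra.
have -> : E%:R ^+ 2 / 4 = (E%:R / 2) ^+ 2 :> R by field.
by rewrite lerXn2r ?nnegrE ?cmod_ge0 ?divr_ge0.
Qed.

(** F is the smoothed character, which is close to om^floor(u) away from the integers.
    Near the integers the error is at most 2, and this is majorized by
    8 |geom E u|^2/E^2, a trigonometric polynomial with constant term 8/E; removing
    this constant term gives G, and E is chosen to make it at most kappa/2. *)
Lemma floor_character_approx (kappa : R) : 0 < kappa ->
  exists F G : R -> R[i], [/\ trig_poly0 F, trig_poly0 G &
   forall (a : nat) (f : R), 0 <= f -> f < 1 ->
     cmod (om ^+ a - F (a%:R + f)) <= kappa + complex.Re (G (a%:R + f))].
Proof.
move=> k0.
pose E := (Num.bound (16 / kappa)).+1; have E0 : (0 < E)%N by [].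
have ER : 0 < E%:R :> R by rewrite ltr0n.
have EK : 8 / E%:R <= kappa / 2.
  have h : 16 / kappa <= E%:R.
    apply: le_trans (ltW (archi_boundP _)) _; first by rewrite divr_ge0 // ltW.
    by rewrite ler_nat.
  rewrite ler_pdivrMr // mulrAC ler_pdivlMr //.
  move: h; rewrite ler_pdivrMr // [E%:R * _]mulrC; lra.
clearbody E.
(* The width of the neighbourhoods of the integers where the majorant is at least 2. *)
pose del : R := (16 * E%:R)^-1; have d0 : 0 < del by rewrite invr_gt0 mulr_gt0.
pose x := 4 * Q%:R / (kappa * del ^+ 2).
have x0 : 0 <= x by rewrite divr_ge0 ?mulr_ge0 ?sqr_ge0 // ltW.
pose K := (Num.bound x).+1; have K0 : (0 < K)%N by [].
have KR : 0 < K%:R :> R by rewrite ltr0n.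
have Kk : 2 * Q%:R / (K%:R * del ^+ 2) <= kappa / 2.
  have h : x <= K%:R.
    by apply: le_trans (ltW (archi_boundP x0)) _; rewrite ler_nat.
  have d2 : 0 < del ^+ 2 by rewrite exprn_gt0.
  move: h; rewrite /x ler_pdivrMr ?mulr_gt0 // => h.
  rewrite ler_pdivrMr ?mulr_gt0 //.
  have -> : kappa / 2 * (K%:R * del ^+ 2) = (K%:R * (kappa * del ^+ 2)) / 2 by ring.
  lra.
pose G u := toC (8 / E%:R ^+ 2) * \sum_(d <- index_iota 0 E) \sum_(d' <- index_iota 0 E)
   (if d == d' then 0 else e ((d%:R - d'%:R) * u)) : R[i].
exists (smoothed K), G; split.
- exact: smoothed_trig.
- apply: (@trig_poly0_ext (fun u => \sum_(d <- index_iota 0 E) \sum_(d' <- index_iota 0 E)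
   (if d == d' then 0 else toC (8 / E%:R ^+ 2) * e ((d%:R - d'%:R) * u)))); last first.
    apply: trig_poly0_sum => d; apply: trig_poly0_sum => d'.
    case: eqP => [_|/eqP dd']; first exact: trig_poly0_zero.
    by apply: trig_poly0_term; rewrite subr_eq0 eqr_nat.
  move=> u; rewrite /G mulr_sumr; apply: eq_bigr => d _.
  by rewrite mulr_sumr; apply: eq_bigr => d' _; case: ifP; rewrite ?mulr0.
have GE u : toC (8 / E%:R ^+ 2 * cmod (geom E u) ^+ 2) = toC (8 / E%:R) + G u.
  rewrite toCM geom_square /G.
  have -> : toC (8 / E%:R : R) = toC (8 / E%:R ^+ 2) * (\sum_(0 <= d < E) 1).
    rewrite sumr_const_nat subn0 -toC_nat -toCM.
    by congr toC; field; rewrite gt_eqF.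
  rewrite -mulrDr -big_split; congr (_ * _); apply: eq_big_nat => d /andP[_ dE] /=.
  rewrite (bigD1_seq d) ?iota_uniq ?mem_index_iota //= subrr mul0r e0; congr (_ + _).
  rewrite big_mkcond; apply: eq_bigr => d' _; rewrite eq_sym.
  by case: eqP.
have ReG u : complex.Re (G u) = 8 / E%:R ^+ 2 * cmod (geom E u) ^+ 2 - 8 / E%:R.
  have := congr1 (@complex.Re R) (GE u); rewrite raddfD /= => ->.
  by rewrite addrC addKr.
move=> a f f0 f1.
have sq0 (v : R) : 0 <= 8 / E%:R ^+ 2 * cmod (geom E v) ^+ 2.
  by rewrite mulr_ge0 ?sqr_ge0 // divr_ge0 ?sqr_ge0.
have [inside|out] := boolP ((del <= f) && (f <= 1 - del)).
  have /andP[i1 i2] := inside.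
  apply: le_trans (smoothed_close K0 a d0 i1 i2) _.
  apply: le_trans Kk _; rewrite ReG; have := sq0 (a%:R + f); lra.
have big : 2 <= 8 / E%:R ^+ 2 * cmod (geom E (a%:R + f)) ^+ 2.
  have : E%:R ^+ 2 / 4 <= cmod (geom E (a%:R + f)) ^+ 2.
    move: out; rewrite negb_and -!ltNge => /orP[lt|lt].
      by apply: near_int_majorant => //; rewrite ger0_norm // ltW.
    have -> : a%:R + f = a.+1%:R + (f - 1) by rewrite -natr1; ring.
    apply: near_int_majorant => //; rewrite ler0_norm; rewrite -/del; lra.
  move=> h; have -> : 2 = 8 / E%:R ^+ 2 * (E%:R ^+ 2 / 4) :> R by field; rewrite gt_eqF.
  by apply: ler_wpM2l => //; rewrite divr_ge0 ?sqr_ge0.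
apply: le_trans (cmodB _ _) _; rewrite norm_om.
have := smoothed_bound K0 (a%:R + f); rewrite ReG; lra.
Qed.
End Fejer.

(** * Chebyshev's bound on dyadic intervals *)
Section Chebyshev.
Variable R : realType.

Lemma prime_dvd_fact p m : prime p -> (p %| m`!)%N -> (p <= m)%N.
Proof.
move=> pp; elim: m => [|m IH]; first by rewrite fact0 dvdn1; case: p pp => [|[]].
rewrite factS Euclid_dvdM // => /orP[/dvdn_leq|/IH]; first by apply.
exact: leqW.
Qed.

(** The primes between m and 2 m all divide the binomial coefficient C(2m, m) <= 4^m. *)
Lemma chebyshev_dyadic m :
  \sum_(m.+1 <= p < (2 * m).+1 | prime p) ln p%:R <= 2 * m%:R :> R.
Proof.
pose B := 'C(2 * m, m).
have m2 : (m <= 2 * m)%N by rewrite leq_pmull.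
have B0 : (0 < B)%N by rewrite bin_gt0.
have BE : (B * (m`! * m`!) = (2 * m)`!)%N.
  by rewrite -(bin_fact m2); congr (_ * (_ * _`!))%N; lia.
have Bup : (B <= 2 ^ (2 * m))%N.
  have -> : (2 ^ (2 * m) = \sum_(i < (2 * m).+1) 'C(2 * m, i))%N.
    rewrite -[2%N]/(1 + 1)%N expnDn; apply: eq_bigr => i _.
    by rewrite !exp1n !muln1.
  have h : (m < (2 * m).+1)%N by rewrite ltnS.
  by rewrite (bigD1 (Ordinal h)) //= leq_addr.
apply: (@le_trans _ _ (ln B%:R)); last first.
  apply: (@le_trans _ _ (ln (2 ^+ (2 * m)))).
    by rewrite ler_ln ?posrE ?exprn_gt0 ?ltr0n // -natrX ler_nat.
  have l2 := ln2_le1 R.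
  by rewrite lnXn // -[ln 2 *+ _]mulr_natl natrM ler_piMr.
pose X := maxn B.+1 (2 * m).+1.
have BX : (0 < B < X)%N by rewrite B0 /X leq_maxl.
rewrite (ln_nat_sum R BX).
have mX : ((2 * m).+1 <= X)%N by exact: leq_maxr.
have nn p : 0 <= (logn p B)%:R * ln p%:R :> R by rewrite mulr_ge0 ?ln_nat_ge0.
rewrite [leRHS](big_cat_nat (n := m.+1)) //=; last by apply: leq_trans mX; rewrite ltnS.
rewrite -[leLHS]add0r; apply: lerD; first by apply: sumr_ge0 => p _; exact: nn.
rewrite [leRHS](big_cat_nat (n := (2 * m).+1)) //=.
rewrite -[leLHS]addr0; apply: lerD; last by apply: sumr_ge0 => p _; exact: nn.
rewrite big_nat_cond [leRHS]big_nat_cond; apply: ler_sum => p /andP[/andP[mp pm] pp].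
rewrite ler_peMl ?ln_nat_ge0 // ler1n logn_gt0 mem_primes pp B0 /=.
have : (p %| (2 * m)`!)%N by rewrite dvdn_fact // prime_gt0.
rewrite -BE !Euclid_dvdM // => /orP[//|/orP[] /(prime_dvd_fact pp)]; by rewrite leqNgt mp.
Qed.

End Chebyshev.

(** * Cancellation of products of floor characters over primes *)
Section SmallOnBlocks.
Variables (R : realType) (D Jb : nat).
Hypothesis D0 : (0 < D)%N.
Implicit Types (psi : nat -> nat -> R[i]).

(** The initial part of the dyadic block i that ends at N'.  With L the binary
    logarithm of n, the first two conditions say that 2^i >= n^(1/D) and that
    n/2^(i Jb) >= n^(1/D), up to constants: then every n/p^j with j <= Jb
    is large.  All initial parts are needed for a later summation by parts. *)
Definition in_block (n i N' : nat) : bool :=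
  [&& trunc_log 2 n <= D * i, D * (i * Jb) + trunc_log 2 n <= D * trunc_log 2 n,
      2 ^ i <= N' & N' <= 2 * 2 ^ i]%N.

Definition block_sum psi n i N' : R[i] :=
  \sum_((2 ^ i).+1 <= p < N'.+1 | prime p) toC (ln p%:R) * psi n p.

(** The sums of psi over primes are o(2^i), uniformly over the blocks.  This class is
    closed under linear combinations, contains the waves, and will absorb the floor
    characters one by one. *)
Definition small psi := forall kappa : R, 0 < kappa ->
  exists L0 : nat, forall n i N', (L0 <= trunc_log 2 n)%N -> in_block n i N' ->
    cmod (block_sum psi n i N') <= kappa * (2 ^ i)%:R.

Lemma small_ext psi psi' : (forall n p, prime p -> psi n p = psi' n p) -> small psi -> small psi'.
Proof.
move=> E h k k0; have [L0 hL] := h k k0; exists L0 => n i N' LL bl.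
suff <- : block_sum psi n i N' = block_sum psi' n i N' by exact: hL.
by apply: eq_bigr => p pp; rewrite E.
Qed.

Lemma small0 : small (fun _ _ => 0).
Proof.
move=> k k0; exists 0%N => n i N' _ _; rewrite /block_sum big1 ?cmod0 ?mulr_ge0 ?(ltW k0) //.
by move=> p _; rewrite mulr0.
Qed.

Lemma smallD psi psi' : small psi -> small psi' -> small (fun n p => psi n p + psi' n p).
Proof.
move=> h h' k k0; have k2 : 0 < k / 2 by rewrite divr_gt0.
have [L hL] := h _ k2; have [L' hL'] := h' _ k2.
exists (maxn L L') => n i N'; rewrite geq_max => /andP[l1 l2] bl.
have -> : block_sum (fun n p => psi n p + psi' n p) n i N'
   = block_sum psi n i N' + block_sum psi' n i N'.
  by rewrite /block_sum -big_split; apply: eq_bigr => p _; rewrite mulrDr.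
apply: le_trans (cmodD _ _) _; have := hL n i N' l1 bl; have := hL' n i N' l2 bl.
set x := (2 ^ i)%:R; have -> : k * x = k / 2 * x + k / 2 * x by field.
by move=> *; apply: lerD.
Qed.

Lemma smallZ a psi : small psi -> small (fun n p => a * psi n p).
Proof.
move=> h k k0; have c0 := cmod_ge0 a.
have a0 : 0 < cmod a + 1 by lra.
have [L hL] := h _ (divr_gt0 k0 a0).
exists L => n i N' l1 bl.
have -> : block_sum (fun n p => a * psi n p) n i N' = a * block_sum psi n i N'.
  by rewrite /block_sum mulr_sumr; apply: eq_bigr => p _; rewrite mulrCA.
rewrite cmodM; apply: le_trans (ler_wpM2l c0 (hL n i N' l1 bl)) _.
rewrite mulrA; apply: ler_wpM2r => //.
rewrite mulrCA -[leRHS]mulr1; apply: ler_wpM2l; first exact: ltW.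
by rewrite ler_pdivrMr // mul1r lerDl.
Qed.

Lemma small_sum (T : eqType) (s : seq T) (F : T -> nat -> nat -> R[i]) :
  (forall x, x \in s -> small (F x)) -> small (fun n p => \sum_(x <- s) F x n p).
Proof.
elim: s => [|x s IH] hF.
  by apply: small_ext small0 => n p _; rewrite big_nil.
apply: (@small_ext (fun n p => F x n p + \sum_(y <- s) F y n p)).
  by move=> n p _; rewrite big_cons.
apply: smallD; first by apply: hF; rewrite inE eqxx.
by apply: IH => y ys; apply: hF; rewrite inE ys orbT.
Qed.

Lemma small_wave j0 J (c : nat -> R) : (0 < j0)%N -> (j0 <= Jb)%N -> c 0%N != 0 ->
  small (wave j0 J c).
Proof.
move=> j00 jJ c0 k k0; have [L0 hL] := @prime_wave_small R j0 J D c k j00 D0 c0 k0.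
exists L0 => n i N' l1 /and4P[b1 b2 b3 b4]; apply: hL => //.
by apply: leq_trans b2; rewrite leq_add2r !leq_mul2l jJ !orbT.
Qed.

Lemma block_mass n i N' : in_block n i N' ->
  \sum_((2 ^ i).+1 <= p < N'.+1 | prime p) ln p%:R <= 2 * (2 ^ i)%:R :> R.
Proof.
move=> /and4P[_ _ b3 b4]; apply: le_trans (chebyshev_dyadic R (2 ^ i)).
rewrite [leRHS](big_cat_nat (n := N'.+1)) //= lerDl.
by apply: sumr_ge0 => p _; exact: ln_nat_ge0.
Qed.

Lemma Re_toCM (x : R) z : complex.Re (toC x * z) = x * complex.Re z.
Proof. by case: z => u v; rewrite /= mul0r subr0. Qed.

Lemma Re_sum (I : Type) (r : seq I) (P : pred I) (F : I -> R[i]) :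
  complex.Re (\sum_(i <- r | P i) F i) = \sum_(i <- r | P i) complex.Re (F i).
Proof. exact: raddf_sum. Qed.

Variables (Q h0 : nat).
Hypotheses (h00 : (0 < h0)%N) (h0Q : (h0 < Q)%N).
Let om : R[i] := e (h0%:R / Q%:R).

(** Approximate om^floor(u), for u = n/p^j, by a trigonometric polynomial F(u) without
    constant term.  The product g F is covered by the hypothesis, and the error is at
    most kappa + Re G(u), where G(u) is itself a combination of waves. *)
Lemma small_mul_floor (g : nat -> nat -> R[i]) j :
  (forall n p, cmod (g n p) <= 1) -> (0 < j)%N -> (j <= Jb)%N ->
  (forall al, al != 0 -> small (fun n p => g n p * e (al * (n%:R / (p ^ j)%:R)))) ->
  small (fun n p => g n p * om ^+ (n %/ p ^ j)).
Proof.
move=> g1 j0 jJ hg k k0.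
have k8 : 0 < k / 8 by rewrite divr_gt0.
have k4 : 0 < k / 4 by rewrite divr_gt0.
have [F [G [[s hs sE] [t ht tE] FG]]] := floor_character_approx h00 h0Q k8.
pose u (n p : nat) : R := n%:R / (p ^ j)%:R.
have sF : small (fun n p => g n p * F (u n p)).
  apply: (@small_ext (fun n p => \sum_(x <- s) x.1 * (g n p * e (x.2 * u n p)))).
    move=> n p _; rewrite sE mulr_sumr; apply: eq_bigr => x _; by rewrite mulrCA.
  apply: small_sum => x xs; apply: smallZ; apply: hg.
  exact: (allP hs).
have sG : small (fun n p => G (u n p)).
  apply: (@small_ext (fun n p => \sum_(x <- t) x.1 * wave j 0 (fun=> x.2) n p)).
    move=> n p _; rewrite tE; apply: eq_bigr => x _; congr (_ * e _).
    by rewrite /phase big_nat1 addn0 /u natrX mulrCA.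
  apply: small_sum => x xt; apply: smallZ; apply: small_wave => //.
  exact: (allP ht).
have [L hL] := sF _ k4; have [L' hL'] := sG _ k4.
exists (maxn L L') => n i N'; rewrite geq_max => /andP[l1 l2] bl.
have b1 := hL n i N' l1 bl; have b2 := hL' n i N' l2 bl; have b3 := block_mass bl.
have -> : block_sum (fun n p => g n p * om ^+ (n %/ p ^ j)) n i N'
  = block_sum (fun n p => g n p * F (u n p)) n i N'
  + block_sum (fun n p => g n p * (om ^+ (n %/ p ^ j) - F (u n p))) n i N'.
  by rewrite /block_sum -big_split; apply: eq_bigr => p _ /=; rewrite -mulrDr -mulrDr addrC subrK.
apply: le_trans (cmodD _ _) _.
have b4 : cmod (block_sum (fun n p => g n p * (om ^+ (n %/ p ^ j) - F (u n p))) n i N')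
  <= k / 8 * (2 * (2 ^ i)%:R) + k / 4 * (2 ^ i)%:R.
  apply: le_trans (cmod_sum _ _ _) _.
  apply: (@le_trans _ _ (\sum_((2 ^ i).+1 <= p < N'.+1 | prime p)
     (k / 8 * ln p%:R + complex.Re (toC (ln p%:R) * G (u n p))))).
    apply: ler_sum => p pp; rewrite cmodM cmod_toC ger0_norm ?ln_nat_ge0 // Re_toCM.
    rewrite [k / 8 * _]mulrC -mulrDr; apply: ler_wpM2l; first exact: ln_nat_ge0.
    rewrite cmodM -[leRHS]mul1r; apply: ler_pM; rewrite ?cmod_ge0 //.
    have pj : (0 < p ^ j)%N by rewrite expn_gt0 prime_gt0.
    have pR : 0 < (p ^ j)%:R :> R by rewrite ltr0n.
    have -> : u n p = (n %/ p ^ j)%:R + (n %% p ^ j)%:R / (p ^ j)%:R.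
      by rewrite /u {1}(divn_eq n (p ^ j)) natrD natrM; field; rewrite gt_eqF.
    apply: FG; first by rewrite divr_ge0.
    by rewrite ltr_pdivrMr // mul1r ltr_nat ltn_mod.
  rewrite big_split /= -mulr_sumr; apply: lerD.
    by apply: ler_wpM2l => //; exact: ltW.
  rewrite -Re_sum; apply: le_trans (cmod_Re _) _; exact: b2.
have -> : k * (2 ^ i)%:R = k / 4 * (2 ^ i)%:R
   + (k / 8 * (2 * (2 ^ i)%:R) + k / 4 * (2 ^ i)%:R) + k / 4 * (2 ^ i)%:R.
  by set x := (2 ^ i)%:R; field.
by apply: le_trans (lerD b1 b4) _; rewrite lerDl; apply: mulr_ge0 => //; exact: ltW.
Qed.

Lemma norm_om_prod n p J r :
  cmod (\prod_(r.+1 <= j < J.+1) om ^+ (n %/ p ^ j)) = 1.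
Proof.
elim/big_rec: _ => [|j z _ h]; first exact: cmod1.
by rewrite cmodM h mulr1 /om eX norm_e.
Qed.

(** Absorb the factors j = r + 2, ..., Jb into the wave one at a time: a term
    al * n/p^j of the approximation just becomes one more coefficient of the phase.  The
    coefficient c 0 of n/p stays nonzero, so the result is always a wave of leading
    exponent 1. *)
Lemma small_wave_floors r (c : nat -> R) : (r < Jb)%N -> c 0%N != 0 ->
  small (fun n p => wave 1 r c n p * \prod_(r.+2 <= j < Jb.+1) om ^+ (n %/ p ^ j)).
Proof.
move=> rJ; move: {2}(Jb - r.+1)%N (erefl (Jb - r.+1)%N) => k.
elim: k r rJ c => [|k IH] r rJ c kE c0.
  apply: (@small_ext (wave 1 r c)).
    by move=> n p _; rewrite big_geq ?mulr1 //; lia.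
  by apply: small_wave => //; lia.
have rJ' : (r.+1 < Jb)%N by lia.
apply: (@small_ext (fun n p => (wave 1 r c n p * \prod_(r.+3 <= j < Jb.+1) om ^+ (n %/ p ^ j))
    * om ^+ (n %/ p ^ r.+2))).
  by move=> n p _; rewrite [in RHS]big_ltn //; ring.
apply: small_mul_floor => //.
  by move=> n p; rewrite cmodM norm_om_prod /wave norm_e mulr1.
move=> al al0.
pose c' j := if (j == r.+1)%N then al else c j.
apply: (@small_ext (fun n p => wave 1 r.+1 c' n p * \prod_(r.+3 <= j < Jb.+1) om ^+ (n %/ p ^ j))).
  move=> n p pp; rewrite [RHS]mulrAC; congr (_ * _).
  rewrite /wave -eD; congr e; rewrite /phase big_nat_recr //= mulrDr.
  congr (_ + _).
    congr (_ * _); apply: eq_big_nat => j /andP[_ jr]; rewrite /c' ifF //.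
    by apply/negbTE; lia.
  by rewrite /c' eqxx natrX mulrCA.
apply: IH => //; first by lia.
Qed.

(** The factor j = 1 is treated before the others: its approximation has only nonzero
    frequencies, which supplies the leading term that [small_wave_floors] starts
    from. *)
Lemma small_floor_product : (0 < Jb)%N ->
  small (fun n p => om ^+ (\sum_(1 <= j < Jb.+1) n %/ p ^ j)).
Proof.
move=> J0.
apply: (@small_ext (fun n p => (\prod_(2 <= j < Jb.+1) om ^+ (n %/ p ^ j)) * om ^+ (n %/ p ^ 1))).
  move=> n p _; rewrite [in RHS]big_ltn // exprD mulrC; congr (_ * _).
  by elim/big_rec2: _ => [|j z m _ ->]; rewrite ?expr0 // exprD.
apply: small_mul_floor => //.
  by move=> n p; rewrite norm_om_prod.
move=> al al0.
apply: (@small_ext (fun n p => wave 1 0 (fun=> al) n p * \prod_(2 <= j < Jb.+1) om ^+ (n %/ p ^ j))).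
  move=> n p _; rewrite mulrC; congr (_ * e _).
  by rewrite /phase big_nat1 addn0 natrX mulrCA.
exact: small_wave_floors.
Qed.
End SmallOnBlocks.

(** * Periodic functions of the valuation of n! *)
Section Valuation.
Variable R : realType.

Lemma logn_fact_short p n J : prime p -> (n < p ^ J.+1)%N ->
  logn p n`! = (\sum_(1 <= j < J.+1) n %/ p ^ j)%N.
Proof.
move=> pp nJ; rewrite logn_fact //.
have z k : (J < k)%N -> (n %/ p ^ k = 0)%N.
  by move=> Jk; apply: divn_small; apply: leq_trans nJ _; rewrite leq_pexp2l // prime_gt0.
have zn k : (n < k)%N -> (n %/ p ^ k = 0)%N.
  by move=> nk; apply: divn_small; apply: ltn_trans nk _; rewrite ltn_expl // prime_gt1.
pose M := maxn n J.
transitivity (\sum_(1 <= k < M.+1) n %/ p ^ k)%N.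
  rewrite [RHS](big_cat_nat (n := n.+1)) //= ?ltnS ?leq_maxl //.
  rewrite [X in (_ = _ + X)%N]big_nat_cond [X in (_ = _ + X)%N]big1 ?addn0 //.
  by move=> k /andP[/andP[k1 _] _]; exact: zn.
rewrite [LHS](big_cat_nat (n := J.+1)) //= ?ltnS ?leq_maxr //.
rewrite [X in (_ + X = _)%N]big_nat_cond [X in (_ + X = _)%N]big1 ?addn0 //.
by move=> k /andP[/andP[k1 _] _]; exact: z.
Qed.

Section Periodic.
Variables (Q : nat) (f : nat -> R).
Hypotheses (Q0 : (0 < Q)%N) (fQ : forall v, f (v %% Q) = f v)
  (fsum : \sum_(0 <= r < Q) f r = 0).
Let QR : 0 < Q%:R :> R. Proof. by rewrite ltr0n. Qed.

Definition fourier_coef (h : nat) : R[i] :=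
  toC (Q%:R^-1) * \sum_(0 <= r < Q) toC (f r) * e (r%:R * - (h%:R / Q%:R)).

(** The trivial character h = 0 does not occur because f has mean zero. *)
Lemma fourier_inversion v :
  toC (f v) = \sum_(1 <= h < Q) fourier_coef h * e (h%:R / Q%:R) ^+ v.
Proof.
have c0 : fourier_coef 0 = 0.
  rewrite /fourier_coef (eq_bigr (fun r => toC (f r))); last first.
    by move=> r _; rewrite mul0r oppr0 mulr0 e0 mulr1.
  by rewrite -toC_sum fsum mulr0.
transitivity (\sum_(0 <= h < Q) fourier_coef h * e (h%:R / Q%:R) ^+ v); last first.
  by rewrite big_ltn // c0 mul0r add0r.
have vQ : (v %% Q < Q)%N by rewrite ltn_mod.
have eE h : e (h%:R / Q%:R) ^+ v = e ((v %% Q)%:R * (h%:R / Q%:R)) :> R[i].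
  rewrite eX {1}(divn_eq v Q) natrD mulrDl natrM -[RHS]mul1r eD; congr (_ * _).
  by rewrite -mulrA [Q%:R * _]mulrC -mulrA mulVf ?gt_eqF // mulr1 -natrM e_nat.
rewrite -fQ; set w := (v %% Q)%N.
under eq_bigr => h _.
  rewrite eE /fourier_coef -mulrA mulr_suml.
  under eq_bigr => r _ do rewrite -mulrA -eD.
  over.
rewrite -mulr_sumr exchange_big_nat /=.
rewrite (eq_big_nat _ _ (F2 := fun r => if r == w then toC (f r) * Q%:R else 0)); last first.
  move=> r /andP[_ rQ]; rewrite -mulr_sumr.
  rewrite (eq_bigr (fun h => e ((r%:R - w%:R) * - (h%:R / Q%:R)))); last first.
    by move=> h _; congr e; rewrite /w; ring.
  by rewrite sum_roots_diff //; case: eqP => _; rewrite ?mulr0.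
rewrite -big_mkcond /= big_nat1_eq vQ -toC_nat -toCM -toCM.
by congr toC; field; rewrite gt_eqF.
Qed.

(** When p^(J+1) > n, the valuation v_p(n!) is the sum of the first J floors, so each
    character of it is a product of J floor characters. *)
Lemma periodic_small (D J : nat) (kappa : R) : (0 < D)%N -> (0 < J)%N -> 0 < kappa ->
  exists L0 : nat, forall n i N', (L0 <= trunc_log 2 n)%N ->
    in_block D J n i N' -> (trunc_log 2 n < i * J.+1)%N -> (0 < n)%N ->
    `|\sum_((2 ^ i).+1 <= p < N'.+1 | prime p) ln p%:R * f (logn p n`!)| <= kappa * (2 ^ i)%:R.
Proof.
move=> D0 J0 k0.
have sm : small D J (fun n p => \sum_(h <- index_iota 1 Q) fourier_coef h *
     e (h%:R / Q%:R) ^+ (\sum_(1 <= j < J.+1) n %/ p ^ j)).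
  apply: small_sum => h; rewrite mem_index_iota => /andP[h1 hQ]; apply: smallZ.
  exact: small_floor_product.
have [L0 hL] := sm _ k0; exists L0 => n i N' LL bl Li n0.
have := hL n i N' LL bl; rewrite -cmod_toC toC_sum; congr (cmod _ <= _).
rewrite /block_sum big_nat_cond [RHS]big_nat_cond.
apply: eq_bigr => p /andP[/andP[p1 _] pp]; rewrite toCM; congr (_ * _).
rewrite -fourier_inversion (@logn_fact_short p n J pp) //.
apply: leq_trans (trunc_log_ltn n (isT : 1 < 2)%N) _.
apply: (@leq_trans (2 ^ (i * J.+1))%N); first by rewrite leq_pexp2l.
by rewrite expnM leq_exp2r // ltnW.
Qed.

Variable Fm : R.
Hypothesis fF : forall v, `|f v| <= Fm.
Let Fm0 : 0 <= Fm. Proof. exact: le_trans (normr_ge0 _) (fF 0%N). Qed.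

(** The block of 2^i is treated by exponential sums with J floors: n^(1/D) <= 2^i,
    2^(iJ) <= n^(1-1/D) and n < 2^(i(J+1)), up to constants. *)
Definition good D J n i : bool :=
  [&& 0 < J, trunc_log 2 n <= D * i, D * (i * J) + trunc_log 2 n <= D * trunc_log 2 n
    & trunc_log 2 n < i * J.+1]%N.

(** On good blocks J is at most D, so the threshold of [periodic_small] can be chosen
    independently of J. *)
Lemma periodic_small_good (D : nat) (kappa : R) : (0 < D)%N -> 0 < kappa ->
  exists L0 : nat, forall n i N' J, (L0 <= trunc_log 2 n)%N -> (0 < n)%N ->
    good D J n i -> (2 ^ i <= N')%N -> (N' <= 2 * 2 ^ i)%N ->
    `|\sum_((2 ^ i).+1 <= p < N'.+1 | prime p) ln p%:R * f (logn p n`!)| <= kappa * (2 ^ i)%:R.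
Proof.
move=> D0 k0.
have H B : exists L0 : nat, forall J, (0 < J <= B)%N -> forall n i N', (L0 <= trunc_log 2 n)%N ->
    in_block D J n i N' -> (trunc_log 2 n < i * J.+1)%N -> (0 < n)%N ->
    `|\sum_((2 ^ i).+1 <= p < N'.+1 | prime p) ln p%:R * f (logn p n`!)| <= kappa * (2 ^ i)%:R.
  elim: B => [|B [L IH]]; first by exists 0%N => J; case: J.
  have [L' hL'] := @periodic_small D B.+1 kappa D0 isT k0.
  exists (maxn L L') => J /andP[J0]; rewrite leq_eqVlt => /orP[/eqP ->|JB] n i N'.
    by rewrite geq_max => /andP[_ l2]; exact: hL'.
  by rewrite geq_max => /andP[l1 _]; apply: IH => //; rewrite J0.
have [L0 hL] := H D; exists (maxn L0 1) => n i N' J; rewrite geq_max => /andP[l1 l2] n0.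
move=> /and4P[J0 g2 g3 g4] N1 N2.
apply: (hL J) => //; last by apply/and4P.
rewrite J0 /=; have iJ : (i * J <= trunc_log 2 n)%N.
  by rewrite -(leq_pmul2l D0); apply: leq_trans g3; rewrite leq_addr.
have i0 : (0 < i)%N by case: (i) g2 => //; rewrite muln0; case: trunc_log l2.
by rewrite -(leq_pmul2l i0) [(i * D)%N]mulnC; apply: leq_trans g2.
Qed.

Definition weighted al be n p : R :=
  if prime p && (al < p <= be)%N then ln p%:R / p%:R * f (logn p n`!) else 0.

Lemma weighted_block_trivial al be n i :
  `|\sum_((2 ^ i).+1 <= p < (2 * 2 ^ i).+1) weighted al be n p| <= 2 * Fm.
Proof.
have P0 : 0 < (2 ^ i)%:R :> R by rewrite ltr0n expn_gt0.
apply: le_trans (ler_norm_sum _ _ _) _.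
apply: (@le_trans _ _ (\sum_((2 ^ i).+1 <= p < (2 * 2 ^ i).+1 | prime p) ln p%:R * ((2 ^ i)%:R^-1 * Fm))).
  rewrite [leRHS]big_mkcond; apply: ler_sum_nat => p /andP[p1 p2]; rewrite /weighted.
  have l0 := ln_nat_ge0 R p.
  case: (prime p); last by rewrite normr0.
  have B0 : 0 <= ln p%:R * ((2 ^ i)%:R^-1 * Fm) by rewrite !mulr_ge0 ?invr_ge0.
  case: ifP => _; last by rewrite normr0.
  rewrite !normrM (ger0_norm l0) ger0_norm ?invr_ge0 // -mulrA.
  apply: ler_wpM2l => //; apply: ler_pM; rewrite ?invr_ge0 //.
  have p0 : (0 < p)%N by exact: leq_ltn_trans (leq0n _) p1.
  by rewrite lef_pV2 ?posrE ?ltr0n ?expn_gt0 // ler_nat ltnW.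
rewrite -mulr_suml; apply: (@le_trans _ _ (2 * (2 ^ i)%:R * ((2 ^ i)%:R^-1 * Fm))).
  by apply: ler_wpM2r; [rewrite mulr_ge0 ?invr_ge0|exact: chebyshev_dyadic].
by rewrite le_eqVlt; apply/orP; left; apply/eqP; field; rewrite gt_eqF.
Qed.

(** Partial summation removes the weight 1/p; restricting the block to the interval from al
    to be truncates the sum at both ends, which leaves a difference of two initial parts
    of the block. *)
Lemma weighted_block_good al be n i (kappa : R) : 0 <= kappa ->
  (forall N', (2 ^ i <= N')%N -> (N' <= 2 * 2 ^ i)%N ->
    `|\sum_((2 ^ i).+1 <= p < N'.+1 | prime p) ln p%:R * f (logn p n`!)| <= kappa * (2 ^ i)%:R) ->
  `|\sum_((2 ^ i).+1 <= p < (2 * 2 ^ i).+1) weighted al be n p| <= 2 * kappa.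
Proof.
move=> k0 h.
have P0 : 0 < (2 ^ i)%:R :> R by rewrite ltr0n expn_gt0.
pose x := maxn (2 ^ i) al; pose y := minn (2 * 2 ^ i) be.
pose X p : R := if prime p then ln p%:R * f (logn p n`!) else 0.
have -> : \sum_((2 ^ i).+1 <= p < (2 * 2 ^ i).+1) weighted al be n p
  = \sum_(x.+1 <= p < y.+1) p%:R^-1 * X p.
  rewrite /x /y -maxnSS -minnSS -sum_mask; apply: eq_bigr => p _.
  rewrite /weighted /X ltnS; case: (prime p) => /=; last by rewrite mulr0 if_same.
  by case: ifP => // _; rewrite mulrAC mulrC.
have [yx|xy] := leqP y.+1 x.+1; first by rewrite big_geq // normr0 mulr_ge0.
have y2 : (y <= 2 * 2 ^ i)%N by exact: geq_minl.
have x2 : (2 ^ i <= x)%N by exact: leq_maxl.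
have part c : (x.+1 <= c <= y.+1)%N ->
    cmod (\sum_(x.+1 <= k < c) toC (X k)) <= 2 * (kappa * (2 ^ i)%:R).
  case: c => // c /andP[]; rewrite !ltnS => xc cy.
  rewrite -toC_sum cmod_toC.
  have -> : \sum_(x.+1 <= k < c.+1) X k =
     \sum_((2 ^ i).+1 <= k < c.+1 | prime k) ln k%:R * f (logn k n`!)
     - \sum_((2 ^ i).+1 <= k < x.+1 | prime k) ln k%:R * f (logn k n`!).
    rewrite (big_cat_nat (n := x.+1) (m := (2 ^ i).+1) (p := c.+1)) ?ltnS //=.
    by rewrite addrAC subrr add0r [RHS]big_mkcond.
  apply: le_trans (ler_normB _ _) _.
  have h1 := h c (leq_trans x2 xc) (leq_trans cy y2).
  have h2 := h x x2 (leq_trans (leq_trans xc cy) y2).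
  by apply: le_trans (lerD h1 h2) _; rewrite mulr_natl mulr2n.
rewrite -cmod_toC toC_sum; under eq_bigr => p _ do rewrite toCM.
have Ab := @abel_antitone R (fun k => k%:R^-1) (fun k => toC (X k)) x.+1 y.+1 _ xy _ _ part.
apply: le_trans (Ab _ _) _.
- by move=> k _; rewrite invr_ge0.
- move=> k k1 k2; have k0' : (0 < k)%N by exact: leq_trans k1.
  by rewrite lef_pV2 ?posrE ?ltr0n // ?ler_nat.
have -> : 2 * kappa = (2 ^ i)%:R^-1 * (2 * (kappa * (2 ^ i)%:R)) by field; rewrite gt_eqF.
apply: ler_wpM2r; first by rewrite !mulr_ge0.
by rewrite lef_pV2 ?posrE ?ltr0n ?expn_gt0 // ler_nat leqW.
Qed.

(** Either 2^i < n^(1/D1), or some 2^(iJ) with J <= D1 falls between n^(1-1/D) and n. *)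
Definition bad D1 D n i : bool :=
  (D1 * i < trunc_log 2 n)%N ||
  has (fun J => (i * J <= trunc_log 2 n)%N && (D * trunc_log 2 n < D * (i * J) + trunc_log 2 n)%N)
    (iota 1 D1).

Lemma not_bad_good D1 D n i : (0 < D)%N -> (D1 <= D)%N -> (0 < i <= trunc_log 2 n)%N ->
  ~~ bad D1 D n i -> good D (trunc_log 2 n %/ i) n i.
Proof.
set L := trunc_log 2 n => D0 DD /andP[i0 iL]; rewrite /bad -/L negb_or -leqNgt => /andP[b1 /hasPn b2].
have J0 : (0 < L %/ i)%N by rewrite divn_gt0.
have JD : (L %/ i <= D1)%N by rewrite -(leq_pmul2r i0); apply: leq_trans (leq_divM _ _) b1.
have iJ : (i * (L %/ i) <= L)%N by rewrite mulnC leq_divM.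
have := b2 (L %/ i)%N; rewrite mem_iota J0 add1n ltnS JD iJ /= -leqNgt => /(_ isT) h.
apply/and4P; split => //; first by apply: leq_trans b1 _; rewrite leq_mul2r DD orbT.
by rewrite -/L mulnC; exact: ltn_ceil.
Qed.

(** The small i number about L/D1, where L is the binary logarithm of n, and for each
    of the D1 values of J the product i J is confined to an interval of length L/D.
    With D = D1^2 this leaves a proportion O(1/D1) of the blocks. *)
Lemma count_bad D1 D n : (0 < D1)%N -> (0 < D)%N ->
  (\sum_(0 <= i < (trunc_log 2 n).+1 | bad D1 D n i) 1
    <= (trunc_log 2 n %/ D1).+1 + D1 * (trunc_log 2 n %/ D).+1)%N.
Proof.
move=> D10 D0; set L := trunc_log 2 n.
have h J : (0 < J)%N -> (\sum_(0 <= i < L.+1 |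
    (i * J <= L)%N && (D * L < D * (i * J) + L)%N) 1 <= (L %/ D).+1)%N.
  move=> J0; set t := (L %/ D)%N; set u := (L %/ J)%N.
  apply: (@leq_trans (\sum_(0 <= i < L.+1 | (u - t <= i < u.+1)%N) 1)); last first.
    by apply: leq_trans (sum_between _ _ _) _; clear; lia.
  rewrite big_mkcond [leqRHS]big_mkcond; apply: leq_sum => i _.
  case: ifP => // /andP[a b]; rewrite ifT // ltnS.
  have iu : (i <= u)%N by rewrite leq_divRL.
  rewrite iu andbT leq_subCl; apply: (@leq_trans (L - i * J)).
    have uJ : (u * J <= L)%N by exact: leq_divM.
    apply: (@leq_trans ((u - i) * J)%N); first by rewrite leq_pmulr.
    by rewrite mulnBl leq_sub2r.
  rewrite leq_divRL // mulnC mulnBr leq_subLR; exact: ltnW.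
have split_bad i : ((bad D1 D n i : nat) <= (i <= L %/ D1) +
    \sum_(J <- iota 1 D1) ((i * J <= L) && (D * L < D * (i * J) + L)))%N.
  rewrite /bad; case: ltnP => /= [lt|_].
    by rewrite leq_divRL // mulnC (ltnW lt) leq_addr.
  rewrite -/L; elim: (iota 1 D1) => [|J s IH]; first by rewrite /= big_nil.
  by rewrite /= big_cons; case: (_ && _) => //=; rewrite addnCA.
rewrite big_mkcond; apply: (@leq_trans (\sum_(0 <= i < L.+1) ((i <= L %/ D1) +
    \sum_(J <- iota 1 D1) ((i * J <= L) && (D * L < D * (i * J) + L))))%N).
  by apply: leq_sum => i _; apply: leq_trans (split_bad i); case: (bad _ _ _ _).
rewrite big_split /=; apply: leq_add.
  apply: (@leq_trans (\sum_(0 <= i < L.+1 | (0 <= i < (L %/ D1).+1)%N) 1)).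
    by rewrite [leqRHS]big_mkcond; apply: leq_sum => i _; rewrite leq0n /= ltnS; case: (i <= L %/ D1)%N.
  by apply: leq_trans (sum_between _ _ _) _; rewrite subn0.
rewrite exchange_big /=; apply: (@leq_trans (\sum_(J <- iota 1 D1) (L %/ D).+1)).
  rewrite big_seq [leqRHS]big_seq; apply: leq_sum => J; rewrite mem_iota => /andP[J1 _].
  apply: leq_trans (h J J1); rewrite [leqRHS]big_mkcond; apply: leq_sum => i _.
  by case: (_ && _).
by rewrite big_const_seq count_predT size_iota iter_addn_0 mulnC.
Qed.

Lemma dyadic_partition (g : nat -> R) I :
  \sum_(2 <= p < (2 ^ I).+1) g p = \sum_(0 <= i < I) \sum_((2 ^ i).+1 <= p < (2 * 2 ^ i).+1) g p.
Proof.
elim: I => [|I IH]; first by rewrite !big_geq.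
rewrite [RHS]big_nat_recr // -IH -big_cat_nat ?expnS //=; first by rewrite ltnS expn_gt0.
by rewrite ltnS leq_pmull.
Qed.

(** There are L + 1 dyadic blocks.  The good ones contribute eta/4 each, and the bad
    ones at most twice the bound Fm of f, by Chebyshev; D1 is chosen so large that the
    bad ones contribute at most eta L/2 in total. *)
Lemma weighted_sum_small (eta : R) : 0 < eta ->
  exists L0 : nat, forall n al be, (L0 <= trunc_log 2 n)%N -> (0 < n)%N -> (be <= n)%N ->
  `|\sum_(1 <= p < n.+1) weighted al be n p| <= eta * (trunc_log 2 n)%:R.
Proof.
move=> eta0.
pose D1 := (Num.bound (16 * Fm / eta)).+1; pose D := (D1 * D1)%N.
have D10 : (0 < D1)%N by [].
have D0 : (0 < D)%N by rewrite muln_gt0.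
have D1D : (D1 <= D)%N by rewrite leq_pmull.
have k8 : 0 < eta / 8 by rewrite divr_gt0.
have x0 : 0 <= 16 * Fm / eta by rewrite divr_ge0 ?mulr_ge0 // ltW.
have DF : 16 * Fm <= eta * D1%:R.
  have h : 16 * Fm / eta <= D1%:R.
    by apply: le_trans (ltW (archi_boundP x0)) _; rewrite ler_nat.
  by move: h; rewrite ler_pdivrMr // [D1%:R * _]mulrC.
clearbody D1.
have [L1 hL1] := periodic_small_good D0 k8.
pose y := 16 * Fm * (D1%:R + 1) / eta + 1.
have y0 : 0 <= y.
  by rewrite addr_ge0 // divr_ge0 ?mulr_ge0 ?addr_ge0 // ltW.
exists (maxn L1 (Num.bound y)) => n al be; rewrite geq_max => /andP[l1 l2] n0 ben.
set L := trunc_log 2 n in l1 l2 *.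
have yL : y <= L%:R.
  by apply: le_trans (ltW (archi_boundP y0)) _; rewrite ler_nat.
have nL : (n < 2 ^ L.+1)%N by exact: trunc_log_ltn.
have -> : \sum_(1 <= p < n.+1) weighted al be n p
   = \sum_(2 <= p < (2 ^ L.+1).+1) weighted al be n p.
  rewrite big_ltn ?ltnS // [weighted _ _ _ 1]/weighted /= add0r.
  rewrite [RHS](big_cat_nat (n := maxn 2 n.+1)) ?leq_maxl //=; last first.
    by rewrite geq_max ltnS expn_gt0 /= ltnS ltnW.
  rewrite [X in _ = _ + X]big_nat_cond [X in _ = _ + X]big1 ?addr0; last first.
    move=> p /andP[/andP[p1 _] _]; rewrite /weighted ifF //; apply/negbTE.
    rewrite negb_and negb_and; apply/orP; right; apply/orP; right.
    rewrite -ltnNge; apply: leq_ltn_trans ben _; move: p1; rewrite geq_max => /andP[_]; exact.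
  case: (n) n0 => // -[|m] _; last by congr bigop.body; congr index_iota; lia.
  by rewrite !big_geq.
rewrite dyadic_partition; apply: le_trans (ler_norm_sum _ _ _) _.
apply: (@le_trans _ _ (\sum_(0 <= i < L.+1) (eta / 4 + (if bad D1 D n i || (i == 0%N) then 2 * Fm else 0)))).
  apply: ler_sum_nat => i /andP[_ iL]; rewrite ltnS in iL.
  have triv := weighted_block_trivial al be n i.
  case: ifPn => [_|]; first by apply: le_trans triv _; rewrite lerDr ltW // divr_gt0.
  rewrite negb_or addr0 => /andP[nb i0]; rewrite -lt0n in i0.
  have gd := not_bad_good D0 D1D (introT andP (conj i0 iL)) nb.
  have -> : eta / 4 = 2 * (eta / 8) by field.
  apply: weighted_block_good; first exact: ltW.
  by move=> N' N1 N2; exact: (hL1 n i N' _ l1 n0 gd N1 N2).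
rewrite big_split /= sumr_const_nat subn0.
have cnt : \sum_(0 <= i < L.+1) (if bad D1 D n i || (i == 0%N) then 2 * Fm else 0 : R)
    <= 2 * Fm * ((L %/ D1).+1 + D1 * (L %/ D).+1 + 1)%:R.
  have -> : \sum_(0 <= i < L.+1) (if bad D1 D n i || (i == 0%N) then 2 * Fm else 0 : R)
    = 2 * Fm * (\sum_(0 <= i < L.+1 | bad D1 D n i || (i == 0%N)) 1)%N%:R.
    by rewrite natr_sum mulr_sumr -big_mkcond; apply: eq_bigr => *; rewrite mulr1.
  apply: ler_wpM2l; first by rewrite mulr_ge0.
  rewrite ler_nat; apply: leq_trans (leq_add (count_bad n D10 D0) (leqnn 1)).
  apply: (@leq_trans (\sum_(0 <= i < L.+1 | bad D1 D n i) 1 + \sum_(0 <= i < L.+1 | i == 0%N) 1)%N).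
    rewrite big_mkcond [X in (_ <= X + _)%N]big_mkcond [X in (_ <= _ + X)%N]big_mkcond -big_split.
    by apply: leq_sum => i _; case: (bad D1 D n i); case: (i == 0%N).
  by rewrite leq_add2l big_nat1_eq.
have cntR : ((L %/ D1).+1 + D1 * (L %/ D).+1 + 1)%:R <= 2 * L%:R / D1%:R + (D1%:R + 1) + 1 :> R.
  have D1R : 0 < D1%:R :> R by rewrite ltr0n.
  have a1 : (L %/ D1)%:R <= L%:R / D1%:R :> R.
    by rewrite ler_pdivlMr // -natrM ler_nat leq_divM.
  have a2 : D1%:R * (L %/ D)%:R <= L%:R / D1%:R :> R.
    rewrite ler_pdivlMr // -!natrM ler_nat mulnAC -/D mulnC; exact: leq_divM.
  rewrite !natrD natrM -!natr1 mulrDr mulr1; lra.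
have last : 2 * Fm * (2 * L%:R / D1%:R + (D1%:R + 1) + 1) <= eta / 2 * L%:R.
  have D1R : 0 < D1%:R :> R by rewrite ltr0n.
  have b1 : 2 * Fm * (2 * L%:R / D1%:R) <= eta / 4 * L%:R.
    have -> : 2 * Fm * (2 * L%:R / D1%:R) = (16 * Fm) * (L%:R / D1%:R) / 4 by field; rewrite gt_eqF.
    have -> : eta / 4 * L%:R = (eta * D1%:R) * (L%:R / D1%:R) / 4 by field; rewrite gt_eqF.
    apply: ler_wpM2r => //; apply: ler_wpM2r => //.
  have b2 : 2 * Fm * ((D1%:R + 1) + 1) <= eta / 4 * L%:R.
    have D11 : 1 <= D1%:R :> R by rewrite ler1n.
    have s1 : 2 * Fm * ((D1%:R + 1) + 1) <= 2 * Fm * (D1%:R + 1) * 2.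
      by rewrite -[leRHS]mulrA; apply: ler_wpM2l; [rewrite mulr_ge0|lra].
    have s2 : 16 * Fm * (D1%:R + 1) / eta <= L%:R by apply: le_trans yL; rewrite lerDl.
    have s3 : 16 * Fm * (D1%:R + 1) <= L%:R * eta by rewrite -ler_pdivrMr.
    lra.
  lra.
have L1R : 1 <= L%:R :> R.
  by apply: le_trans yL; rewrite lerDr divr_ge0 ?mulr_ge0 ?addr_ge0 // ltW.
have fm := ler_wpM2l (mulr_ge0 (ler0n R 2) Fm0) cntR.
have -> : (eta / 4) *+ L.+1 = eta / 4 * L%:R + eta / 4 by rewrite -[_ *+ L.+1]mulr_natr -(natr1 L) mulrDr mulr1.
have e1 : eta / 4 <= eta / 4 * L%:R by rewrite ler_peMr // divr_ge0 // ltW.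
have := le_trans cnt (le_trans fm last); lra.
Qed.
End Periodic.
End Valuation.

(** * Mertens' theorem and the size of n! *)
Section Mertens.
Variable R : realType.

Lemma sum_dyadic_le (g : nat -> R) (B : nat -> R) n :
  (0 < n)%N -> (forall p, 0 <= g p) -> (forall i, 0 <= B i) ->
  (forall i, \sum_((2 ^ i).+1 <= p < (2 * 2 ^ i).+1) g p <= B i) ->
  \sum_(2 <= p < n.+1) g p <= \sum_(0 <= i < (trunc_log 2 n).+1) B i.
Proof.
move=> n0 g0 B0 h; set L := trunc_log 2 n.
apply: (@le_trans _ _ (\sum_(2 <= p < (2 ^ L.+1).+1) g p)).
  have nL : (n < 2 ^ L.+1)%N by exact: trunc_log_ltn.
  have [n2|n2] := leqP 2 n.+1; last by rewrite big_geq ?(ltnW n2) // sumr_ge0.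
  rewrite [leRHS](big_cat_nat (n := n.+1)) //=; last by rewrite ltnS ltnW.
  by rewrite lerDl sumr_ge0.
rewrite dyadic_partition; apply: ler_sum => i _; exact: h.
Qed.

Lemma theta_le n : (0 < n)%N -> \sum_(1 <= p < n.+1 | prime p) ln p%:R <= 4 * n%:R :> R.
Proof.
move=> n0.
pose g p : R := if prime p then ln p%:R else 0.
have -> : \sum_(1 <= p < n.+1 | prime p) ln p%:R = \sum_(2 <= p < n.+1) g p.
  rewrite big_mkcond; case: n n0 => // n _; rewrite big_ltn //=.
  by rewrite add0r.
apply: (@le_trans _ _ (\sum_(0 <= i < (trunc_log 2 n).+1) 2 * (2 ^ i)%:R)).
  apply: sum_dyadic_le => // i; first by rewrite /g; case: ifP => // _; exact: ln_nat_ge0.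
  by rewrite /g -big_mkcond; exact: chebyshev_dyadic.
have -> I : \sum_(0 <= i < I) 2 * (2 ^ i)%:R = 2 * (2 ^ I)%:R - 2 :> R.
  elim: I => [|I IH]; first by rewrite big_geq // expn0 mulr1 subrr.
  by rewrite big_nat_recr //= IH expnS natrM; ring.
have := trunc_logP (isT : 1 < 2)%N n0; rewrite -(ler_nat R) expnS natrM; lra.
Qed.

Lemma sum_ln_sqr_le n : (0 < n)%N ->
  \sum_(1 <= p < n.+1 | prime p) ln p%:R / p%:R ^+ 2 <= 4 :> R.
Proof.
move=> n0.
pose g p : R := if prime p then ln p%:R / p%:R ^+ 2 else 0.
have -> : \sum_(1 <= p < n.+1 | prime p) ln p%:R / p%:R ^+ 2 = \sum_(2 <= p < n.+1) g p.
  rewrite big_mkcond; case: n n0 => // n _; rewrite big_ltn //=.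
  by rewrite add0r.
apply: (@le_trans _ _ (\sum_(0 <= i < (trunc_log 2 n).+1) 2 * (2 ^ i)%:R^-1)).
  apply: sum_dyadic_le => // i.
    by rewrite /g; case: ifP => // _; rewrite mulr_ge0 ?ln_nat_ge0 ?invr_ge0 ?exprn_ge0.
  have P0 : 0 < (2 ^ i)%:R :> R by rewrite ltr0n expn_gt0.
  rewrite /g -big_mkcond; apply: (@le_trans _ _
     (\sum_((2 ^ i).+1 <= p < (2 * 2 ^ i).+1 | prime p) ln p%:R * (2 ^ i)%:R ^- 2)).
    rewrite big_nat_cond [leRHS]big_nat_cond; apply: ler_sum => p /andP[/andP[p1 _] _].
    apply: ler_wpM2l; first exact: ln_nat_ge0.
    have p0 : 0 < p%:R :> R by rewrite ltr0n; exact: leq_ltn_trans p1.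
    by rewrite lef_pV2 ?posrE ?exprn_gt0 // lerXn2r ?nnegrE // ler_nat ltnW.
  rewrite -mulr_suml; apply: (@le_trans _ _ (2 * (2 ^ i)%:R * (2 ^ i)%:R ^- 2)).
    by apply: ler_wpM2r; [rewrite invr_ge0 exprn_ge0|exact: chebyshev_dyadic].
  by rewrite le_eqVlt; apply/orP; left; apply/eqP; move: P0; set x := (2 ^ i)%:R => P0; field; rewrite gt_eqF.
have E I : \sum_(0 <= i < I) 2 * (2 ^ i)%:R^-1 = 4 - 4 * (2 ^ I)%:R^-1 :> R.
  elim: I => [|I IH]; first by rewrite big_geq // expn0 invr1 mulr1 subrr.
  by rewrite big_nat_recr //= IH expnS natrM invfM; field.
rewrite E; have : 0 <= (2 ^ (trunc_log 2 n).+1)%:R^-1 :> R by rewrite invr_ge0.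
lra.
Qed.

(** The floor of n/p accounts for an error 1, and the higher powers of p for a geometric
    series with first term n/p^2. *)
Lemma logn_fact_approx p n : prime p -> (0 < n)%N ->
  `|(logn p n`!)%:R - n%:R / p%:R| <= 1 + 2 * (n%:R / p%:R ^+ 2) :> R.
Proof.
move=> pp n0; have p0 : 0 < p%:R :> R by rewrite ltr0n prime_gt0.
have p2 : 2 <= p%:R :> R by rewrite ler_nat prime_gt1.
have E : logn p n`! = (n %/ p + \sum_(2 <= k < n.+1) n %/ p ^ k)%N.
  by rewrite logn_fact // big_ltn // expn1.
have low : n%:R / p%:R - 1 <= (logn p n`!)%:R :> R.
  apply: (@le_trans _ _ (n %/ p)%:R); last by rewrite ler_nat E leq_addr.
  rewrite lerBlDr ler_pdivrMr // natr1 -natrM ler_nat ltnW // ltn_ceil // prime_gt0 //.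
have up1 : (n %/ p)%:R <= n%:R / p%:R :> R.
  by rewrite ler_pdivlMr // -natrM ler_nat leq_divM.
have up2 : (\sum_(2 <= k < n.+1) n %/ p ^ k)%:R <= 2 * (n%:R / p%:R ^+ 2) :> R.
  rewrite natr_sum; apply: (@le_trans _ _ (\sum_(2 <= k < n.+1) n%:R / p%:R ^+ k)).
    apply: ler_sum => k _; rewrite ler_pdivlMr ?exprn_gt0 // -natrX -natrM ler_nat.
    exact: leq_divM.
  have G m : \sum_(2 <= k < m.+2) (p%:R ^- k : R) <= 2 * p%:R ^- 2 - 2 * p%:R ^- m.+2.
    elim: m => [|m IH]; first by rewrite big_geq // subrr.
    rewrite big_nat_recr //=; have xp : 0 < p%:R ^- m.+2 :> R by rewrite invr_gt0 exprn_gt0.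
    have : 2 * p%:R ^- m.+3 <= p%:R ^- m.+2 :> R.
      rewrite [p%:R ^+ m.+3]exprS invfM mulrA -[leRHS]mul1r; apply: ler_wpM2r; first exact: ltW.
      by rewrite ler_pdivrMr // mul1r.
    move: IH; lra.
  rewrite -mulr_sumr mulrCA; apply: ler_wpM2l => //.
  case: (n) n0 => // m _.
  apply: le_trans (G m) _; rewrite gerBl mulr_ge0 // invr_ge0 exprn_ge0 // ltW.
have nn : 0 <= n%:R / p%:R ^+ 2 :> R by rewrite divr_ge0 ?exprn_ge0 ?(ltW p0).
have -> : (logn p n`!)%:R = (n %/ p)%:R + (\sum_(2 <= k < n.+1) n %/ p ^ k)%:R :> R.
  by rewrite -natrD -E.
rewrite E natrD in low; rewrite ler_norml; apply/andP; split; lra.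
Qed.

Lemma sum_logn_approx n : (0 < n)%N ->
  \sum_(1 <= p < n.+1 | prime p) ln p%:R * `|(logn p n`!)%:R - n%:R / p%:R| <= 12 * n%:R :> R.
Proof.
move=> n0.
apply: (@le_trans _ _ (\sum_(1 <= p < n.+1 | prime p) (ln p%:R + 2 * n%:R * (ln p%:R / p%:R ^+ 2)))).
  apply: ler_sum => p pp.
  apply: le_trans (ler_wpM2l (ln_nat_ge0 R p) (logn_fact_approx pp n0)) _.
  by rewrite le_eqVlt; apply/orP; left; apply/eqP; ring.
rewrite big_split /= -mulr_sumr.
have h1 := theta_le n0; have h2 := sum_ln_sqr_le n0.
have n2 : 0 <= 2 * n%:R :> R by rewrite mulr_ge0.
have h3 := ler_wpM2l n2 h2; lra.
Qed.

Lemma ln_fact_sum n : (0 < n)%N ->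
  ln n`!%:R = \sum_(1 <= p < n.+1 | prime p) ln p%:R * (logn p n`!)%:R :> R.
Proof.
move=> n0; have nf : (0 < n`! < (n`!).+1)%N by rewrite fact_gt0 ltnSn.
have nn : (n < (n`!).+1)%N.
  by rewrite ltnS dvdn_leq ?fact_gt0 // dvdn_fact // n0 leqnn.
rewrite (ln_nat_sum R nf) [LHS](big_cat_nat (n := n.+1)) //=.
rewrite [X in _ + X]big_nat_cond [X in _ + X]big1 ?addr0.
  by apply: eq_bigr => p _; rewrite mulrC.
move=> p /andP[/andP[np _] pp].
rewrite (_ : logn p n`! = 0%N) ?mul0r //; apply/eqP; rewrite -leqn0 leqNgt logn_gt0.
rewrite mem_primes pp fact_gt0 /=; apply/negP => /(prime_dvd_fact pp).
by rewrite leqNgt np.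
Qed.

Lemma ln_fact_bounds n : (0 < n)%N ->
  n%:R * ln (n%:R : R) - n%:R <= ln (n`!%:R : R) <= n%:R * ln (n%:R : R).
Proof.
elim: n => // -[|n] IH _; first by rewrite ln1; apply/andP; split; lra.
have /andP[l u] := IH isT.
have n1 : 0 < n.+1%:R :> R by rewrite ltr0n.
have n2 : 0 < n.+2%:R :> R by rewrite ltr0n.
have e2 : n.+2%:R = n.+1%:R + 1 :> R by rewrite natr1.
rewrite factS natrM lnM ?posrE ?ltr0n ?fact_gt0 //.
have inc : ln n.+1%:R <= ln n.+2%:R :> R by rewrite ler_ln ?posrE // ler_nat.
have d : n.+1%:R * (ln n.+2%:R - ln n.+1%:R) <= 1 :> R.
  rewrite -ln_div ?posrE // mulrC -ler_pdivlMr // div1r.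
  have -> : n.+2%:R / n.+1%:R = 1 + n.+1%:R^-1 :> R by rewrite e2 mulrDl mul1r divff ?gt_eqF.
  by apply: le_ln1Dx; apply: lt_trans (_ : 0 < _); rewrite ?invr_gt0 // ltrN10.
have g : n.+1%:R * ln n.+1%:R <= n.+1%:R * ln n.+2%:R :> R by apply: ler_wpM2l.
rewrite mulrBr in d; rewrite e2 mulrDl mul1r.
move: l u d g; rewrite e2; set x := ln n.+1%:R; set y := ln (n.+1%:R + 1).
set v := n.+1%:R; set w := ln _; set vx := v * x; set vy := v * y.
move=> *; apply/andP; split; lra.
Qed.

(** Compare log n! = sum of v_p(n!) log p, where v_p(n!) is n/p with a total error
    12 n, with n log n, which differs from log n! by at most n. *)
Lemma mertens n : (0 < n)%N ->
  `|\sum_(1 <= p < n.+1 | prime p) ln p%:R / p%:R - ln n%:R| <= 13 :> R.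
Proof.
move=> n0; have nR : 0 < n%:R :> R by rewrite ltr0n.
rewrite -(ler_pM2l nR) -{1}(ger0_norm (ltW nR)) -normrM mulrBr.
have e1 : n%:R * (\sum_(1 <= p < n.+1 | prime p) ln p%:R / p%:R) - ln n`!%:R
  = - \sum_(1 <= p < n.+1 | prime p) ln p%:R * ((logn p n`!)%:R - n%:R / p%:R) :> R.
  rewrite (ln_fact_sum n0) mulr_sumr -sumrB -sumrN; apply: eq_bigr => p _; ring.
have b1 : `|n%:R * (\sum_(1 <= p < n.+1 | prime p) ln p%:R / p%:R) - ln n`!%:R| <= 12 * n%:R :> R.
  rewrite e1 normrN; apply: le_trans (ler_norm_sum _ _ _) _.
  apply: le_trans (sum_logn_approx n0); apply: ler_sum => p _.
  by rewrite normrM (ger0_norm (ln_nat_ge0 R p)).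
have /andP[l u] := ln_fact_bounds n0.
move: b1; rewrite !ler_norml => /andP[b1 b2]; rewrite [n%:R * 13]mulrC.
move: l u b1 b2; set A := n%:R * \sum_(_ <= _ < _ | _) _; set B := ln _`!%:R.
set C := n%:R * ln _ => *; apply/andP; split; lra.
Qed.
End Mertens.

(** * Eventual periodicity of finite unions of progressions *)
Section Progressions.

Lemma arith_prog_periodic (u : int) (q Q : nat) : (0 < q)%N -> (q %| Q)%N ->
  exists m0 : nat, forall m, (m0 <= m)%N -> arith_prog u q (m + Q)%N <-> arith_prog u q m.
Proof.
move=> q0 /dvdnP[t QE]; exists (`|u|%N).+1 => m mu; split.
  move=> [_ [k hk]]; split; first by apply: leq_trans mu.
  have tk : (t <= k)%N.
    have : (Q%:Z <= k%:Z * q%:Z)%R by move: hk mu; rewrite PoszD; lia.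
    by rewrite QE -PoszM lez_nat leq_pmul2r.
  exists (k - t)%N; rewrite -subzn // mulrBl.
  by move: hk; rewrite QE PoszD !PoszM => hk; lia.
move=> [_ [k hk]]; split; first by rewrite addn_gt0; apply/orP; left; exact: leq_trans mu.
exists (k + t)%N; rewrite !PoszD hk QE PoszM; ring.
Qed.

Lemma finite_union_periodic (A : set nat) : finite_union_of_arith_progs A ->
  exists Q m0 : nat, (0 < Q)%N /\
    forall m, (m0 <= m)%N -> ((m + Q)%N \in A) = (m \in A).
Proof.
move=> [s [s0 AE]]; pose Q := (\prod_(uq <- s) uq.2)%N.
have Q0 : (0 < Q)%N by rewrite /Q big_seq; apply: prodn_cond_gt0 => uq /s0.
have sQ uq : uq \in s -> (uq.2 %| Q)%N.
  by move=> us; rewrite /Q (big_rem uq) //= dvdn_mulr.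
have [m0 h] : exists m0 : nat, forall m, (m0 <= m)%N ->
    (\big[setU/set0]_(uq <- s) arith_prog uq.1 uq.2) (m + Q)%N <->
    (\big[setU/set0]_(uq <- s) arith_prog uq.1 uq.2) m.
  clearbody Q; clear AE; elim: s s0 sQ => [|x s IH] s0 sQ.
    by exists 0%N => m _; rewrite !big_nil.
  have [||m1 h1] := IH.
  - by move=> y ys; apply: s0; rewrite inE ys orbT.
  - by move=> y ys; apply: sQ; rewrite inE ys orbT.
  have xs : x \in x :: s by rewrite inE eqxx.
  have [m2 h2] := @arith_prog_periodic x.1 x.2 Q (s0 x xs) (sQ x xs).
  exists (maxn m1 m2) => m; rewrite geq_max => /andP[l1 l2]; rewrite !big_cons.
  by split=> -[|] H; [left; apply/h2|right; apply/h1|left; apply/h2|right; apply/h1].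
exists Q, m0; split => // m mm; rewrite AE.
by apply/idP/idP; rewrite !in_setE => /h; exact.
Qed.

End Progressions.

(** * Density and fluctuation of an eventually periodic set *)
Section Density.
Variables (R : realType) (A : set nat) (Q m0 : nat).
Hypotheses (Q0 : (0 < Q)%N) (hA : forall m, (m0 <= m)%N -> ((m + Q)%N \in A) = (m \in A)).
Let QR : 0 < Q%:R :> R. Proof. by rewrite ltr0n. Qed.

(** The Q-periodic function that agrees with the indicator of A from m0 on
    ([residue_indicatorE]): the class of v modulo Q is tested at its representative in
    the range from Q m0 to Q m0 + Q, where periodicity has set in. *)
Definition residue_indicator (v : nat) : R := ((v %% Q + Q * m0)%N \in A)%:R.

Lemma residue_indicatorE v : (m0 <= v)%N -> residue_indicator v = (v \in A)%:R.
Proof.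
have it k m : (m0 <= m)%N -> ((m + Q * k)%N \in A) = (m \in A).
  move=> mm; elim: k => [|k IH]; first by rewrite muln0 addn0.
  by rewrite mulnS addnCA addnC hA // (leq_trans mm) // leq_addr.
move=> mv; rewrite /residue_indicator; congr (_%:R); congr nat_of_bool.
have vE := divn_eq v Q.
have [le|gt] := leqP m0 (v %/ Q).
  rewrite -(it (v %/ Q - m0)%N); last by apply: leq_trans (leq_addl _ _); rewrite leq_pmull.
  by rewrite -addnA -mulnDr subnKC // mulnC addnC -vE.
rewrite -(it (m0 - v %/ Q)%N v mv) mulnBr.
have le : (Q * (v %/ Q) <= Q * m0)%N by rewrite leq_mul2l (ltnW gt) orbT.
suff -> : (v + (Q * m0 - Q * (v %/ Q)) = v %% Q + Q * m0)%N by [].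
by move: vE le; move: (v %/ Q)%N (v %% Q)%N => t r; clear; lia.
Qed.

Definition residue_density : R := (\sum_(0 <= r < Q) residue_indicator r) / Q%:R.

Definition residue_fluct v : R := residue_indicator v - residue_density.

Lemma residue_fluct_mod v : residue_fluct (v %% Q) = residue_fluct v.
Proof. by rewrite /residue_fluct /residue_indicator modn_mod. Qed.

Lemma residue_fluct_sum : \sum_(0 <= r < Q) residue_fluct r = 0.
Proof.
rewrite sumrB sumr_const_nat subn0 -[_ *+ Q]mulr_natl /residue_density.
by rewrite mulrCA mulfV ?gt_eqF // mulr1 subrr.
Qed.

Lemma residue_fluct_norm v : `|residue_fluct v| <= 1 + `|residue_density|.
Proof.
apply: le_trans (ler_normB _ _) _; rewrite lerD2r /residue_indicator.
by case: (_ \in _); rewrite ?normr1 ?normr0.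
Qed.

Lemma residue_fluct_partial n :
  `|\sum_(0 <= m < n) residue_fluct m| <= Q%:R * (1 + `|residue_density|).
Proof.
have per k : \sum_(0 <= m < k * Q) residue_fluct m = 0.
  elim: k => [|k IH]; first by rewrite mul0n big_geq.
  rewrite mulSn addnC (big_cat_nat (n := (k * Q)%N)) ?leq_addr //= IH add0r.
  rewrite -{1}[(k * Q)%N]add0n big_addn addKn.
  transitivity (\sum_(0 <= r < Q) residue_fluct r); last exact: residue_fluct_sum.
  by apply: eq_bigr => m _; rewrite -residue_fluct_mod addnC modnMDl residue_fluct_mod.
rewrite (divn_eq n Q) (big_cat_nat (n := (n %/ Q * Q)%N)) ?leq_addr //= per add0r.
apply: le_trans (ler_norm_sum _ _ _) _.
apply: (@le_trans _ _ (\sum_(n %/ Q * Q <= m < n %/ Q * Q + n %% Q) (1 + `|residue_density|))).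
  by apply: ler_sum => m _; exact: residue_fluct_norm.
rewrite sumr_const_nat addKn -[leLHS]mulr_natl; apply: ler_wpM2r.
  by rewrite addr_ge0.
by rewrite ler_nat ltnW // ltn_mod.
Qed.

Lemma count_residue_density N :
  `|(count (fun m => m \in A) (iota 1 N))%:R - residue_density * N%:R|
  <= m0%:R + (Q%:R + 1) * (1 + `|residue_density|).
Proof.
have Fm0 : 0 <= 1 + `|residue_density| by rewrite addr_ge0.
have cE : (count (fun m => m \in A) (iota 1 N))%:R = \sum_(1 <= m < N.+1) (m \in A)%:R :> R.
  rewrite -sum1_count natr_sum big_mkcond /index_iota subn1 /=.
  by apply: eq_bigr => m _; case: (m \in A).
have -> : (count (fun m => m \in A) (iota 1 N))%:R - residue_density * N%:R
  = \sum_(1 <= m < N.+1) ((m \in A)%:R - residue_indicator m)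
    + (\sum_(0 <= m < N.+1) residue_fluct m - residue_fluct 0).
  rewrite cE (big_ltn (ltn0Sn N)) [_ + _ - residue_fluct 0]addrC addKr.
  rewrite -big_split /=.
  under [RHS]eq_bigr => m _ do rewrite /residue_fluct addrA subrK.
  by rewrite sumrB sumr_const_nat subn1 /= mulr_natr.
apply: le_trans (ler_normD _ _) _; apply: lerD.
  apply: le_trans (ler_norm_sum _ _ _) _.
  apply: (@le_trans _ _ (\sum_(0 <= m < N.+1 | (0 <= m < m0)%N) 1)).
    rewrite [leRHS]big_mkcond [leRHS]big_ltn //= -[leLHS]add0r; apply: lerD.
      by case: ifP.
    apply: ler_sum => m _; case: (ltnP m m0) => mm.
      by rewrite /residue_indicator; case: (_ \in _); case: (_ \in _); rewrite ?subrr ?normr0 ?subr0 ?sub0r ?normrN ?normr1.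
    by rewrite residue_indicatorE // subrr normr0.
  have := sum_between 0 m0 N.+1; rewrite subn0 -(ler_nat R) natr_sum.
  exact.
rewrite mulrDl mul1r; apply: le_trans (ler_normB _ _) _.
by apply: lerD; [exact: residue_fluct_partial|exact: residue_fluct_norm].
Qed.

Lemma natural_densityE : natural_density R A = residue_density.
Proof.
apply: cvg_lim => //; apply/cvgrPdist_le => eps eps0.
pose C := m0%:R + (Q%:R + 1) * (1 + `|residue_density|).
have C0 : 0 <= C by rewrite addr_ge0 ?mulr_ge0 ?addr_ge0.
exists (Num.bound (C / eps)).+1 => // N /= NN.
have N0 : 0 < N%:R :> R by rewrite ltr0n; exact: leq_trans NN.
have CN : C <= eps * N%:R.
  rewrite mulrC -ler_pdivrMr //; apply: le_trans (ltW (archi_boundP _)) _.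
    by rewrite divr_ge0 // ltW.
  by rewrite ler_nat ltnW.
have E (c : R) : c / N%:R - residue_density = (c - residue_density * N%:R) / N%:R.
  by field; rewrite gt_eqF.
rewrite distrC E normrM.
rewrite [`|N%:R^-1|]ger0_norm ?invr_ge0 // ler_pdivrMr //.
by apply: le_trans CN; exact: count_residue_density.
Qed.
End Density.

(** * The sum restricted to primes with valuation in A *)
Section Final.
Variables (R : realType) (A : set nat) (a b : R).
Hypotheses (hA : finite_union_of_arith_progs A) (ha : 0 <= a) (hab : a < b) (hb : b <= 1).

Definition restricted_sum n : R :=
  \sum_(0 <= p < n.+1 | [&& prime p, n%:R `^ a < p%:R :> R,
                                p%:R <= n%:R `^ b :> R
                              & logn p n`! \in A])
        (logn p n`!)%:R * ln (p%:R : R).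

(** The bounds n^a and n^b on primes may be replaced by their integer parts, whose
    logarithms differ by at most log 2 from a log n and b log n. *)
Lemma ln_trunc_power (x : R) n : 0 <= x -> (0 < n)%N ->
  (0 < Num.truncn (n%:R `^ x))%N /\ `|ln (Num.truncn (n%:R `^ x))%:R - x * ln n%:R| <= 1.
Proof.
move=> x0 n0; have n1 : 1 <= n%:R :> R by rewrite ler1n.
have y1 : 1 <= n%:R `^ x.
  by rewrite -[leLHS](powRr0 n%:R) ler_powR.
set y := n%:R `^ x in y1 *; have y0 : 0 <= y by rewrite (le_trans ler01).
have t0 : (0 < Num.truncn y)%N by rewrite truncn_gt0.
have tR : 0 < (Num.truncn y)%:R :> R by rewrite ltr0n.
split => //.
have /andP[t1 t2] := truncn_itv y0.
have -> : x * ln n%:R = ln y by rewrite /y ln_powR.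
have yp : 0 < y by exact: lt_le_trans y1.
have l1 : ln (Num.truncn y)%:R <= ln y by rewrite ler_ln ?posrE.
have l2 : ln y <= ln (2 * (Num.truncn y)%:R).
  rewrite ler_ln ?posrE ?mulr_gt0 //; apply: ltW; apply: lt_le_trans t2 _.
  have tr1 : 1 <= (Num.truncn y)%:R :> R by rewrite ler1n.
  by rewrite -(natr1 (Num.truncn y)); lra.
have l3 := ln2_le1 R.
rewrite lnM ?posrE // in l2.
by rewrite ler_norml; apply/andP; split; lra.
Qed.

Lemma mertens_interval al be n : (0 < al)%N -> (al <= be)%N -> (be <= n)%N ->
  `|\sum_(1 <= p < n.+1 | prime p) (if (al < p <= be)%N then ln p%:R / p%:R else 0)
   - (ln be%:R - ln al%:R)| <= 26 :> R.
Proof.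
move=> al0 ab bn.
have be0 : (0 < be)%N by exact: leq_trans ab.
pose g p : R := if prime p then ln p%:R / p%:R else 0.
have -> : \sum_(1 <= p < n.+1 | prime p) (if (al < p <= be)%N then ln p%:R / p%:R else 0)
  = \sum_(1 <= p < be.+1 | prime p) ln p%:R / p%:R - \sum_(1 <= p < al.+1 | prime p) ln p%:R / p%:R :> R.
  rewrite [X in X - _](big_cat_nat (n := al.+1)) //= addrAC subrr add0r.
  rewrite [RHS]big_mkcond [LHS]big_mkcond /=.
  have -> : \sum_(1 <= p < n.+1) (if prime p then if (al < p < be.+1)%N then ln p%:R / p%:R else 0 else 0)
     = \sum_(1 <= p < n.+1) (if (al.+1 <= p < be.+1)%N then g p else 0) :> R.
    by apply: eq_bigr => p _; rewrite /g; case: (prime p) => //; rewrite if_same.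
  by rewrite sum_mask (maxn_idPr _) // (minn_idPr _) // ltnS.
have h1 := mertens R be0; have h2 := mertens R al0.
move: h1 h2; set x := \sum_(1 <= p < be.+1 | _) _; set y := \sum_(1 <= p < al.+1 | _) _.
move=> h1 h2; rewrite ler_norml in h1; rewrite ler_norml in h2; rewrite ler_norml.
by case/andP: h1 => ? ?; case/andP: h2 => ? ?; apply/andP; split; lra.
Qed.

(** Replace v_p(n!) by n/p and the indicator of A by its density plus the fluctuation;
    the density yields the main term by Mertens' theorem, and the fluctuation is
    bounded by [weighted_sum_small]. *)
Lemma restricted_sum_asymptotic (eta : R) : 0 < eta ->
  exists2 C : R, 0 <= C & exists L0 : nat, forall n, (L0 <= trunc_log 2 n)%N -> (0 < n)%N ->
  `|restricted_sum n - (b - a) * natural_density R A * ln n`!%:R|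
    <= C * n%:R + eta * (n%:R * ln n%:R).
Proof.
move=> eta0; have [Q [m0 [Q0 per]]] := finite_union_periodic hA.
rewrite (natural_densityE R Q0 per).
set del := residue_density R A Q m0.
have [L0 hL] := weighted_sum_small Q0 (residue_fluct_mod R A Q m0) (residue_fluct_sum R A m0 Q0)
   (residue_fluct_norm R A Q m0) (divr_gt0 eta0 (ltr0n R 2)).
pose C := 4 * m0%:R + 12 + 28 * `|del| + `|b - a| * `|del|.
exists C; first by rewrite /C !addr_ge0 ?mulr_ge0.
exists L0 => n LL n0.
pose f := residue_fluct R A Q m0.
pose al := Num.truncn (n%:R `^ a); pose be := Num.truncn (n%:R `^ b).
have hb0 : 0 <= b by rewrite (le_trans ha) // ltW.
have [al0 alE] := ln_trunc_power ha n0; rewrite -/al in al0 alE.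
have [be0 beE] := ln_trunc_power hb0 n0; rewrite -/be in be0 beE.
have n1 : 1 <= n%:R :> R by rewrite ler1n.
have nR : 0 < n%:R :> R by rewrite ltr0n.
have alb : (al <= be)%N.
  rewrite truncn_ge_nat ?powR_ge0 //; apply: (@le_trans _ _ (n%:R `^ a)).
    by rewrite truncn_le powR_ge0.
  by rewrite ler_powR // ltW.
have ben : (be <= n)%N.
  rewrite -(ler_nat R); apply: (@le_trans _ _ (n%:R `^ b)).
    by rewrite truncn_le powR_ge0.
  by rewrite -[leRHS]powRr1 ?ler_powR // ltW.
have FE : restricted_sum n = \sum_(1 <= p < n.+1 | prime p)
   (if (al < p <= be)%N then ln p%:R * ((logn p n`!)%:R * (logn p n`! \in A)%:R) else 0).
  rewrite /restricted_sum big_mkcond big_ltn //= add0r [RHS]big_mkcond; apply: eq_bigr => p _.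
  rewrite -(truncn_lt_nat _ (powR_ge0 _ _)) -(truncn_ge_nat _ (powR_ge0 _ _)) -/al -/be.
  case: (prime p) => //=; rewrite andbA; case: (al < p <= be)%N => //=.
  by case: (_ \in _); rewrite ?mulr1 ?mulr0 // mulrC.
pose T := \sum_(1 <= p < n.+1) weighted f al be n p.
pose M := \sum_(1 <= p < n.+1 | prime p) (if (al < p <= be)%N then ln p%:R / p%:R else 0) : R.
have hT : `|T| <= eta / 2 * (trunc_log 2 n)%:R by exact: hL.
have hM := mertens_interval al0 alb ben; rewrite -/M in hM.
(* Cost of the two replacements: m0 log p for each prime, from the valuations below
   m0 where the indicator is not yet periodic, and the total error 12 n of
   v_p(n!) ~ n/p. *)
have main : `|restricted_sum n - (del * (n%:R * M) + n%:R * T)| <= (4 * m0%:R + 12) * n%:R.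
  have -> : restricted_sum n - (del * (n%:R * M) + n%:R * T) =
    \sum_(1 <= p < n.+1 | prime p) (if (al < p <= be)%N then
      ln p%:R * ((logn p n`!)%:R * ((logn p n`! \in A)%:R - residue_indicator R A Q m0 (logn p n`!))
        + ((logn p n`!)%:R - n%:R / p%:R) * residue_indicator R A Q m0 (logn p n`!)) else 0).
    have -> : T = \sum_(1 <= p < n.+1 | prime p)
        (if (al < p <= be)%N then ln p%:R / p%:R * f (logn p n`!) else 0).
      rewrite /T [RHS]big_mkcond; apply: eq_bigr => p _; rewrite /weighted.
      by case: (prime p).
    rewrite FE /M !mulr_sumr -big_split -sumrB; apply: eq_bigr => p _ /=.
    case: ifP => _; last by rewrite !mulr0 addr0 subrr.
    rewrite /f /residue_fluct -/del; set r := residue_indicator _ _ _ _ _; ring.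
  apply: le_trans (ler_norm_sum _ _ _) _.
  apply: (@le_trans _ _ (\sum_(1 <= p < n.+1 | prime p)
     (m0%:R * ln p%:R + ln p%:R * `|(logn p n`!)%:R - n%:R / p%:R|))).
    apply: ler_sum => p pp; have l0 := ln_nat_ge0 R p.
    have S0 : 0 <= m0%:R * ln p%:R + ln p%:R * `|(logn p n`!)%:R - n%:R / p%:R| :> R.
      by rewrite addr_ge0 ?mulr_ge0.
    case: ifP => _; last by rewrite normr0.
    rewrite normrM (ger0_norm l0) [m0%:R * _]mulrC -mulrDr; apply: ler_wpM2l => //.
    apply: le_trans (ler_normD _ _) _; apply: lerD.
      case: (leqP m0 (logn p n`!)) => mv.
        by rewrite (residue_indicatorE R Q0 per mv) subrr mulr0 normr0.
      rewrite normrM -[leRHS]mulr1; apply: ler_pM => //.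
        by rewrite ger0_norm // ler_nat ltnW.
      by rewrite /residue_indicator; case: (_ \in _); case: (_ \in _); rewrite ?subrr ?normr0 ?subr0 ?sub0r ?normrN ?normr1.
    rewrite normrM -[leRHS]mulr1; apply: ler_pM => //.
    by rewrite /residue_indicator; case: (_ \in _); rewrite ?normr0 ?normr1.
  rewrite big_split /= -mulr_sumr mulrDl; apply: lerD; last exact: sum_logn_approx.
  by rewrite [4 * _]mulrC -mulrA; apply: ler_wpM2l => //; exact: theta_le.
have hM2 : `|M - (b - a) * ln n%:R| <= 28.
  rewrite ler_norml in hM; rewrite ler_norml in alE; rewrite ler_norml in beE.
  case/andP: hM => ? ?; case/andP: alE => ? ?; case/andP: beE => ? ?.
  by rewrite ler_norml mulrBl; apply/andP; split; lra.
have /andP[f1 f2] := ln_fact_bounds R n0.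
have hF : `|n%:R * ln n%:R - ln n`!%:R| <= n%:R :> R by rewrite ler_norml; apply/andP; split; lra.
have logL := trunc_log2_le_ln R n0.
have -> : restricted_sum n - (b - a) * del * ln n`!%:R =
   (restricted_sum n - (del * (n%:R * M) + n%:R * T)) + n%:R * T
   + del * (n%:R * (M - (b - a) * ln n%:R)) + (b - a) * del * (n%:R * ln n%:R - ln n`!%:R) by ring.
apply: le_trans (ler_normD _ _) _.
apply: le_trans (lerD (ler_normD _ _) (lexx _)) _.
apply: le_trans (lerD (lerD (ler_normD _ _) (lexx _)) (lexx _)) _.
have p2 : `|n%:R * T| <= eta * (n%:R * ln n%:R).
  rewrite normrM (ger0_norm (ltW nR)) mulrCA; apply: ler_wpM2l; first exact: ltW.
  apply: le_trans hT _; have : eta / 2 * (trunc_log 2 n)%:R <= eta / 2 * (2 * ln n%:R).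
    by apply: ler_wpM2l => //; rewrite divr_ge0 // ltW.
  lra.
have p3 : `|del * (n%:R * (M - (b - a) * ln n%:R))| <= `|del| * (n%:R * 28).
  rewrite !normrM (ger0_norm (ltW nR)); apply: ler_wpM2l => //.
  by apply: ler_wpM2l => //; exact: ltW.
have p4 : `|(b - a) * del * (n%:R * ln n%:R - ln n`!%:R)| <= `|b - a| * `|del| * n%:R.
  by rewrite !normrM; apply: ler_wpM2l => //; rewrite mulr_ge0.
have := lerD (lerD (lerD main p2) p3) p4.
move/le_trans; apply; rewrite /C le_eqVlt; apply/orP; left; apply/eqP; ring.
Qed.

Lemma restricted_sum_ratio (eps : R) : 0 < eps ->
  exists N0 : nat, forall n, (N0 <= n)%N ->
    `|restricted_sum n / ln n`!%:R - (b - a) * natural_density R A| <= eps.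
Proof.
move=> eps0; have e8 : 0 < eps / 8 by rewrite divr_gt0.
have [C C0 [L0 h]] := restricted_sum_asymptotic e8.
pose X := 4 * C / eps + 2.
have X0 : 0 <= X by rewrite addr_ge0 // divr_ge0 ?mulr_ge0 // ltW.
pose k := maxn L0 (2 * Num.bound X).
exists (2 ^ k)%N => n kn.
have n0 : (0 < n)%N by apply: leq_trans kn; rewrite expn_gt0.
have nR : 0 < n%:R :> R by rewrite ltr0n.
have kL : (k <= trunc_log 2 n)%N by exact: trunc_log_max.
have lnX : X <= ln n%:R.
  apply: le_trans (ltW (archi_boundP X0)) _.
  apply: (@le_trans _ _ (k%:R * ln 2)).
    apply: (@le_trans _ _ (k%:R * 2^-1)); last by apply: ler_wpM2l => //; exact: ln2_ge_half.
    have : (2 * Num.bound X)%:R <= k%:R :> R by rewrite ler_nat leq_maxr.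
    rewrite natrM; lra.
  rewrite mulr_natl -lnXn // ler_ln ?posrE ?exprn_gt0 //.
  by rewrite -natrX ler_nat.
have ln2' : 2 <= ln n%:R :> R by apply: le_trans lnX; rewrite lerDr divr_ge0 ?mulr_ge0 // ltW.
have Ce : 4 * C <= eps * ln n%:R.
  have : 4 * C / eps <= ln n%:R by apply: le_trans lnX; rewrite lerDl.
  by rewrite ler_pdivrMr // [ln _ * _]mulrC.
have /andP[f1 _] := ln_fact_bounds R n0.
have big : n%:R * ln n%:R <= 2 * ln n`!%:R :> R.
  have : n%:R * 2 <= n%:R * ln n%:R :> R by apply: ler_wpM2l => //; exact: ltW.
  lra.
have P0 : 0 < n%:R * ln n%:R :> R by rewrite mulr_gt0 // (lt_le_trans _ ln2').
have F0 : 0 < ln n`!%:R :> R by lra.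
have := h n (leq_trans (leq_maxl _ _) kL) n0.
set S := restricted_sum n; set g := (b - a) * _ => hS.
have -> : S / ln n`!%:R - g = (S - g * ln n`!%:R) / ln n`!%:R by field; rewrite gt_eqF.
rewrite normrM [`|_^-1|]ger0_norm ?invr_ge0 ?(ltW F0) // ler_pdivrMr //.
apply: le_trans hS _.
have c1 : C * n%:R <= eps / 4 * (n%:R * ln n%:R).
  have := ler_wpM2r (ltW nR) Ce; set u := n%:R; set v := ln u.
  have -> : eps / 4 * (u * v) = eps * v * u / 4 by ring.
  lra.
have : eps / 2 * (n%:R * ln n%:R) <= eps / 2 * (2 * ln n`!%:R).
  by apply: ler_wpM2l => //; rewrite divr_ge0 // ltW.
have := mulr_gt0 eps0 P0; move: c1; set u := n%:R * ln _; set v := ln _`!%:R; lra.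
Qed.
End Final.

Local Open Scope classical_set_scope.

Theorem corollary1p2 (R : realType) (A : set nat) (a b : R)
    (hA : finite_union_of_arith_progs A)
    (ha : 0 <= a) (hab : a < b) (hb : b <= 1) :
  exists e : nat -> R,
    e @ \oo --> (0 : R) /\
    forall n : nat, (0 < n)%N ->
      \sum_(0 <= p < n.+1 | [&& prime p, n%:R `^ a < p%:R :> R,
                                p%:R <= n%:R `^ b :> R
                              & logn p n`! \in A])
        (logn p n`!)%:R * ln (p%:R : R)
      = ((b - a) * natural_density R A + e n) * ln (n`!%:R : R).
Proof.
exists (fun n => restricted_sum A a b n / ln n`!%:R - (b - a) * natural_density R A); split.
  apply/cvgrPdist_le => eps eps0.
  have [N0 h] := restricted_sum_ratio hA ha hab hb eps0.
  by exists N0 => // n /= nN; rewrite sub0r normrN; exact: h.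
move=> n n0; rewrite -/(restricted_sum A a b n) addrC subrK.
(* For n = 1 both sides vanish, as log n! = 0 and there are no primes up to n. *)
have [n1|n1] := leqP n 1.
  have -> : n = 1%N by apply/eqP; rewrite eqn_leq n1.
  have -> : 1`!%:R = 1 :> R by [].
  rewrite ln1 mulr0 /restricted_sum big_nat_cond big1 // => p.
  by move=> /andP[/andP[_ p1] /andP[/prime_gt1]]; rewrite ltnNge -ltnS p1.
rewrite mulfVK // gt_eqF // ln_gt0 // ltr1n.
by apply: leq_trans n1 _; rewrite dvdn_leq ?fact_gt0 // dvdn_fact // n0 leqnn.
Qed.
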